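(* Let $p\ge3$ be a prime, let $g\ge1$, let $l$ be an integer with $g-p+2\le l\le g$, and put $\hat l=2(g-p+1)-l$. Then there is a resolution of $\mathrm{Sp}(2g,\mathbb Z)$-representations over $\mathbb F_p$ given by an exact sequence $$\cdots\to V_p(\varpi_{l-4p})\to V_p(\varpi_{\hat l-2p})\to V_p(\varpi_{l-2p})\to V_p(\varpi_{\hat l})\to V_p(\varpi_l)\to\overline V_p(\varpi_l)\to0 .$$
   Context: Let $H=\mathbb Z^{2g}$ be the fundamental representation of $\mathrm{Sp}(2g,\mathbb Z)$ with symplectic basis $a_1,\dots,a_g,b_1,\dots,b_g$. For $0\le k\le g$, $V(\varpi_k)\subset\bigwedge^kH$ is the subrepresentation generated by the highest weight vector $a_1\wedge\cdots\wedge a_k$ (over $\mathbb R$ this is the irreducible representation of fundamental highest weight $\varpi_k=\epsilon_1+\dots+\epsilon_k$). $V_p(\varpi_k)=V(\varpi_k)/pV(\varpi_k)$ is its $p$-modular reduction, and $\overline V_p(\varpi_k)$ is the unique irreducible subquotient over $\mathbb F_p$ generated by (the image of) the same highest weight vector. For negative indices, $V_p(\varpi_k)=0$ and $\overline V_p(\varpi_k)=0$. In the sequence the indices alternate: $l,\ \hat l,\ l-2p,\ \hat l-2p,\ l-4p,\ \hat l-4p,\dots$ *)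

(* Defs.v *)
From HB Require Import structures.
From mathcomp Require Import all_boot all_order all_algebra.
From mathcomp Require Import perm boolp generic_quotient ring_quotient.

Set Implicit Arguments.
Unset Strict Implicit.
Unset Printing Implicit Defensive.

Import GRing.Theory.
Local Open Scope ring_scope.

(* H = Z^(g+g) consists of column vectors; the standard basis is
   a_1, .., a_g, b_1, .., b_g, in this order, and (a_i, b_j) = delta_ij. *)
Definition sympl_mx (g : nat) : 'M[int]_(g + g) :=
  block_mx 0 1%:M (- 1%:M) 0.

Definition Sp (g : nat) : Type :=
  {A : 'M[int]_(g + g) | A^T *m sympl_mx g *m A == sympl_mx g}.

HB.instance Definition _ g := Choice.on (Sp g).

Section SpGroup.
Variable g : nat.
Local Notation J := (sympl_mx g).

Lemma sympl_mx_sqr : J *m J = - 1%:M.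
Proof.
rewrite /sympl_mx mulmx_block !mul0mx !mulmx0 !mul1mx !mulmx1 !addr0 !add0r.
by rewrite (scalar_mx_block g g 1) opp_block_mx !oppr0.
Qed.

Lemma SpP (A : Sp g) : (val A)^T *m J *m val A = J.
Proof. exact/eqP/(valP A). Qed.

Lemma Sp_one_subproof : (1%:M)^T *m J *m 1%:M == J.
Proof. by rewrite trmx1 mul1mx mulmx1. Qed.

Lemma Sp_mul_subproof (A B : Sp g) :
  (val A *m val B)^T *m J *m (val A *m val B) == J.
Proof.
rewrite trmx_mul !mulmxA -2!(mulmxA (val B)^T).
by rewrite SpP SpP.
Qed.

Definition Sp_inv_mx (A : 'M[int]_(g + g)) := - (J *m A^T *m J).

Lemma Sp_mulVmx (A : Sp g) : Sp_inv_mx (val A) *m val A = 1%:M.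
Proof.
by rewrite mulNmx -!mulmxA [_ *m (J *m _)]mulmxA SpP sympl_mx_sqr opprK.
Qed.

Lemma Sp_mulmxV (A : Sp g) : val A *m Sp_inv_mx (val A) = 1%:M.
Proof. exact/mulmx1C/Sp_mulVmx. Qed.

Lemma Sp_inv_subproof (A : Sp g) :
  (Sp_inv_mx (val A))^T *m J *m Sp_inv_mx (val A) == J.
Proof.
set B := Sp_inv_mx _; rewrite -{1}(SpP A) !mulmxA -trmx_mul.
by rewrite -!mulmxA !Sp_mulmxV trmx1 mul1mx mulmx1.
Qed.

Definition Sp_one : Sp g := Sub 1%:M Sp_one_subproof.
Definition Sp_mul (A B : Sp g) : Sp g := Sub (val A *m val B) (Sp_mul_subproof A B).
Definition Sp_inv (A : Sp g) : Sp g := Sub (Sp_inv_mx (val A)) (Sp_inv_subproof A).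

Lemma Sp_mulA : associative Sp_mul.
Proof. by move=> A B C; apply/val_inj; rewrite /= mulmxA. Qed.
Lemma Sp_mul1 : left_id Sp_one Sp_mul.
Proof. by move=> A; apply/val_inj; rewrite /= mul1mx. Qed.
Lemma Sp_mulr1 : right_id Sp_one Sp_mul.
Proof. by move=> A; apply/val_inj; rewrite /= mulmx1. Qed.
Lemma Sp_mulV : left_inverse Sp_one Sp_inv Sp_mul.
Proof. by move=> A; apply/val_inj; rewrite /= Sp_mulVmx. Qed.
Lemma Sp_mulrV : right_inverse Sp_one Sp_inv Sp_mul.
Proof. by move=> A; apply/val_inj; rewrite /= Sp_mulmxV. Qed.

HB.instance Definition _ := isGroup.Build (Sp g)
  Sp_mulA Sp_mul1 Sp_mulr1 Sp_mulV Sp_mulrV.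

End SpGroup.

Definition incr (k n : nat) : Type :=
  {f : {ffun 'I_k -> 'I_n} | [forall i : 'I_k, forall j : 'I_k, (i < j)%N ==> (f i < f j)%N]}.

HB.instance Definition _ k n := Finite.on (incr k n).

(* The k-th exterior power of Z^n, in coordinates: s : incr k n, that is
   s_1 < .. < s_k, indexes the basis vector e_(s_1) /\ .. /\ e_(s_k). *)
Definition ext (k n : nat) : Type := {ffun incr k n -> int}.

HB.instance Definition _ k n := GRing.Zmodule.on (ext k n).

(* The wedge product of the k columns of X: its coordinates are the maximal
   minors of X. *)
Definition wedge (k n : nat) (X : 'M[int]_(n, k)) : ext k n :=
  [ffun s : incr k n => \det (rowsub (val s) X)].

(* A sends e_(s_1) /\ .. /\ e_(s_k) to A e_(s_1) /\ .. /\ A e_(s_k), and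
   A e_i is the i-th column of A. *)
Definition ext_act (k m n : nat) (A : 'M[int]_(m, n)) (x : ext k n) : ext k m :=
  \sum_(s : incr k n) wedge (colsub (val s) A) *~ x s.

Section CauchyBinet.

Lemma det_mulmx_ffun (k n : nat) (B : 'M[int]_(k, n)) (X : 'M[int]_(n, k)) :
  \det (B *m X) =
  \sum_(f : {ffun 'I_k -> 'I_n}) (\prod_i B i (f i)) * \det (rowsub f X).
Proof.
rewrite /determinant.
transitivity (\sum_(s : 'S_k) \sum_(f : {ffun 'I_k -> 'I_n})
   (-1) ^+ s * (\prod_i (B i (f i) * X (f i) (s i)))).
  apply: eq_bigr => s _; rewrite -big_distrr /=; congr (_ * _).
  under eq_bigr => i _ do rewrite mxE.
  by rewrite bigA_distr_bigA.
rewrite exchange_big /=; apply: eq_bigr => f _.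
rewrite big_distrr /=; apply: eq_bigr => s _.
rewrite big_split /= mulrCA; congr (_ * (_ * _)).
by apply: eq_bigr => i _; rewrite mxE.
Qed.

Lemma det_rowsub_perm (k n : nat) (f : 'I_k -> 'I_n) (s : 'S_k) (X : 'M[int]_(n, k)) :
  \det (rowsub (f \o s) X) = (-1) ^+ s * \det (rowsub f X).
Proof.
have -> : rowsub (f \o s) X = row_perm s (rowsub f X).
  by apply/matrixP => i j; rewrite !mxE.
by rewrite row_permE det_mulmx det_perm.
Qed.

Lemma incr_inj k n (s : incr k n) : injective (val s).
Proof.
move=> i j eq_ij; apply/val_inj => /=.
have H := forallP (valP s).
case: (ltngtP i j) => // lt_ij.
  by have := implyP (forallP (H i) j) lt_ij; rewrite eq_ij ltnn.
by have := implyP (forallP (H j) i) lt_ij; rewrite eq_ij ltnn.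
Qed.

Lemma incr_sorted k n (s : incr k n) : sorted ltn (map val (codom (val s))).
Proof.
rewrite codomE -map_comp.
apply: (@homo_sorted _ _ _ (relpre val ltn)) => [i j lt_ij|].
  exact: (implyP (forallP (forallP (valP s) i) j) lt_ij).
by rewrite -sorted_map val_enum_ord iota_ltn_sorted.
Qed.

Lemma incr_perm_inj k n (s1 s2 : incr k n) (u1 u2 : 'S_k) :
  val s1 \o u1 =1 val s2 \o u2 -> (s1, u1) = (s2, u2).
Proof.
move=> eq_su.
have eq_s : s1 = s2.
  apply/val_inj/ffunP => i.
  suff /(congr1 (fun c => map val c)) : codom (val s1) = codom (val s2).
    rewrite !codomE -!map_comp => /eq_in_map H.
    by apply/val_inj/H; rewrite -enumT mem_enum.
  apply: (inj_map val_inj).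
  apply: (irr_sorted_eq ltn_trans ltnn); rewrite ?incr_sorted //.
  have sub (t1 t2 : incr k n) (v1 v2 : 'S_k) : val t1 \o v1 =1 val t2 \o v2 ->
      {subset map val (codom (val t1)) <= map val (codom (val t2))}.
    move=> eq_t _ /mapP[_ /codomP[j ->] ->]; apply: map_f.
    by have := eq_t ((v1^-1)%g j); rewrite /= permKV => ->; apply: codom_f.
  by move=> y; apply/idP/idP; [apply: (sub _ _ _ _ eq_su) | apply: (sub _ _ _ _ (fsym eq_su))].
rewrite {}eq_s in eq_su *; congr (_, _); apply/permP => i.
exact: (incr_inj (eq_su i)).
Qed.

Lemma incr_perm_ex k n (f : {ffun 'I_k -> 'I_n}) : injective f ->
  exists u : incr k n * 'S_k, [ffun i => val u.1 (u.2 i)] = f.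
Proof.
move=> f_inj; set A := [set f i | i in 'I_k].
have cA : #|A| = k by rewrite card_imset ?card_ord.
have fA i : f i \in A by apply: imset_f.
pose s := [ffun i : 'I_k => enum_val (cast_ord (esym cA) i)].
have inc_A : sorted ltn (map val (enum A)).
  rewrite -[enum _](eq_filter (mem_enum _)).
  rewrite -(eq_filter (mem_map val_inj _)) -filter_map.
  by rewrite (sorted_filter ltn_trans) // unlock val_ord_enum iota_ltn_sorted.
have s_incr : [forall i : 'I_k, forall j : 'I_k, (i < j)%N ==> (s i < s j)%N].
  apply/forallP => i; apply/forallP => j; apply/implyP => lt_ij.
  have x0 : 'I_n := f i.
  rewrite !ffunE !(enum_val_nth x0) /=.
  have sz l : (l < k)%N -> (l < size (enum A))%N by rewrite -cardE cA.
  rewrite -!(nth_map x0 0%N val) ?sz //.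
  by apply: (sorted_ltn_nth ltn_trans) => //; rewrite inE size_map ?sz.
pose u i := cast_ord cA (enum_rank_in (fA i) (f i)).
have su i : s (u i) = f i by rewrite ffunE cast_ordK enum_rankK_in.
have u_inj : injective u by move=> i j eq_u; apply: f_inj; rewrite -!su eq_u.
exists (Sub s s_incr, perm u_inj); apply/ffunP => i.
by rewrite ffunE /= permE su.
Qed.

Lemma det_mulmx_incr (k n : nat) (B : 'M[int]_(k, n)) (X : 'M[int]_(n, k)) :
  \det (B *m X) =
  \sum_(s : incr k n) \det (colsub (val s) B) * \det (rowsub (val s) X).
Proof.
rewrite det_mulmx_ffun (bigID (fun f : {ffun 'I_k -> 'I_n} => injectiveb f)) /=.
rewrite [X in _ + X]big1 ?addr0; last first.
  move=> f /injectivePn[i [j neq_ij eq_f]].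
  rewrite (determinant_alternate neq_ij) ?mulr0 // => l.
  by rewrite !mxE eq_f.
pose h (u : incr k n * 'S_k) : {ffun 'I_k -> 'I_n} := [ffun i => val u.1 (u.2 i)].
pose G (f : {ffun 'I_k -> 'I_n}) := (\prod_i B i (f i)) * \det (rowsub f X).
transitivity (\sum_u G (h u)); last first.
  rewrite -(pair_big predT predT (fun s v => G (h (s, v)))) /=.
  apply: eq_bigr => s _; rewrite /determinant big_distrl /=.
  apply: eq_bigr => v _; rewrite /G.
  have -> : \det (rowsub (h (s, v)) X) = (-1) ^+ v * \det (rowsub (val s) X).
    rewrite -det_rowsub_perm; congr (\det _).
    by apply/matrixP => i j; rewrite !mxE ffunE.
  rewrite mulrCA mulrA; congr (_ * _ * _).
  by apply: eq_bigr => i _; rewrite !mxE ffunE.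
rewrite (partition_big h (fun f => injectiveb f)) /=; last first.
  move=> [s v] _; apply/injectiveP => i j; rewrite !ffunE /=.
  by move/incr_inj/perm_inj.
apply: eq_bigr => f /injectiveP/incr_perm_ex[u def_f].
rewrite (big_pred1 u) ?def_f // => [|w]; first by rewrite -/(h u) /h def_f.
apply/eqP/eqP => [eq_hf|->]; last exact: def_f.
case: w u def_f eq_hf => [s1 u1] [s2 u2] /ffunP E2 /ffunP E1.
by apply: incr_perm_inj => i; have := E1 i; rewrite -E2 !ffunE.
Qed.

End CauchyBinet.

Lemma ext_act_wedge (k m n : nat) (A : 'M[int]_(m, n)) (X : 'M[int]_(n, k)) :
  ext_act A (wedge X) = wedge (A *m X).
Proof.
apply/ffunP => t; rewrite /ext_act sum_ffunE ffunE.
rewrite -[rowsub _ (A *m X)]mul_rowsub_mx det_mulmx_incr.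
apply: eq_bigr => s _; rewrite ffunMzE !ffunE mulrzz.
by congr (\det _ * _); apply/matrixP => i j; rewrite !mxE.
Qed.

Section ExtAct.
Variable k : nat.

Lemma ext_act_is_zmod_morphism (m n : nat) (A : 'M[int]_(m, n)) :
  zmod_morphism (@ext_act k m n A).
Proof.
move=> x y; rewrite /ext_act -sumrB; apply: eq_bigr => s _.
by rewrite !ffunE mulrzBr.
Qed.

HB.instance Definition _ (m n : nat) (A : 'M[int]_(m, n)) :=
  GRing.isZmodMorphism.Build (ext k n) (ext k m) (@ext_act k m n A)
    (@ext_act_is_zmod_morphism m n A).

Lemma wedge_colsub1 n (s : incr k n) :
  wedge (colsub (val s) 1%:M) = [ffun t : incr k n => (t == s)%:R].
Proof.
apply/ffunP => t; rewrite !ffunE; case: eqP => [->|neq_ts].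
  rewrite -[RHS](det1 _ k); congr (\det _); apply/matrixP => i j.
  by rewrite !mxE (inj_eq (@incr_inj _ _ s)).
have [i t_i] : exists i, val t i \notin codom (val s).
  apply/existsP; rewrite -negb_forall; apply/negP => /forallP t_s.
  have sub : {subset codom (val t) <= codom (val s)} by move=> _ /codomP[i ->].
  have ut : uniq (codom (val t)).
    by rewrite map_inj_uniq ?enum_uniq //; apply: incr_inj.
  have [|_ eq_c] := uniq_min_size ut sub; first by rewrite !size_codom.
  have eq_codom : codom (val t) = codom (val s).
    apply/(inj_map val_inj)/(irr_sorted_eq ltn_trans ltnn) => [||y];
      rewrite ?incr_sorted //.
    by apply/mapP/mapP => -[x x_in ->]; exists x; rewrite ?eq_c // -eq_c.
  apply: neq_ts; apply/val_inj/ffunP => i.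
  move: eq_codom; rewrite !codomE -!map_comp => /eq_in_map.
  by apply; rewrite -enumT mem_enum.
rewrite (expand_det_row _ i) big1 // => j _; rewrite !mxE.
by case: eqP t_i => [->|_ _]; rewrite ?codom_f // mul0r.
Qed.

Lemma ext_act1 n (x : ext k n) : ext_act 1%:M x = x.
Proof.
apply/ffunP => t; rewrite /ext_act sum_ffunE (bigD1 t) //= big1 => [|s neq_st].
  by rewrite addr0 wedge_colsub1 ffunMzE ffunE eqxx mulrzz mul1r.
by rewrite wedge_colsub1 ffunMzE ffunE eq_sym (negPf neq_st) mul0rz.
Qed.

Lemma ext_actM l m n (A : 'M[int]_(l, m)) (B : 'M[int]_(m, n)) (x : ext k n) :
  ext_act (A *m B) x = ext_act A (ext_act B x).
Proof.
rewrite [ext_act B x]/ext_act raddf_sum; apply: eq_bigr => s _.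
by rewrite raddfMz /= ext_act_wedge mulmx_colsub.
Qed.

End ExtAct.

Section HighestWeight.
Variables g k : nat.

(* a_1 /\ .. /\ a_k (for k <= g) *)
Definition hw_vec : ext k (g + g) :=
  wedge (\matrix_(i < g + g, j < k) (i == j :> nat)%:R).

(* The Sp(2g, Z)-submodule of the k-th exterior power of H generated by the
   highest weight vector. *)
Inductive in_V : ext k (g + g) -> Prop :=
| in_V_hw : in_V hw_vec
| in_V_sub x y : in_V x -> in_V y -> in_V (x - y)
| in_V_act (A : Sp g) x : in_V x -> in_V (ext_act (val A) x).

Definition V_pred : {pred ext k (g + g)} := fun x => `[< in_V x >].

Lemma V_pred_zmod_closed : zmod_closed V_pred.
Proof.
split=> [|x y]; last first.
  by rewrite !unfold_in => /asboolP ? /asboolP ?; apply/asboolP/in_V_sub.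
by apply/asboolP; rewrite -(subrr hw_vec); apply: in_V_sub; apply: in_V_hw.
Qed.

HB.instance Definition _ := GRing.isZmodClosed.Build (ext k (g + g)) V_pred
  V_pred_zmod_closed.

Definition V : Type := {x : ext k (g + g) | x \in V_pred}.

HB.instance Definition _ := SubChoice.on V.
HB.instance Definition _ := [SubChoice_isSubZmodule of V by <:].

Lemma V_hw_subproof : hw_vec \in V_pred.
Proof. exact/asboolP/in_V_hw. Qed.

Definition V_hw : V := Sub hw_vec V_hw_subproof.

Lemma V_act_subproof (A : Sp g) (x : V) : ext_act (val A) (val x) \in V_pred.
Proof. exact/asboolP/in_V_act/asboolP/(valP x). Qed.

Definition V_act (A : Sp g) (x : V) : V :=
  Sub (ext_act (val A) (val x)) (V_act_subproof A x).

Lemma V_act_is_zmod_morphism A : zmod_morphism (V_act A).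
Proof. by move=> x y; apply/val_inj; rewrite /= !raddfB. Qed.

HB.instance Definition _ A := GRing.isZmodMorphism.Build V V (V_act A)
  (V_act_is_zmod_morphism A).

Lemma V_act1 x : V_act 1%g x = x.
Proof. by apply/val_inj; rewrite /= ext_act1. Qed.

Lemma V_actM A B x : V_act (A * B)%g x = V_act A (V_act B x).
Proof. by apply/val_inj; rewrite /= ext_actM. Qed.

End HighestWeight.

Record rep (F : fieldType) (G : groupType) := Rep {
  rep_space :> lmodType F;
  rep_act : G -> {linear rep_space -> rep_space};
  rep_act1 : forall x, rep_act 1%g x = x;
  rep_actM : forall a b x, rep_act (a * b)%g x = rep_act a (rep_act b x)
}.

Arguments rep_act {F G r}.

Section Representations.
Variables (F : fieldType) (G : groupType).
Implicit Types U W : rep F G.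

Record rep_hom U W := RepHom {
  rep_fun :> {linear U -> W};
  rep_funE : forall a x, rep_fun (rep_act a x) = rep_act a (rep_fun x)
}.

Definition subrep U (N : U -> Prop) : Prop :=
  [/\ N 0,
      forall (c : F) x y, N x -> N y -> N (c *: x + y) &
      forall a x, N x -> N (rep_act a x)].

Definition generates U (x : U) : Prop :=
  forall N : U -> Prop, subrep N -> N x -> forall y, N y.

Definition irreducible U : Prop :=
  (exists x : U, x != 0) /\
  forall N : U -> Prop, subrep N ->
    (forall x, N x -> x = 0) \/ (forall x, N x).

(* W is (isomorphic to) a subquotient N / ker f of U, where N is a
   subrepresentation containing v, and is generated by the image of v. The
   map f matters only on N. *)
Definition subquotient_generated_by U (v : U) W : Prop :=
  exists (N : U -> Prop) (f : U -> W),
  [/\ subrep N, N v,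
      forall (c : F) x y, N x -> N y -> f (c *: x + y) = c *: f x + f y,
      forall a x, N x -> f (rep_act a x) = rep_act a (f x) &
      generates (f v)].

Lemma zero_rep_subproof (x : 'rV[F]_0) : idfun x = x. Proof. by []. Qed.

Definition zero_rep : rep F G :=
  @Rep F G 'rV[F]_0 (fun _ => idfun) zero_rep_subproof
    (fun _ _ => zero_rep_subproof).

(* .. -> C 2 -> C 1 -> C 0 -> W -> 0 is exact for suitable maps. *)
Definition has_resolution (C : nat -> rep F G) W : Prop :=
  exists (d : forall n, rep_hom (C n.+1) (C n)) (e : rep_hom (C 0) W),
  [/\ forall w, exists x, e x = w,
      forall x, e x = 0 <-> exists y, d 0 y = x &
      forall n x, d n x = 0 <-> exists y, d n.+1 y = x].

End Representations.

Section ModularReduction.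
Variables (p : nat) (p_prime : prime p) (g k : nat).
Local Notation V := (V g k).

Definition pV : {pred V} := fun x => `[< exists y, x = y *+ p >].

Lemma pV_zmod_closed : zmod_closed pV.
Proof.
split=> [|x y]; first by apply/asboolP; exists 0; rewrite mul0rn.
rewrite !unfold_in => /asboolP[x' ->] /asboolP[y' ->]; apply/asboolP.
by exists (x' - y'); rewrite mulrnBl.
Qed.

HB.instance Definition _ := GRing.isZmodClosed.Build V pV pV_zmod_closed.

Definition VmodpV (_ : prime p) : Type := {ideal_quot pV}.
Local Notation Q := (VmodpV p_prime).

HB.instance Definition _ := GRing.Zmodule.on Q.

Definition V_pi : V -> Q := fun x => \pi_({ideal_quot pV})%qT x.

Lemma V_pi_is_zmod_morphism : zmod_morphism V_pi.
Proof. exact: raddfB. Qed.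

HB.instance Definition _ := GRing.isZmodMorphism.Build V Q V_pi
  V_pi_is_zmod_morphism.

Lemma V_piP (q : Q) : exists x, V_pi x = q.
Proof. by exists (repr (q : {ideal_quot pV})); apply: reprK. Qed.

Lemma V_pi_eq0 x : V_pi x = 0 <-> exists y, x = y *+ p.
Proof.
have -> : (V_pi x = 0) <-> (x \in pV : Prop).
  rewrite -{2}[x]subr0 Quotient.idealrBE; split=> [/eqP|/eqP //].
    by rewrite -(raddf0 V_pi).
  by rewrite -(raddf0 V_pi).
by split=> [/asboolP|?]; last exact/asboolP.
Qed.

Lemma VmodpV_mulp (q : Q) : q *+ p = 0.
Proof. by have [x <-] := V_piP q; rewrite -raddfMn; apply/V_pi_eq0; exists x. Qed.

Lemma VmodpV_mulnmod (q : Q) n : q *+ (n %% p) = q *+ n.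
Proof.
by rewrite [in RHS](divn_eq n p) mulrnDr mulnC mulrnA VmodpV_mulp mul0rn add0r.
Qed.

Definition VmodpV_scale (c : 'F_p) (q : Q) : Q := q *+ c.

Lemma VmodpV_scaleA c d q :
  VmodpV_scale c (VmodpV_scale d q) = VmodpV_scale (c * d) q.
Proof.
by rewrite /VmodpV_scale -mulrnA /= [X in _ *+ (_ %% X)]Fp_cast // VmodpV_mulnmod mulnC.
Qed.

Lemma VmodpV_scale1 : left_id 1 VmodpV_scale.
Proof.
move=> q; rewrite /VmodpV_scale /= [X in _ *+ (_ %% X)]Fp_cast //.
by rewrite VmodpV_mulnmod.
Qed.

Lemma VmodpV_scaleDr : right_distributive VmodpV_scale +%R.
Proof. by move=> c x y; rewrite /VmodpV_scale mulrnDl. Qed.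

Lemma VmodpV_scaleDl q : {morph VmodpV_scale^~ q : c d / c + d}.
Proof.
move=> c d; rewrite /VmodpV_scale /= [X in _ *+ (_ %% X)]Fp_cast //.
by rewrite VmodpV_mulnmod mulrnDr.
Qed.

HB.instance Definition _ := GRing.Zmodule_isLmodule.Build 'F_p Q
  VmodpV_scaleA VmodpV_scale1 VmodpV_scaleDr VmodpV_scaleDl.

Definition VmodpV_act (A : Sp g) (q : Q) : Q :=
  V_pi (V_act A (repr (q : {ideal_quot pV}))).

Lemma VmodpV_act_pi A x : VmodpV_act A (V_pi x) = V_pi (V_act A x).
Proof.
apply/eqP; rewrite -subr_eq0 -raddfB -raddfB; apply/eqP.
set z := _ - x; have /V_pi_eq0[y ->] : V_pi z = 0.
  by rewrite raddfB; apply/eqP; rewrite subr_eq0; apply/eqP/reprK.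
by apply/V_pi_eq0; exists (V_act A y); rewrite raddfMn.
Qed.

Lemma VmodpV_act_is_linear A : linear (VmodpV_act A).
Proof.
move=> c q r; have [[x <-] [y <-]] := (V_piP q, V_piP r).
rewrite -[c *: V_pi x]raddfMn -raddfD !VmodpV_act_pi.
by rewrite raddfD raddfMn raddfD raddfMn.
Qed.

HB.instance Definition _ A := GRing.isLinear.Build 'F_p Q Q *:%R (VmodpV_act A)
  (VmodpV_act_is_linear A).

Lemma VmodpV_act1 q : VmodpV_act 1%g q = q.
Proof. by have [x <-] := V_piP q; rewrite VmodpV_act_pi V_act1. Qed.

Lemma VmodpV_actM A B q :
  VmodpV_act (A * B)%g q = VmodpV_act A (VmodpV_act B q).
Proof. by have [x <-] := V_piP q; rewrite !VmodpV_act_pi V_actM. Qed.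

Definition VmodpV_rep : rep 'F_p (Sp g) :=
  @Rep 'F_p (Sp g) Q (fun A => VmodpV_act A) VmodpV_act1 VmodpV_actM.

End ModularReduction.

(* V_p(varpi_k), which is zero for k < 0. *)
Definition Vp (p : nat) (p_prime : prime p) (g : nat) (k : int) :
    rep 'F_p (Sp g) :=
  match k with
  | Posz n => VmodpV_rep p_prime g n
  | Negz _ => zero_rep 'F_p (Sp g)
  end.

(* W is a model of \bar V_p(varpi_k), which is zero for k < 0. *)
Definition is_Vbar (p : nat) (p_prime : prime p) (g : nat) (k : int)
    (W : rep 'F_p (Sp g)) : Prop :=
  match k with
  | Posz n =>
      irreducible W /\
      subquotient_generated_by
        (V_pi p_prime (V_hw g n) : VmodpV_rep p_prime g n) W
  | Negz _ => forall w : W, w = 0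
  end.

(* The sequence l, l', l - 2p, l' - 2p, l - 4p, .. *)
Fixpoint res_index (p : nat) (l l' : int) (n : nat) : int :=
  match n with
  | 0 => l
  | 1 => l'
  | n'.+2 => res_index p l l' n' - 2 * p%:Z
  end.

(* Main.v *)
From HB Require Import structures.
Require Import Defs.
From mathcomp Require Import all_boot all_order all_algebra.
From mathcomp Require Import ring zify.
From mathcomp Require Import fingroup perm boolp generic_quotient ring_quotient.

Set Implicit Arguments.
Unset Strict Implicit.
Unset Printing Implicit Defensive.

Import Order.TTheory GRing.Theory Num.Theory.
Local Open Scope ring_scope.

(* Work in the exterior algebra of R^(2g), for R = Z or R = F_p, and let
   E be the wedge product with omega = sum_i a_i /\ b_i, which commutes with
   Sp(2g, Z). The lattice V(varpi_k) is the kernel of the adjoint of E; modulo p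
   it becomes the common kernel of all divided powers of that adjoint, because
   over both rings this kernel is spanned by the vectors
   prod (a_s /\ b_s - a_t /\ b_t) /\ a_A /\ b_B, which lie in the orbit lattice.
   The maps of the resolution are powers E^c with 0 < c < p, alternately
   c = p - 1 - (g - l) and its complement to p, and E^p = 0.

   For disjoint A and B, the coefficients of a vector on the basis elements
   (prod_(i in K) a_i /\ b_i) /\ a_A /\ b_B form a function of the subset K of
   U = ~: (A :|: B), and E becomes the operator adding one element to K. Exactness
   is thus a statement about functions on subsets of a finite set, proved by
   induction on that set. The same induction shows that the radical of the standard
   bilinear form on V_p(varpi_l) is the image of E^(p - 1 - (g - l)). Finally every
   proper subrepresentation of V_p(varpi_l) lies in this radical: the elements
   (t - 1)(t' - 1) of the group ring, for transvections t and t' along a_i and b_i,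
   project onto the terms containing a_i but not b_i, so that a vector that is not
   orthogonal to V_p(varpi_l) generates the highest weight vector. *)

(** * Functions on the subsets of a finite set *)

(** The functions on subsets of U form a tensor power of the two-dimensional representation of sl_2,
    one factor per element of U, with E = [raise U] and its adjoint F. If w is killed by F and has
    weight m = #|U| - 2 #|S|, then F E^c w = c (m - c + 1) E^(c-1) w. So for 0 < c < p the vector
    E^c w can be primitive again exactly when m + 1 = c modulo p; its own weight plus one is then -c
    modulo p. This fixes the exponents and makes them alternate between c and p - c.

    The obstacle is that F^t = t! F^(t) says nothing about the divided power F^(t) once t >= p.
    Primitivity is therefore stated through the sums [ssum], which are divided powers over any ring,
    and its spanning vectors are produced without division, so that one argument serves Z and F_p.

    Splitting off an index splits off a tensor factor and changes m by one. The induction for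
    exactness thus has to treat all c together: the derivative in the index leads to c + 1, the
    remaining part to c - 1. At the right end of the complex no power of E leaves the module;
    membership in the radical takes the place of E^c f = 0 and is carried through the same
    induction. *)

Section Raising.
Variables (R : comNzRingType) (I : finType).
Local Notation T := {ffun {set I} -> R^o}.
Implicit Types (f g x y : T) (i j : I) (S J U : {set I}).

(* A function f on subsets stands for the polynomial sum_S f(S) prod_(i in S) x_i
   modulo the squares x_i ^ 2; mulv i is the multiplication by x_i. *)
Definition mulv i f : T := [ffun S : {set I} => if i \in S then f (S :\ i) else 0].

Lemma mulv_is_linear i : linear (mulv i).
Proof.
by move=> a f g; apply/ffunP => S; rewrite !ffunE; case: ifP; rewrite ?scaler0 ?addr0.
Qed.
HB.instance Definition _ i := GRing.isLinear.Build R T T *:%R (mulv i) (mulv_is_linear i).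

Definition raise U f : T := \sum_(i in U) mulv i f.

Lemma raise_is_linear U : linear (raise U).
Proof.
move=> a f g; rewrite /raise scaler_sumr -big_split.
by apply: eq_bigr => i _; rewrite linearP.
Qed.
HB.instance Definition _ U := GRing.isLinear.Build R T T *:%R (raise U) (raise_is_linear U).

Lemma iter_raise_is_linear U n : linear (iter n (raise U)).
Proof. by elim: n => // n IH a f g; rewrite !iterS IH linearP. Qed.
HB.instance Definition _ U n :=
  GRing.isLinear.Build R T T *:%R (iter n (raise U)) (iter_raise_is_linear U n).

Lemma mulvC i j f : mulv i (mulv j f) = mulv j (mulv i f).
Proof.
apply/ffunP => S; rewrite !ffunE !inE.
have [->|neq] := eqVneq i j; first by [].
rewrite ?(eq_sym j) ?neq /=.
by case: (i \in S); case: (j \in S) => //; rewrite !setDDl setUC.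
Qed.

Lemma mulvv i f : mulv i (mulv i f) = 0.
Proof. by apply/ffunP => S; rewrite !ffunE !inE eqxx; case: ifP. Qed.

Lemma raise_mulv U i f : raise U (mulv i f) = mulv i (raise U f).
Proof. by rewrite /raise linear_sum; apply: eq_bigr => j _; rewrite mulvC. Qed.

Lemma raise_setU1 i U f : i \notin U -> raise (i |: U) f = mulv i f + raise U f.
Proof. by move=> iU; rewrite /raise big_setU1. Qed.

(** Binomial expansion of (x_i + E)^(n+1): the two operators commute and x_i squares to zero, so
    only the first-order term remains. *)
Lemma iter_raise_setU1 i U n f : i \notin U ->
  iter n.+1 (raise (i |: U)) f
    = iter n.+1 (raise U) f + n.+1%:R *: mulv i (iter n (raise U) f).
Proof.
move=> iU; elim: n => [|n IH].
  by rewrite /= raise_setU1 // scale1r addrC.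
rewrite iterS IH linearD linearZ /= !raise_setU1 // mulvv add0r raise_mulv.
set A := mulv i _; rewrite addrAC addrC; congr (_ + _).
by rewrite -[X in X + _]scale1r -scalerDl nat1r.
Qed.

(** Each index added to U contributes to the p-th power only a term with the factor p. *)
Lemma iter_raise_char (p : nat) U f : (0 < p)%N -> p%:R = 0 :> R -> iter p (raise U) f = 0.
Proof.
move=> p_gt0 p0; move: {-1}#|U| (leqnn #|U|) => n.
elim: n U => [|n IH] U.
  rewrite leqn0 cards_eq0 => /eqP ->; case: p p_gt0 {p0} => // p _.
  by rewrite iterS /raise big_set0.
have [->|[i iU]] := set_0Vmem U; first by rewrite cards0 => _; apply: IH; rewrite cards0.
rewrite (cardsD1 i) iU ltnS => /IH E.
rewrite -(setD1K iU); case: p p_gt0 p0 E {IH} => // p _ p0 E.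
by rewrite iter_raise_setU1 ?setD11 // E p0 scale0r addr0.
Qed.

(** For the polynomial of f, [low i] sets x_i = 0 and [upp i] is the derivative in x_i. *)
Definition low i f : T := [ffun S : {set I} => if i \in S then 0 else f S].
Definition upp i f : T := [ffun S : {set I} => if i \in S then 0 else f (i |: S)].

Lemma low_is_linear i : linear (low i).
Proof.
by move=> a f g; apply/ffunP => S; rewrite !ffunE; case: ifP; rewrite ?scaler0 ?addr0.
Qed.
HB.instance Definition _ i := GRing.isLinear.Build R T T *:%R (low i) (low_is_linear i).

Lemma upp_is_linear i : linear (upp i).
Proof.
by move=> a f g; apply/ffunP => S; rewrite !ffunE; case: ifP; rewrite ?scaler0 ?addr0.
Qed.
HB.instance Definition _ i := GRing.isLinear.Build R T T *:%R (upp i) (upp_is_linear i).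

Lemma low_upp i f : f = low i f + mulv i (upp i f).
Proof.
apply/ffunP => S; rewrite !ffunE; case: ifP => iS; last by rewrite addr0.
by rewrite setD11 setD1K // add0r.
Qed.

Definition ssum f J : R := \sum_(S : {set I} | J \subset S) f S.

Lemma ssumD f g J : ssum (f + g) J = ssum f J + ssum g J.
Proof. by rewrite /ssum -big_split; apply: eq_bigr => S _; rewrite ffunE. Qed.
Lemma ssumZ a f J : ssum (a *: f) J = a * ssum f J.
Proof. by rewrite /ssum mulr_sumr; apply: eq_bigr => S _; rewrite ffunE. Qed.
Lemma ssumN f J : ssum (- f) J = - ssum f J.
Proof. by rewrite -scaleN1r ssumZ mulN1r. Qed.
Lemma ssum0 J : ssum 0 J = 0.
Proof. by rewrite /ssum big1 // => S _; rewrite ffunE. Qed.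
Lemma ssum_sum (K : finType) (P : pred K) (F : K -> T) J :
  ssum (\sum_(k | P k) F k) J = \sum_(k | P k) ssum (F k) J.
Proof. by apply: (big_morph (ssum^~ J)) => [f g|]; [apply: ssumD|apply: ssum0]. Qed.

Lemma ssum_setD1 i f J : i \in J ->
  ssum f (J :\ i) = ssum f J + ssum (low i f) (J :\ i).
Proof.
move=> iJ; rewrite [LHS](bigID (fun S : {set I} => i \in S)) /=; congr (_ + _).
  by apply: eq_bigl => S; rewrite andbC -[in RHS](setD1K iJ) subUset sub1set.
rewrite [RHS](bigID (fun S : {set I} => i \in S)) /= [X in _ = X + _]big1 ?add0r => [|S /andP[_ iS]].
  by apply: eq_bigr => S /andP[_ /negPf iS]; rewrite ffunE iS.
by rewrite ffunE iS.
Qed.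

Lemma ssum_mulv i f J : ssum (mulv i f) J = ssum (low i f) (J :\ i).
Proof.
rewrite /ssum [LHS](bigID (fun S : {set I} => i \in S)) /= [X in _ + X]big1 ?addr0; last first.
  by move=> S /andP[_ /negPf iS]; rewrite ffunE iS.
rewrite [RHS](bigID (fun S : {set I} => i \in S)) /= [X in X + _]big1 ?add0r; last first.
  by move=> S /andP[_ iS]; rewrite ffunE iS.
rewrite (reindex_onto (fun S => i |: S) (fun S => S :\ i)) /=; last first.
  by move=> S /andP[_ iS]; rewrite setD1K.
apply: eq_big => [S|S].
  rewrite setU11 andbT -subDset; congr (_ && _).
  apply/eqP/idP => [<-|iS]; first by rewrite setD11.
  by rewrite setU1K.
by move=> /andP[/andP[_ _] /eqP E]; rewrite !ffunE setU11 E -E setD11.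
Qed.

Lemma ssum_low i f J : i \notin J -> ssum (low i f) J = ssum f J - ssum f (i |: J).
Proof.
move=> iJ; have := ssum_setD1 f (setU11 i J); rewrite setU1K // => ->.
by rewrite addrC addKr.
Qed.

(** Each S is counted once for every element of S :\: J. For t = d - #|J| this is the identity F
    F^(t-1) = t F^(t). *)
Lemma ssum_up U f J d : (forall S, f S != 0 -> S \subset U /\ #|S| = d) -> J \subset U ->
  \sum_(i in U :\: J) ssum f (i |: J) = (d%:R - #|J|%:R) * ssum f J.
Proof.
move=> Hf JU; rewrite /ssum mulr_sumr.
under eq_bigr => i _ do under eq_bigl => S do rewrite subUset sub1set andbC.
under eq_bigr => i _ do rewrite big_mkcondr.
rewrite exchange_big /=; apply: eq_bigr => S JS.
have [->|/Hf[SU Sd]] := eqVneq (f S) 0.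
  by rewrite mulr0 big1 // => i _; case: ifP.
rewrite -big_mkcondr /= (eq_bigl [in S :\: J]); last first.
  move=> i; rewrite !inE -andbA; case iS: (i \in S); rewrite ?andbF //.
  by rewrite (subsetP SU).
rewrite sumr_const -[LHS]mulr_natl; congr (_ * _).
by rewrite -natrB -?Sd ?subset_leq_card // cardsDS.
Qed.

(** The commutation relation F^(t) E = E F^(t) + (m + t - 1) F^(t-1), where t = d + 1 - #|J| and m =
    #|U| - 2 d. The indices in J produce E F^(t); those outside J are summed by [ssum_up]. *)
Lemma ssum_raise U f J d : (forall S, f S != 0 -> S \subset U /\ #|S| = d) -> J \subset U ->
  ssum (raise U f) J
    = (#|U|%:R - d%:R - #|J|%:R) * ssum f J + \sum_(i in J) ssum f (J :\ i).
Proof.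
move=> Hf JU; rewrite /raise ssum_sum.
under eq_bigr => i _ do rewrite ssum_mulv.
rewrite (bigID (fun i => i \in J)) /= [X in X + _](eq_bigl [in J]); last first.
  by move=> i; rewrite andbC; apply: andb_idr => /(subsetP JU).
rewrite [X in X + _](eq_bigr (fun i => ssum f (J :\ i) - ssum f J)); last first.
  by move=> i iJ; rewrite (ssum_setD1 f iJ) addrC addKr.
rewrite [X in _ + X](eq_bigl [in U :\: J]); last by move=> i; rewrite inE andbC.
rewrite [X in _ + X](eq_bigr (fun i => ssum f J - ssum f (i |: J))); last first.
  move=> i; rewrite inE => /andP[iJ _].
  have /setDidPl -> : [disjoint J & [set i]] by rewrite disjoint_sym disjoints1.
  exact: ssum_low.
rewrite !sumrB (ssum_up Hf JU) !sumr_const cardsDS //.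
rewrite -!(mulr_natl (ssum f J)) natrB ?subset_leq_card //; ring.
Qed.

End Raising.

(** * Primitive vectors and the standard bilinear form *)

Section Primitive.
Variables (R : comNzRingType) (I : finType).
Local Notation T := {ffun {set I} -> R^o}.
Implicit Types (f g x y : T) (i j : I) (S J U : {set I}) (m : int) (d : nat).

Definition homog U d f := forall S, f S != 0 -> S \subset U /\ #|S| = d.

(* The primitive vectors of weight m = #|U| - 2 #|S|: all divided powers
   f |-> (J |-> sum_(S | J \subset S, #|S| = #|J| + j) f S), j > 0, of the lowering
   operator vanish on f. *)
Definition prim U m f :=
  (forall S, f S != 0 -> S \subset U /\ #|U|%:Z = m + 2 * #|S|%:Z) /\
  (forall J, 2 * #|J|%:Z + m < #|U|%:Z -> ssum f J = 0).

Lemma prim0 U m : prim U m 0.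
Proof. by split=> [S|J _]; rewrite ?ffunE ?eqxx ?ssum0. Qed.

Lemma primD U m f g : prim U m f -> prim U m g -> prim U m (f + g).
Proof.
move=> [f1 f2] [g1 g2]; split=> [S|J HJ]; last by rewrite ssumD f2 ?g2 ?addr0.
rewrite ffunE; have [->|/f1 //] := eqVneq (f S) 0.
by rewrite add0r => /g1.
Qed.

Lemma primZ U m a f : prim U m f -> prim U m (a *: f).
Proof.
move=> [f1 f2]; split=> [S|J HJ]; last by rewrite ssumZ f2 ?mulr0.
rewrite ffunE => H; apply: f1; apply: contraNneq H => ->.
by rewrite scaler0.
Qed.

Lemma primB U m f g : prim U m f -> prim U m g -> prim U m (f - g).
Proof. by move=> Hf Hg; rewrite -scaleN1r; apply: primD => //; apply: primZ. Qed.

Lemma prim_deg U m f : prim U m f ->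
  f = 0 \/ exists d, #|U|%:Z = m + 2 * d%:Z /\ homog U d f.
Proof.
move=> [f1 _]; have [/eqfunP f0|] := boolP [forall S, f S == 0].
  by left; apply/ffunP => S; rewrite f0 ffunE.
move=> /forallPn[S fS]; right; have [_ US] := f1 _ fS.
exists #|S|; split=> // S' /f1[? ?]; split=> //; lia.
Qed.

Lemma ssum_notin U f J d : homog U d f -> ~~ (J \subset U) -> ssum f J = 0.
Proof.
move=> Hf JU; rewrite /ssum big1 // => S JS; apply/eqP; apply: contraNT JU => /Hf[SU _].
exact: subset_trans SU.
Qed.

Lemma ssum_top U f J d : homog U d f -> #|J| = d -> ssum f J = f J.
Proof.
move=> Hf Jd; rewrite /ssum (bigD1 J) //= big1 ?addr0 // => S /andP[JS neq].
apply/eqP; apply: contraNT neq => /Hf[_ Sd].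
by rewrite eq_sym eqEcard JS Sd Jd leqnn.
Qed.

Lemma homog_raise U f d : homog U d f -> homog U d.+1 (raise U f).
Proof.
move=> Hf S; rewrite /raise sum_ffunE => H.
have [i iU] : exists2 i, i \in U & mulv i f S != 0.
  apply/exists_inP; apply: contraNT H => /exists_inPn E.
  by rewrite big1 // => i iU; apply/eqP; have := E i iU; rewrite negbK.
rewrite ffunE; case: ifP; rewrite ?eqxx // => iS /Hf[SU <-].
rewrite -(setD1K iS) subUset sub1set iU; split=> //.
by rewrite setU1K ?setD11 // cardsU1 setD11.
Qed.

Lemma homog_iter U f d n : homog U d f -> homog U (d + n) (iter n (raise U) f).
Proof. by move=> Hf; elim: n => [|n IH]; rewrite ?addn0 ?addnS //=; apply: homog_raise. Qed.

Lemma raise_out U f J d : homog U d f -> ~~ (J \subset U) -> raise U f J = 0.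
Proof. by move=> /homog_raise H JU; apply/eqP; apply: contraNT JU => /H[]. Qed.

(** An index that f does not involve only enlarges #|U| by one; the weight absorbs this and the
    range of J is the same. *)
Lemma prim_widen i U m f : i \notin U -> prim U (m - 1) f -> prim (i |: U) m f.
Proof.
move=> iU [f1 f2]; split=> [S /f1[SU E]|J]; rewrite cardsU1 iU /=.
  by split; [exact: subset_trans SU (subsetUr _ _) | lia].
by move=> H; apply: f2; lia.
Qed.

Lemma prim_narrow i U m f : i \notin U -> prim (i |: U) m f -> upp i f = 0 -> prim U (m - 1) f.
Proof.
move=> iU [f1 f2] uf0; split=> [S fS|J H]; last by apply: f2; rewrite cardsU1 iU /=; lia.
have [SU] := f1 S fS; rewrite cardsU1 iU /= => E; split; last by lia.
apply/subsetP => j jS; have := subsetP SU _ jS; rewrite !inE => /predU1P[E'|//].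
move/ffunP/(_ (S :\ i)): uf0; rewrite -{}E' !ffunE setD11 setD1K // => E0.
by rewrite E0 eqxx in fS.
Qed.

Lemma low_upp_id i f : low i (upp i f) = upp i f.
Proof. by apply/ffunP => S; rewrite !ffunE; case: (i \in S). Qed.

Lemma low_mulv i f : low i (mulv i f) = 0.
Proof. by apply/ffunP => S; rewrite !ffunE; case: (i \in S). Qed.

Lemma upp_low i f : upp i (low i f) = 0.
Proof. by apply/ffunP => S; rewrite !ffunE setU11; case: (i \in S). Qed.

Lemma upp_mulv i f : upp i (mulv i f) = low i f.
Proof.
apply/ffunP => S; rewrite !ffunE setU11; case: ifPn => // iS.
by rewrite setU1K.
Qed.

Lemma low_id U m i f : i \notin U -> prim U m f -> low i f = f.
Proof.
move=> iU [f1 _]; apply/ffunP => S; rewrite !ffunE; case: ifP => // iS.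
have [->//|/f1[SU _]] := eqVneq (f S) 0.
by rewrite (subsetP SU _ iS) in iU.
Qed.

Lemma upp_low_id i f : low i f = f -> upp i f = 0.
Proof. by move=> <-; rewrite upp_low. Qed.

Lemma ssum_low_in i f J : i \in J -> ssum (low i f) J = 0.
Proof.
move=> iJ; rewrite /ssum big1 // => S JS.
by rewrite ffunE (subsetP JS _ iJ).
Qed.

Lemma ssum_upp i f J : i \notin J -> ssum (upp i f) J = ssum f (i |: J).
Proof.
move=> iJ; rewrite {2}(low_upp i f) ssumD ssum_low_in ?setU11 // add0r.
by rewrite ssum_mulv setU1K // low_upp_id.
Qed.

(** The sums of the derivative over J are those of f over i |: J. Both the number of indices and the
    degree drop by one, so the weight grows by one. *)
Lemma prim_upp i U m f : i \notin U -> prim (i |: U) m f -> prim U (m + 1) (upp i f).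
Proof.
move=> iU [f1 f2]; split=> [S|J H].
  rewrite ffunE; case: ifPn; rewrite ?eqxx // => iS /f1[SU].
  rewrite !cardsU1 iU iS /= => E; split; last by lia.
  apply/subsetP => j jS; have := subsetP SU j; rewrite !inE jS orbT => /(_ isT).
  by case/predU1P => // E'; rewrite -E' jS in iS.
have [iJ|iJ] := boolP (i \in J); first by rewrite -low_upp_id ssum_low_in.
by rewrite ssum_upp // f2 // !cardsU1 iU iJ /=; lia.
Qed.

Definition dot f g : R := \sum_S f S * g S.

Lemma dotDl f g h : dot (f + g) h = dot f h + dot g h.
Proof. by rewrite /dot -big_split; apply: eq_bigr => S _; rewrite ffunE mulrDl. Qed.
Lemma dotDr f g h : dot h (f + g) = dot h f + dot h g.
Proof. by rewrite /dot -big_split; apply: eq_bigr => S _; rewrite ffunE mulrDr. Qed.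
Lemma dotZl a f h : dot (a *: f) h = a * dot f h.
Proof. by rewrite /dot mulr_sumr; apply: eq_bigr => S _; rewrite ffunE mulrA. Qed.
Lemma dotZr a f h : dot h (a *: f) = a * dot h f.
Proof. by rewrite /dot mulr_sumr; apply: eq_bigr => S _; rewrite ffunE mulrCA. Qed.
Lemma dotNr f h : dot h (- f) = - dot h f.
Proof. by rewrite -scaleN1r dotZr mulN1r. Qed.
Lemma dotNl f h : dot (- f) h = - dot f h.
Proof. by rewrite -scaleN1r dotZl mulN1r. Qed.
Lemma dot0l g : dot 0 g = 0.
Proof. by rewrite /dot big1 // => S _; rewrite ffunE mul0r. Qed.
Lemma dot0r g : dot g 0 = 0.
Proof. by rewrite /dot big1 // => S _; rewrite [X in _ * X]ffunE mulr0. Qed.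
Lemma dotC f g : dot f g = dot g f.
Proof. by apply: eq_bigr => S _; rewrite mulrC. Qed.

Lemma dot_mulv i f g : dot f (mulv i g) = dot (upp i f) g.
Proof.
rewrite /dot [LHS](bigID (fun S : {set I} => i \in S)) /= [X in _ + X]big1 ?addr0; last first.
  by move=> S /negPf iS; rewrite ffunE iS mulr0.
rewrite [RHS](bigID (fun S : {set I} => i \in S)) /= [X in X + _]big1 ?add0r; last first.
  by move=> S iS; rewrite ffunE iS mul0r.
rewrite (reindex_onto (fun S => i |: S) (fun S => S :\ i)) /=; last first.
  by move=> S iS; rewrite setD1K.
apply: eq_big => [S|S].
  rewrite setU11; apply/eqP/idP => [<-|iS]; first by rewrite setD11.
  by rewrite setU1K.
move=> /andP[_ /eqP E]; have /negPf iS : i \notin S by rewrite -E setD11.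
by rewrite !ffunE setU11 E iS.
Qed.

(** The adjoint of [raise U] is F, and on f of degree d + 1 the value of F at a set of size d is an
    [ssum]. *)
Lemma dot_raise U f g d : homog U d.+1 f -> homog U d g ->
  dot f (raise U g) = \sum_S ssum f S * g S.
Proof.
move=> Hf Hg; rewrite /raise.
have -> : dot f (\sum_(i in U) mulv i g) = \sum_(i in U) dot f (mulv i g).
  by apply: (big_morph (dot f)) => [a b|]; rewrite ?dotDr ?dot0r.
under eq_bigr => i _ do rewrite dot_mulv.
rewrite /dot exchange_big /=; apply: eq_bigr => S _; rewrite -mulr_suml.
have [->|gS] := eqVneq (g S) 0; first by rewrite !mulr0.
have [SU Sd] := Hg _ gS; congr (_ * _).
have := ssum_up Hf SU; rewrite Sd -natr1 [_ - _]addrC addKr mul1r => <-.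
rewrite (bigID [in S]) /= big1 ?add0r => [|i /andP[_ iS]]; last by rewrite ffunE iS.
rewrite [LHS](eq_bigl [in U :\: S]) => [|i]; last by rewrite inE andbC.
apply: eq_bigr => i; rewrite inE => /andP[iS iU].
by rewrite ffunE (negPf iS) (ssum_top Hf) // cardsU1 iS Sd.
Qed.

Lemma prim_dot_raise U m f g : prim U m f ->
  (forall S, g S != 0 -> S \subset U /\ #|U|%:Z = m + 2 + 2 * #|S|%:Z) -> dot f (raise U g) = 0.
Proof.
move=> Hf Hg; have [->|[d [Ud Hd]]] := prim_deg Hf.
  by rewrite dot0l.
case: d Ud Hd => [|d] Ud Hd.
  have -> : g = 0.
    by apply/ffunP => S; rewrite ffunE; apply/eqP/negPn/negP => /Hg[_]; lia.
  by rewrite linear0 dot0r.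
rewrite (dot_raise Hd) => [|S /Hg[? ?]]; last by split=> //; lia.
rewrite big1 // => S _; have [->|/Hg[_ E]] := eqVneq (g S) 0; first by rewrite mulr0.
by rewrite Hf.2 ?mul0r //; lia.
Qed.

(** The part of F f = 0 free of x_i reads F (low i f) + upp i f = 0; pairing with y turns F into its
    adjoint [raise U]. *)
Lemma dot_low_raise i U m f y : i \notin U -> prim (i |: U) m f -> prim U (m + 1) y ->
  dot (low i f) (raise U y) = - dot (upp i f) y.
Proof.
move=> iU Hf Hy; have [->|[d [Ud Hd]]] := prim_deg Hy.
  by rewrite linear0 !dot0r oppr0.
have Hx : homog U d.+1 (low i f).
  move=> S; rewrite ffunE; case: ifPn; rewrite ?eqxx // => iS /(Hf.1)[SU].
  rewrite cardsU1 iU /= => E; split; last by lia.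
  apply/subsetP => j jS; have := subsetP SU j jS; rewrite !inE.
  by case/predU1P => // E'; rewrite -E' jS in iS.
rewrite (dot_raise Hx Hd) /dot -sumrN; apply: eq_bigr => S _.
have [->|/Hd[SU Sd]] := eqVneq (y S) 0; first by rewrite !mulr0 oppr0.
have iS : i \notin S by apply: contraNN iU; apply: (subsetP SU).
rewrite ssum_low // Hf.2 ?sub0r; last by rewrite cardsU1 iU /=; lia.
rewrite -ssum_upp // (@ssum_top U (upp i f) S d) ?mulNr // => S' /(prim_upp iU Hf).1[? ?].
by split=> //; lia.
Qed.

(* Splits the surjection upp i from the primitive vectors of weight m on i |: U to
   those of weight m + 1 on U, when m + 1 is invertible. *)
Lemma prim_lift i U m y (a : R) : i \notin U -> prim U (m + 1) y -> (m + 1)%:~R * a = 1 ->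
  prim (i |: U) m (mulv i y - a *: raise U y).
Proof.
move=> iU Hy ma; have [->|[d [Ud Hd]]] := prim_deg Hy.
  by rewrite !linear0 ?scaler0 ?subr0 ?oppr0 ?addr0; apply: prim0.
have Hr := homog_raise Hd; split=> [S|J].
  rewrite !ffunE => H.
  have [iS|iS] := boolP (i \in S).
    have r0 : raise U y S = 0.
      by apply: (raise_out Hd); apply: contraNN iU => /subsetP; apply.
    move: H; rewrite iS r0 scaler0 subr0 => /Hd[SU SD].
    have := cardsD1 i S; rewrite iS SD cardsU1 iU /= => E; split; last by lia.
    by rewrite -(setD1K iS) setUS.
  move: H; rewrite (negPf iS) sub0r oppr_eq0 => H.
  have /Hr[SU SD] : raise U y S != 0 by apply: contraNneq H => ->; rewrite scaler0.
  by rewrite cardsU1 iU SD /=; split; [exact: subset_trans SU (subsetUr _ _) | lia].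
rewrite cardsU1 iU /= => HJ; have Jd : (#|J| <= d)%N by lia.
rewrite ssumD ssumN ssumZ ssum_mulv (low_id iU Hy).
have [iJ|iJ] := boolP (i \in J).
  rewrite Hy.2; last by have := cardsD1 i J; rewrite iJ; lia.
  rewrite (ssum_notin Hr) ?mulr0 ?subr0 //.
  by apply: contraNN iU => /subsetP; apply.
have /setDidPl -> : [disjoint J & [set i]] by rewrite disjoint_sym disjoints1.
have [JU|JU] := boolP (J \subset U); last first.
  by rewrite (ssum_notin Hd) // (ssum_notin Hr) // mulr0 subr0.
rewrite (ssum_raise Hd JU) [\sum_(j in J) _]big1 ?addr0 => [|j jJ]; last first.
  by apply: Hy.2; have := cardsD1 j J; rewrite jJ; lia.
(* Only J of the full degree d of y is left. There the commutation coefficient is the weight m + 1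
   of y, which [a] inverts. *)
have [E|neq] := eqVneq #|J| d; last first.
  by rewrite Hy.2 ?mulr0 ?subr0 //; lia.
suff -> : #|U|%:R - d%:R - #|J|%:R = (m + 1)%:~R :> R by rewrite mulrA [a * _]mulrC ma mul1r subrr.
rewrite E !pmulrn -!intrB; congr _%:~R; lia.
Qed.

Lemma low_fold f s S : foldr (@low R I) f s S = if has [in S] s then 0 else f S.
Proof. by elim: s => //= i s IH; rewrite ffunE IH; case: (i \in S). Qed.

(* Inclusion-exclusion over U :\: S isolates the value f S. *)
Lemma prim_neg U m f : m < 0 -> prim U m f -> f = 0.
Proof.
move=> m_lt0 [f1 f2]; apply/ffunP => S; rewrite ffunE; apply/eqP/negPn/negP => fS.
have [SU E] := f1 _ fS.
have claim s J : 2 * (#|J| + size s)%:Z + m < #|U|%:Z -> ssum (foldr (@low R I) f s) J = 0.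
  elim: s J => [|i s IH] J /= H; first by apply: f2; lia.
  have [iJ|iJ] := boolP (i \in J); first by rewrite ssum_low_in.
  rewrite ssum_low // !IH ?subr0 //; last by lia.
  by rewrite cardsU1 iJ; lia.
move: fS; apply/negP; rewrite negbK; apply/eqP.
have <- : ssum (foldr (@low R I) f (enum (U :\: S))) set0 = f S; last first.
  apply: claim; rewrite cards0 -cardE cardsDS //.
  have := subset_leq_card SU; lia.
rewrite /ssum (bigD1 S) ?sub0set //= low_fold big1 => [|S' /andP[_ neq]].
  rewrite addr0; case: hasP => // -[j]; rewrite mem_enum inE /= => /andP[jS _] jS'.
  by rewrite jS' in jS.
rewrite low_fold; case: hasP => // nh.
apply/eqP; apply: contraNT neq => /f1[S'U E'].
rewrite eqEcard; apply/andP; split; last by lia.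
apply/subsetP => j jS'; apply/negPn/negP => jS; apply: nh; exists j => //.
by rewrite mem_enum inE jS (subsetP S'U).
Qed.

End Primitive.

(** * Powers of the raising operator over an integral domain *)

Section PrimitiveDomain.
Variables (R : idomainType) (I : finType).
Local Notation T := {ffun {set I} -> R^o}.
Implicit Types (f g w x y : T) (i j : I) (S J U : {set I}) (m : int) (d : nat).

(** If F kills f, then so does F^(t), by cancelling t in [ssum_up], as long as t stays at most c. *)
Lemma ssum_descent U f d c :
  homog U d f -> (forall J, #|J|.+1 = d -> ssum f J = 0) ->
  (forall t, (0 < t <= c)%N -> t%:R != 0 :> R) ->
  forall t J, (0 < t <= c)%N -> (#|J| + t)%N = d -> ssum f J = 0.
Proof.
move=> Hf H1 Hc; elim=> // t IH J tc Jd.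
have [JU|JU] := boolP (J \subset U); last exact: ssum_notin Hf JU.
have [t0|t_gt0] := posnP t; first by apply: H1; rewrite -Jd t0 addn1.
apply/eqP; have := Hc _ tc; apply: contraNT => nz.
have := ssum_up Hf JU; rewrite big1 => [/esym/eqP|i].
  by rewrite mulf_eq0 (negPf nz) orbF -natrB -?Jd ?leq_addr // addKn.
by rewrite inE => /andP[iJ _]; apply: IH; rewrite ?t_gt0 ?cardsU1 ?iJ; lia.
Qed.

(** F kills E^c w because the factor m - c + 1 vanishes; [ssum_descent] then handles F^(t) for t <=
    c. For t > c, F^(t) E^c w = 0 whatever the weight: this is [small]. *)
Lemma prim_raise U m w c : (0 < c)%N -> (m - c%:Z + 1)%:~R = 0 :> R ->
  (forall t, (0 < t <= c)%N -> t%:R != 0 :> R) ->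
  prim U m w -> prim U (m - 2 * c%:Z) (iter c (raise U) w).
Proof.
move=> c_gt0 mc Hc Hw; have [->|[d [Ud Hd]]] := prim_deg Hw.
  by rewrite linear0; apply: prim0.
have Hj (j : nat) : homog U (d + j) (iter j (raise U) w) by apply: homog_iter.
have small (j : nat) J : (#|J| < d)%N -> ssum (iter j (raise U) w) J = 0.
  elim: j J => [|j IH] J JU /=; first by apply: Hw.2; lia.
  have [JU'|JU'] := boolP (J \subset U); last exact: ssum_notin (Hj j.+1) JU'.
  rewrite (ssum_raise (Hj j) JU') IH // mulr0 add0r big1 // => i iJ.
  by apply: IH; apply: leq_ltn_trans JU; rewrite subset_leq_card ?subD1set.
(* This is F E^(j+1) w = (j + 1)(m - j) E^j w, evaluated at J. *)
have one (j : nat) J : #|J| = (d + j)%N ->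
    ssum (iter j.+1 (raise U) w) J = (j.+1%:Z * (m - j%:Z))%:~R * iter j (raise U) w J.
  elim: j J => [|j IH] J Jd.
    have [JU|JU] := boolP (J \subset U); last first.
      rewrite (ssum_notin (Hj 1%N) JU) -(ssum_top (Hj 0)) ?Jd //.
      by rewrite (ssum_notin (Hj 0%N) JU) mulr0.
    rewrite /= (ssum_raise Hd JU) (ssum_top Hd) ?Jd ?addn0 // big1 ?addr0 => [|i iJ].
      congr (_ * _); rewrite !pmulrn -!intrB; congr _%:~R; lia.
    by apply: Hw.2; have := cardsD1 i J; rewrite iJ; lia.
  have [JU|JU] := boolP (J \subset U); last first.
    rewrite (ssum_notin (Hj j.+2) JU) -(ssum_top (Hj j.+1)) ?Jd //.
    by rewrite (ssum_notin (Hj j.+1) JU) mulr0.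
  rewrite iterS (ssum_raise (Hj j.+1) JU) (ssum_top (Hj j.+1)) ?Jd //.
  rewrite (eq_bigr (fun i => (j.+1%:Z * (m - j%:Z))%:~R * iter j (raise U) w (J :\ i))); last first.
    by move=> i iJ; apply: IH; have := cardsD1 i J; rewrite iJ Jd; lia.
  rewrite -mulr_sumr.
  have -> : \sum_(i in J) iter j (raise U) w (J :\ i) = iter j.+1 (raise U) w J.
    rewrite iterS /raise sum_ffunE [RHS](bigID [in J]) /= [X in _ = _ + X]big1 ?addr0.
      rewrite [LHS](eq_bigl (fun i => (i \in U) && (i \in J))) => [|i]; last first.
        by rewrite andbC; apply/esym/andb_idr => /(subsetP JU).
      by apply: eq_bigr => i /andP[_ iJ]; rewrite ffunE iJ.
    by move=> i /andP[_ /negPf iJ]; rewrite ffunE iJ.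
  (* The commutator contributes m - 2(j + 1), and (j + 1)(m - j) + m - 2(j + 1) = (j + 2)(m - j -
     1). *)
  rewrite -mulrDl; congr (_ * _); rewrite !pmulrn -!intrB -intrD; congr _%:~R; lia.
split=> [S /Hj[SU Sd]|J HJ]; first by split=> //; lia.
have [Jd|Jd] := ltnP #|J| d; first exact: small.
apply: (ssum_descent (Hj c) _ Hc (t := d + c - #|J|)); [|by lia|by lia].
move=> J' J'd; case: c {HJ Hc} c_gt0 mc J'd => // c _ mc J'd.
have E : (m - c%:Z)%:~R = 0 :> R by rewrite -mc; congr _%:~R; lia.
by rewrite one; [rewrite intrM E mulr0 mul0r | lia].
Qed.

(** In characteristic zero the descent runs through the whole degree, so F f = 0 alone gives
    primitivity. *)
Lemma prim_of_ker U m f : (forall t, (0 < t)%N -> t%:R != 0 :> R) ->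
  (forall S, f S != 0 -> S \subset U /\ #|U|%:Z = m + 2 * #|S|%:Z) ->
  (forall J, J \subset U -> \sum_(i in U :\: J) f (i |: J) = 0) -> prim U m f.
Proof.
move=> char0 H1 H2; split=> // J HJ.
have [f0|/forallPn[S fS]] := boolP [forall S, f S == 0].
  by rewrite /ssum big1 // => S _; apply/eqP/(forallP f0).
have Hf : homog U #|S| f.
  by have [_ E] := H1 _ fS; move=> S' /H1[? ?]; split=> //; lia.
have [_ E] := H1 _ fS.
apply: (ssum_descent Hf (c := #|S|) (t := #|S| - #|J|) _ _ (J := J)); [| |lia|lia]; last first.
  by move=> t /andP[? _]; apply: char0.
move=> J' J'S; have [JU|JU] := boolP (J' \subset U); last exact: ssum_notin Hf JU.
have := ssum_up Hf JU; rewrite -J'S -natr1 addrAC subrr add0r mul1r => <-.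
rewrite -[RHS](H2 _ JU); apply: eq_bigr => i; rewrite inE => /andP[iJ _].
by rewrite (ssum_top Hf) // cardsU1 iJ -J'S.
Qed.

End PrimitiveDomain.

(** * Exactness for functions on subsets in characteristic p *)

Section Exactness.
Variables (p : nat) (F : fieldType) (I : finType).
Hypotheses (p_prime : prime p) (p_char : p%:R = 0 :> F)
  (char_p : forall t, (0 < t < p)%N -> t%:R != 0 :> F).
Local Notation T := {ffun {set I} -> F^o}.
Implicit Types (f g h w x y z : T) (i j : I) (S J U : {set I}) (m : int) (c q : nat).

(* The n-th term of the resolution has weight block c n, where c alternates between
   g - l + 1 and p - (g - l + 1). *)
Definition block c q : int := (c + q * p)%N%:Z - 1.

Lemma block_char c q : (block c q + 1)%:~R = c%:R :> F.
Proof. by rewrite /block subrK -pmulrn natrD natrM p_char mulr0 addr0. Qed.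

Lemma raise_block c q U w : (0 < c < p)%N -> prim U (block (p - c) q.+1) w ->
  prim U (block c q) (iter (p - c) (raise U) w).
Proof.
move=> cp Hw; have -> : block c q = block (p - c) q.+1 - 2 * (p - c)%N%:Z.
  by rewrite /block; lia.
apply: prim_raise Hw; [lia| |by move=> t ?; apply: char_p; lia].
rewrite addrAC intrB block_char -pmulrn subrr //.
Qed.

(** The kernel of the map leaving the q-th term: E^c for q > 0, and for q = 0 the projection to the
    irreducible quotient, whose kernel will be the radical. *)
Definition res_ker c q U f :=
  if q is 0 then forall z, prim U (block c 0) z -> dot f z = 0
  else iter c (raise U) f = 0.

(** For q > 0 the exponents add up to p and E^p = 0; for q = 0 the image of E is orthogonal to
    primitive vectors. *)
Lemma res_ker_im c q U w : (0 < c < p)%N -> prim U (block (p - c) q.+1) w ->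
  res_ker c q U (iter (p - c) (raise U) w).
Proof.
move=> cp Hw; case: q Hw => [|q] Hw /=; last first.
  by rewrite -iterD subnKC 1?ltnW ?(andP cp).2 // iter_raise_char // prime_gt0.
move=> z Hz; have [b pb] : exists b, (p - c = b.+1)%N by exists (p - c).-1; lia.
rewrite dotC pb /= (prim_dot_raise Hz) //.
have [->|[d [Ud Hd]]] := prim_deg Hw.
  by move=> S; rewrite linear0 ffunE eqxx.
by move=> S /(homog_iter Hd)[SU SE]; split=> //; rewrite Ud SE /block; lia.
Qed.

Lemma res_kerB c q U f g : res_ker c q U f -> res_ker c q U g -> res_ker c q U (f - g).
Proof.
case: q => [|q] /= Hf Hg; last by rewrite linearB /= Hf Hg subrr.
by move=> z Hz; rewrite dotDl dotNl Hf // Hg // subrr.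
Qed.

Lemma upp_mulv_neq i j f : i != j -> upp i (mulv j f) = mulv j (upp i f).
Proof.
move=> neq; have /negPf ji : j != i by rewrite eq_sym.
apply/ffunP => S; rewrite !ffunE !inE ji (negPf neq) /=.
case iS: (i \in S); case jS: (j \in S) => //; congr (f _).
by apply/setP => k; rewrite !inE; have [->|] := eqVneq k i; rewrite ?neq ?orbT ?andbT.
Qed.

Lemma upp_raise i U f : i \notin U -> upp i (raise U f) = raise U (upp i f).
Proof.
move=> iU; rewrite /raise linear_sum; apply: eq_bigr => j jU /=.
by rewrite upp_mulv_neq //; apply: contraNneq iU => ->.
Qed.

Lemma low_raise i U f : i \notin U -> low i (raise U f) = raise U (low i f).
Proof.
move=> iU; rewrite {1}(low_upp i f) linearD /= raise_mulv linearD /= low_mulv addr0.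
apply/ffunP => S; rewrite ffunE; case: ifPn => // iS; apply/esym.
rewrite /raise sum_ffunE big1 // => j jU; rewrite !ffunE !inE iS andbT.
by have -> : i != j by [apply: contraNneq iU => ->]; case: ifP.
Qed.

(** The coefficient of x_i in (x_i + E)^(n+1) (low i f + x_i upp i f), with x_i^2 = 0; [low_iter] is
    the constant term. *)
Lemma upp_iter i U n f : i \notin U ->
  upp i (iter n.+1 (raise (i |: U)) f)
    = iter n.+1 (raise U) (upp i f) + n.+1%:R *: iter n (raise U) (low i f).
Proof.
move=> iU; have uppDZ g h k : upp i (g + k *: h) = upp i g + k *: upp i h.
  by rewrite linearD linearZ.
rewrite iter_raise_setU1 // uppDZ upp_mulv.
have lowE k : low i (iter k (raise U) f) = iter k (raise U) (low i f).
  by elim: k => // k IH; rewrite !iterS low_raise // IH.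
have uppE k : upp i (iter k (raise U) f) = iter k (raise U) (upp i f).
  by elim: k => // k IH; rewrite !iterS upp_raise // IH.
by rewrite lowE uppE.
Qed.

Lemma low_iter i U n f : i \notin U ->
  low i (iter n (raise (i |: U)) f) = iter n (raise U) (low i f).
Proof.
move=> iU; have lowE k : low i (iter k (raise U) f) = iter k (raise U) (low i f).
  by elim: k => // k IH; rewrite !iterS low_raise // IH.
have lowDZ g h k : low i (g + k *: h) = low i g + k *: low i h.
  by rewrite linearD linearZ.
case: n => // n; rewrite iter_raise_setU1 // lowDZ.
by rewrite low_mulv scaler0 addr0 lowE.
Qed.

(* Induction on U: write U = i |: V and f = x + e_i y. The induction hypothesis for
   (c + 1, q) divides y by E^(p - c - 1), which reduces to y = 0; then the hypothesis
   for (c - 1, q) writes x as E^(p - c + 1) y1, and prim_lift turns y1 into the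
   required preimage. At the ends of the range, c + 1 = p needs no division and
   c = 1 forces x = 0. *)
Theorem raise_exact c q U f : (0 < c < p)%N -> prim U (block c q) f -> res_ker c q U f ->
  exists2 w, prim U (block (p - c) q.+1) w & f = iter (p - c) (raise U) w.
Proof.
have zero c' q' U' f' : f' = 0 ->
  exists2 w, prim U' (block (p - c') q'.+1) w & f' = iter (p - c') (raise U') w.
  by move=> ->; exists 0; rewrite ?linear0 //; apply: prim0.
move: {-1}#|U| (leqnn #|U|) => n; elim: n U f c q => [|n IH] U f c q.
  rewrite leqn0 cards_eq0 => /eqP -> cp Hf Kf; apply: zero.
  apply/ffunP => S; rewrite ffunE; apply/eqP/negPn/negP => fS.
  have [] := Hf.1 _ fS; rewrite subset0 cards0 => /eqP S0; rewrite S0 cards0 => E.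
  case: q Kf Hf fS E => [|q] Kf Hf fS; last by rewrite /block; lia.
  (* On the empty set only weight 0 occurs, that is c = 1 and q = 0. The constant function is then
     primitive, and f pairs with it to [f set0]. *)
  rewrite /block => E; have {cp} : c = 1%N by lia.
  move=> c1; rewrite c1 in Kf Hf.
  have /Kf : prim set0 (block 1 0) ([ffun S : {set I} => (S == set0)%:R] : T).
    split=> [S'|J]; last by rewrite cards0 /block; lia.
    rewrite ffunE; have [->|_] := eqVneq S' set0; rewrite ?eqxx // sub0set cards0 /block.
    by split=> //; lia.
  rewrite /dot (bigD1 set0) //= ffunE eqxx mulr1 big1 => [|S' /negPf E'].
    by rewrite addr0 => H; rewrite S0 H eqxx in fS.
  by rewrite ffunE E' mulr0.
move=> Un cp Hf Kf; have [U0|[i iU]] := set_0Vmem U.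
  by apply: IH => //; rewrite U0 cards0.
move: Un; rewrite (cardsD1 i) iU ltnS => Un.
have iU' : i \notin U :\ i by rewrite setD11.
move: Hf Kf; rewrite -(setD1K iU); move: (U :\ i) iU' Un => V iV Vn Hf Kf {U iU}.
have [b pb] : exists b, (p - c = b.+1)%N by exists (p - c).-1; lia.
have b_nz : b.+1%:R != 0 :> F by apply: char_p; lia.
have c_nz : c%:R != 0 :> F by apply: char_p.
have block1 : block c q + 1 = block c.+1 q by rewrite /block; lia.
have Hy : prim V (block c.+1 q) (upp i f) by rewrite -block1; apply: prim_upp.
have [y'' Hy'' def_y] : exists2 y'', prim V (block b q.+1) y'' & upp i f = iter b (raise V) y''.
  case: (posnP b) pb b_nz => [-> pc _|b_gt0 pb _].
    (* For b = 0 the weights agree: [block p q = block 0 q.+1]. *)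
    by exists (upp i f) => //; congr (prim V _ _): Hy; rewrite /block; lia.
  have [||] := IH V (upp i f) c.+1 q Vn _ Hy.
  - by lia.
  - case: q Kf Hf Hy {block1} => [|q] /= Kf Hf Hy; last first.
      case: c Kf cp pb c_nz Hf Hy => // c Kf cp pb c_nz Hf Hy.
      (* With x and y the two parts of f, and c the exponent before the case split, E^c f = 0 means
         E^c x = 0 and E^c y + c E^(c-1) x = 0. Applying E to the latter gives E^(c+1) y = 0. *)
      have Ku := congr1 (@upp F I i) Kf; have Kl := congr1 (@low F I i) Kf.
      rewrite upp_iter // linear0 in Ku; rewrite low_iter // linear0 in Kl.
      move/eqP: Ku; rewrite addr_eq0 => /eqP ->.
      by rewrite linearN linearZ /= -iterS Kl scaler0 oppr0.
    move=> z Hz; have Hz' : prim V (block c 0 + 1) z by congr (prim V _ _): Hz; rewrite /block; lia.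
    (* Pairing f with the lift of z gives (1 + 1/c) times the pairing of [upp i f] with z, and c + 1
       < p is nonzero in F. *)
    have := Kf _ (prim_lift iV Hz' (a := c%:R^-1) _); rewrite block_char divff // => /(_ erefl).
    rewrite dotDr dotNr dotZr dot_mulv {2}(low_upp i f) dotDl (dot_low_raise iV Hf Hz').
    rewrite [dot (mulv _ _) _]dotC dot_mulv upp_raise // (upp_low_id (low_id iV Hz)) linear0 dot0l addr0.
    rewrite mulrN opprK -{1}[dot _ _]mul1r -mulrDl => /eqP.
    have -> : 1 + c%:R^-1 = c.+1%:R / c%:R :> F by rewrite -natr1 mulrDl divff // mul1r.
    rewrite !mulf_eq0 invr_eq0 (negPf c_nz) orbF (negPf (char_p _)) => [/eqP|] //.
    by lia.
  by rewrite subnS pb /= => w Hw Ew; exists w.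
(* Since y'' does not involve i, the x_i-coefficient of E^(b+1) y'' on i |: V is (b + 1) E^b y''.
   The scalar makes it equal to [upp i f]. *)
pose w0 := b.+1%:R^-1 *: y''.
have blockb : block b q.+1 = block b.+1 q.+1 - 1 by rewrite /block; lia.
have Hw0 : prim (i |: V) (block (p - c) q.+1) w0.
  by rewrite pb; apply: prim_widen => //; rewrite -blockb; apply: primZ.
pose f1 := f - iter (p - c) (raise (i |: V)) w0.
have Hf1 : prim (i |: V) (block c q) f1 by apply: primB => //; apply: raise_block.
have Kf1 : res_ker c q (i |: V) f1 by apply: res_kerB => //; apply: res_ker_im.
suff [w1 Hw1 def_f1] : exists2 w1, prim (i |: V) (block (p - c) q.+1) w1
    & f1 = iter (p - c) (raise (i |: V)) w1.
  exists (w1 + w0); first exact: primD.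
  by rewrite linearD /= -def_f1 /f1 subrK.
have uf1 : upp i f1 = 0.
  rewrite /f1 linearB /= pb upp_iter // /w0 !linearZ /= (low_id iV Hy'').
  by rewrite (upp_low_id (low_id iV Hy'')) !linear0 ?scaler0 add0r scalerA mulVf // scale1r def_y subrr.
have Hf1' := prim_narrow iV Hf1 uf1.
have lf1 := low_id iV Hf1'.
clearbody f1; clear Hy Hy'' def_y Kf Hf w0 Hw0.
case: c cp pb c_nz block1 Hf1 Kf1 Hf1' => // c cp pb c_nz block1 Hf1 Kf1 Hf1'.
(* The exponent is now c.+1. If c = 0, then for q = 0 the weight on V is -1, and for q > 0 the
   x_i-coefficient of E f1 = 0 is f1 itself. *)
have [c0|c_gt0] := posnP c.
  apply: zero; case: q Kf1 Hf1' {Hf1 block1 blockb} => [|q] Kf1 Hf1'.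
    by apply: (prim_neg _ Hf1'); rewrite c0 /block.
  move: Kf1; rewrite c0 => /(congr1 (@upp F I i)).
  by rewrite upp_iter // uf1 !linear0 add0r scale1r lf1.
have [|||y1 Hy1 def_f1] := IH V f1 c q Vn.
- by lia.
- by congr (prim V _ _): Hf1'; rewrite /block; lia.
- case: q Kf1 Hf1 Hf1' {block1 blockb} => [|q] /= Kf1 Hf1 Hf1'.
    by move=> z Hz; apply: Kf1; apply: prim_widen => //; congr (prim V _ _): Hz; rewrite /block; lia.
  move/(congr1 (@upp F I i)): Kf1; rewrite upp_iter // uf1 !linear0 add0r lf1 => /eqP.
  by rewrite scaler_eq0 (negPf c_nz) => /eqP.
have pc : (p - c = b.+2)%N by lia.
rewrite pc in Hy1 def_f1.
have Hy1' : prim V (block b.+1 q.+1 + 1) y1 by congr (prim V _ _): Hy1; rewrite /block; lia.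
have /= Hw := prim_lift iV Hy1' (a := b.+1%:R^-1).
rewrite block_char divff // in Hw; move/(_ erefl): Hw.
set w1 := mulv i y1 - _ => Hw1.
have lw1 : low i w1 = - b.+1%:R^-1 *: raise V y1.
  by rewrite /w1 linearB linearZ /= low_mulv sub0r low_raise // (low_id iV Hy1) scaleNr.
have uw1 : upp i w1 = y1.
  rewrite /w1 linearB linearZ /= upp_mulv upp_raise // (low_id iV Hy1).
  by rewrite (upp_low_id (low_id iV Hy1)) linear0 scaler0 subr0.
(* In E^(b+1) w1 the x_i-coefficient is E^(b+1) y1 - E^(b+1) y1 = 0, and the constant term is
   -E^(b+2) y1 / (b + 1) = -f1 / (b + 1). *)
exists (- b.+1%:R *: w1); rewrite pb; first exact: primZ.
have iterZ U k a w : iter k (raise U) (a *: w) = a *: iter k (raise U) w by rewrite linearZ.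
rewrite iterZ [iter b.+1 _ w1](low_upp i) upp_iter // low_iter // lw1 uw1 !iterZ.
rewrite scalerA mulrN divff // scaleN1r -!iterSr subrr linear0 addr0 -def_f1.
by rewrite scalerA mulrNN divff // scale1r.
Qed.

End Exactness.

(** * Spanning primitive vectors over any commutative ring *)

Section Polytabloids.
Variables (R : comNzRingType) (I : finType).
Local Notation T := {ffun {set I} -> R^o}.
Implicit Types (f g h w x y : T) (i j s t : I) (S J U : {set I}) (m : int) (d : nat).
Implicit Types (L : seq (I * I)).

Definition fone : T := [ffun S : {set I} => (S == set0)%:R].

Definition pairs L : seq I := flatten [seq [:: st.1; st.2] | st <- L].

(** For disjoint pairs these products of x_s - x_t are the polytabloids of a two-row Specht
    module. *)
Definition ptab L : T := foldr (fun st f => mulv st.1 f - mulv st.2 f) fone L.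

Lemma prim_one U : prim U #|U|%:Z fone.
Proof.
split=> [S|J]; last by lia.
rewrite ffunE; have [->|_] := eqVneq S set0; rewrite ?eqxx // sub0set cards0.
by split=> //; lia.
Qed.

(** x_s - x_t is the invariant in the tensor square of the two-dimensional representation: lowering
    s and lowering t cancel. *)
Lemma prim_pair U m f s t : s != t -> s \notin U -> t \notin U -> prim U m f ->
  prim (s |: (t |: U)) m (mulv s f - mulv t f).
Proof.
move=> st sU tU Hf; have sz : #|s |: (t |: U)| = #|U|.+2.
  by rewrite !cardsU1 !inE (negPf st) (negPf sU) tU.
have supp k S : k \notin U -> mulv k f S != 0 -> (S \subset k |: U) /\ #|U|%:Z + 2 = m + 2 * #|S|%:Z.
  move=> kU; rewrite ffunE; case: ifP; rewrite ?eqxx // => kS /(Hf.1)[SU E].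
  split; first by rewrite -(setD1K kS) setUS.
  by have := cardsD1 k S; rewrite kS; lia.
split=> [S|J]; rewrite sz => H.
  have [E|Ht] := eqVneq (mulv t f S) 0; last first.
    have [SU E] := supp t S tU Ht; split; last by lia.
    exact: subset_trans SU (subsetUr _ _).
  have Hs : mulv s f S != 0 by apply: contraNneq H => H; rewrite !ffunE in H E *; rewrite H E subrr.
  have [SU E'] := supp s S sU Hs; split; last by lia.
  by apply: subset_trans SU _; rewrite setUCA subsetUr.
rewrite ssumD ssumN !ssum_mulv (low_id sU Hf) (low_id tU Hf).
have out k J' : k \notin U -> k \in J' -> ssum f J' = 0.
  by move=> kU kJ; rewrite -(low_id kU Hf) ssum_low_in.
have D1 k : k \notin J -> J :\ k = J.
  by move=> kJ; apply/setDidPl; rewrite disjoint_sym disjoints1.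
have sm k : k \in J -> ssum f (J :\ k) = 0.
  by move=> kJ; apply: Hf.2; have := cardsD1 k J; rewrite kJ; lia.
have [sJ|sJ] := boolP (s \in J).
  by rewrite (sm s) // (out s) ?subrr // !inE st.
have [tJ|tJ] := boolP (t \in J); last by rewrite !D1 // subrr.
by rewrite (sm t) // (out t) ?subrr // !inE eq_sym st.
Qed.

Lemma prim_ptab L U : uniq (pairs L) -> {subset pairs L <= U} ->
  prim U (#|U|%:Z - 2 * (size L)%:Z) (ptab L).
Proof.
elim: L U => [|[s t] L IH] U.
  by move=> _ _ /=; rewrite mulr0 subr0; apply: prim_one.
rewrite /= inE => /andP[/norP[st sL] /andP[tL uL]] sub.
have sU : s \in U by apply: sub; rewrite !inE eqxx.
have tU : t \in U by apply: sub; rewrite !inE eqxx orbT.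
have tU' : t \in U :\ s by rewrite !inE eq_sym st.
rewrite -(setD1K sU) -(setD1K tU').
have -> : #|s |: (t |: (U :\ s) :\ t)|%:Z - 2 * (size L).+1%:Z
    = #|(U :\ s) :\ t|%:Z - 2 * (size L)%:Z.
  by rewrite setD1K // setD1K // (cardsD1 s U) sU (cardsD1 t (U :\ s)) tU'; lia.
apply: prim_pair; rewrite ?inE ?eqxx ?andbF //.
apply: IH => // k kL; rewrite !inE sub ?inE ?kL ?orbT // andbT.
by apply/andP; split; [apply: contraNneq tL => <-|apply: contraNneq sL => <-].
Qed.

Lemma size_pairs L : size (pairs L) = (2 * size L)%N.
Proof. by elim: L => //= st L; rewrite -/(pairs L) => ->; lia. Qed.

(** The kernel intersection theorem for two-row Specht modules. Unlike [prim_lift], the surjection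
    [upp i] is split on generators only, [ptab L] being the derivative of [ptab ((i, j) :: L)],
    which avoids division. *)
Lemma prim_span (M : T -> Prop) U m f :
  M 0 -> (forall a g h, M g -> M h -> M (a *: g + h)) ->
  0 <= m -> prim U m f ->
  (forall L, uniq (pairs L) -> {subset pairs L <= U} ->
     #|U|%:Z = m + 2 * (size L)%:Z -> M (ptab L)) ->
  M f.
Proof.
have [n] := ubnP #|U|; elim: n U m f M => // n IH U m f M Un M0 MD m_ge0 Hf ML.
have [U0|[i iU]] := set_0Vmem U.
  rewrite {U}U0 in Hf ML Un.
  have [S0|m_neq0] := eqVneq m 0; last first.
    have -> // : f = 0.
    apply/ffunP => S; rewrite ffunE; apply/eqP/negPn/negP => /(Hf.1)[_].
    by rewrite cards0; lia.
  have -> : f = f set0 *: fone + 0.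
    apply/ffunP => S; rewrite addr0 !ffunE; have [->|S0'] := eqVneq S set0.
      by rewrite [_ *: _]mulr1.
    rewrite scaler0; apply/eqP; apply: contraNT S0' => /(Hf.1)[].
    by rewrite subset0.
  apply: MD => //; apply: (ML [::]); rewrite ?cards0 ?S0 //.
move: Un; rewrite (cardsD1 i) iU ltnS => Un.
have iU' : i \notin U :\ i by rewrite setD11.
move: Hf ML; rewrite -(setD1K iU); move: (U :\ i) iU' Un => V iV Vn Hf ML {U iU}.
have cV : #|i |: V| = #|V|.+1 by rewrite cardsU1 iV.
(* The induction hypothesis is applied to the predicate of being liftable into M; this is why M is
   arbitrary. *)
pose M' g := exists h, [/\ M h, prim (i |: V) m h & upp i h = g].
have [h [Mh Hh def_h]] : M' (upp i f).
  apply: (IH V (m + 1)) => //.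
  - by exists 0; split; rewrite ?linear0 //; apply: prim0.
  - move=> a _ _ [g [Mg Hg <-]] [h [Mh Hh <-]]; exists (a *: g + h).
    by split; [exact: MD | apply: primD => //; exact: primZ | rewrite linearP].
  - by lia.
  - exact: prim_upp.
  move=> L uL LV sL.
  (* A free partner for i exists because #|V| = m + 1 + 2 (size L) exceeds the number of entries of
     L. *)
  have [j jV jL] : exists2 j, j \in V & j \notin pairs L.
    apply/exists_inP; rewrite -negb_forall_in; apply/negP => /forall_inP VL.
    have : (size (enum V) <= size (pairs L))%N.
      by apply: uniq_leq_size (enum_uniq _) _ => k; rewrite mem_enum => /VL.
    rewrite size_pairs -cardE; lia.
  have uLi : uniq (pairs ((i, j) :: L)).
    rewrite /= -/(pairs L) inE negb_or jL uL !andbT; apply/andP; split.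
      by apply: contraNneq iV => ->.
    by apply: contraNN iV => /LV.
  have sub : {subset pairs ((i, j) :: L) <= i |: V}.
    move=> k; rewrite !inE => /or3P[->//|/eqP->|/LV->]; rewrite ?jV ?orbT //.
  exists (ptab ((i, j) :: L)); split.
  - by apply: ML => //=; rewrite cV; lia.
  - by have := prim_ptab uLi sub; congr (prim _ _ _); rewrite cV /=; lia.
  have HL : prim V (#|V|%:Z - 2 * (size L)%:Z) (ptab L) by apply: prim_ptab.
  have ij : i != j by apply: contraNneq iV => ->.
  apply/ffunP => S; rewrite !ffunE setU11 !inE eq_sym (negPf ij) /=.
  case: ifPn => iS; last first.
    rewrite setU1K //; case: ifP => jS; rewrite ?subr0 //.
    have -> : ptab L ((i |: S) :\ j) = 0; last by rewrite subr0.
    rewrite -(low_id iV HL) ffunE !inE ij eqxx //.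
  by rewrite -(low_id iV HL) ffunE iS.
have -> : f = 1 *: (f - h) + h by rewrite scale1r subrK.
apply: (MD) => //; have Hg : prim V (m - 1) (f - h).
  by apply: (prim_narrow iV); [exact: primB | rewrite linearB /= def_h subrr].
have [m_gt0|m_le0] := ltP 0 m; last by rewrite (prim_neg _ Hg) //; lia.
apply: (IH V (m - 1)) => //; first by lia.
move=> L uL LV sL; apply: ML => // [k /LV kV|]; first by rewrite inE kV orbT.
by rewrite cV; lia.
Qed.

End Polytabloids.

(** * The exterior algebra *)

Section Fock.
Variables (R : idomainType) (J : finType) (rk : J -> nat).
Hypotheses (rk_inj : injective rk) (two_nz : 2%:R != 0 :> R).
Local Notation L := {ffun {set J} -> R^o}.
Implicit Types (x y z : L) (i j : J) (S : {set J}).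

(** The sign of moving e_i to its place in the wedge of S ordered by [rk]; the order stays abstract
    so that it can be adapted to the symplectic pairs. *)
Definition sgn i S : R := (-1) ^+ #|[set j in S | (rk j < rk i)%N]|.

Definition create i y : L := [ffun S : {set J} => if i \in S then sgn i S * y (S :\ i) else 0].
Definition annih i y : L := [ffun S : {set J} => if i \in S then 0 else sgn i S * y (i |: S)].

Lemma cr_is_linear i : linear (create i).
Proof.
move=> a y z; apply/ffunP => S; rewrite !ffunE; case: ifP; rewrite ?scaler0 ?addr0 //.
by rewrite mulrDr [_ *: y _]mulrC mulrA mulrC.
Qed.
HB.instance Definition _ i := GRing.isLinear.Build R L L *:%R (create i) (cr_is_linear i).

Lemma an_is_linear i : linear (annih i).
Proof.
move=> a y z; apply/ffunP => S; rewrite !ffunE; case: ifP; rewrite ?scaler0 ?addr0 //.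
by rewrite mulrDr [_ *: y _]mulrC mulrA mulrC.
Qed.
HB.instance Definition _ i := GRing.isLinear.Build R L L *:%R (annih i) (an_is_linear i).

Lemma sgn_sqr i S : sgn i S * sgn i S = 1.
Proof. by rewrite /sgn -expr2 sqrr_sign. Qed.

Lemma sgn_setU1 i j S : j \notin S -> sgn i (j |: S) = (-1) ^+ (rk j < rk i)%N * sgn i S.
Proof.
move=> jS; rewrite /sgn -exprD; congr (_ ^+ _).
have [lt_ji|lt_ji] := boolP (rk j < rk i)%N.
  transitivity #|j |: [set j0 in S | (rk j0 < rk i)%N]|.
    by apply: eq_card => k; rewrite !inE; have [->|] := eqVneq k j; rewrite ?lt_ji.
  by rewrite cardsU1 inE (negPf jS).
rewrite add0n; apply: eq_card => k; rewrite !inE; have [->|//] := eqVneq k j.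
by rewrite (negPf lt_ji) !andbF.
Qed.

Lemma sgn_setD1 i j S : j \in S -> sgn i (S :\ j) = (-1) ^+ (rk j < rk i)%N * sgn i S.
Proof.
move=> jS; rewrite -{2}(setD1K jS) sgn_setU1 ?setD11 //.
by rewrite mulrA -expr2 sqrr_sign mul1r.
Qed.

Lemma sgn_swap i j : i != j ->
  (-1) ^+ (rk i < rk j)%N = - (-1) ^+ (rk j < rk i)%N :> R.
Proof.
move=> neq; case: ltngtP => [_|_|/rk_inj/eqP]; rewrite ?expr0 ?expr1 ?opprK //.
by rewrite (negPf neq).
Qed.

Lemma crC i j y : i != j -> create i (create j y) = - create j (create i y).
Proof.
move=> neq; have ji : j != i by rewrite eq_sym.
apply/ffunP => S; rewrite !ffunE !inE neq ji /=.
case iS: (i \in S); case jS: (j \in S); rewrite ?mulr0 ?oppr0 //.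
rewrite !mulrA !sgn_setD1 // (sgn_swap neq) setDDl setUC -setDDl; ring.
Qed.

Lemma cr_cr i y : create i (create i y) = 0.
Proof.
by apply/ffunP => S; rewrite !ffunE !inE eqxx; case: ifP; rewrite ?mulr0.
Qed.

Lemma an_cr i j y : i != j -> annih i (create j y) = - create j (annih i y).
Proof.
move=> neq; have /negPf ji : j != i by rewrite eq_sym.
apply/ffunP => S; rewrite !ffunE !inE ji neq /=.
case iS: (i \in S); case jS: (j \in S); rewrite ?andbF /= ?mulr0 ?oppr0 //.
rewrite !mulrA sgn_setD1 // sgn_setU1 ?iS // (sgn_swap neq).
have -> : i |: S :\ j = (i |: S) :\ j; last by ring.
by apply/setP => k; rewrite !inE; have [->|] := eqVneq k i; rewrite ?neq.
Qed.

Lemma an_cr_id i y : annih i (create i y) = y - create i (annih i y).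
Proof.
apply/ffunP => S; rewrite !ffunE !inE eqxx /=.
case: ifPn => iS; last by rewrite mulrA sgn_setU1 // ltnn mul1r sgn_sqr mul1r setU1K // subr0.
by rewrite mulrA sgn_setD1 // ltnn mul1r sgn_sqr mul1r setD1K // subrr.
Qed.

Lemma dot_cr i x y : dot (create i x) y = dot x (annih i y).
Proof.
rewrite /dot [LHS](bigID (fun S : {set J} => i \in S)) /= [X in _ + X]big1 ?addr0; last first.
  by move=> S /negPf iS; rewrite ffunE iS mul0r.
rewrite [RHS](bigID (fun S : {set J} => i \in S)) /= [X in X + _]big1 ?add0r; last first.
  by move=> S iS; rewrite ffunE iS mulr0.
rewrite (reindex_onto (fun S => i |: S) (fun S => S :\ i)) /=; last first.
  by move=> S iS; rewrite setD1K.
apply: eq_big => [S|S].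
  rewrite setU11; apply/eqP/idP => [<-|iS]; first by rewrite setD11.
  by rewrite setU1K.
move=> /andP[_ /eqP E]; have iS : i \notin S by rewrite -E setD11.
rewrite !ffunE setU11 E (negPf iS) sgn_setU1 // ltnn mul1r; ring.
Qed.

Definition createv u y : L := \sum_i u i *: create i y.
Definition annihv u y : L := \sum_i u i *: annih i y.

Lemma cv_is_linear u : linear (createv u).
Proof.
move=> a y z; rewrite /createv scaler_sumr -big_split; apply: eq_bigr => i _ /=.
by rewrite linearP /= scalerDr !scalerA mulrC.
Qed.
HB.instance Definition _ u := GRing.isLinear.Build R L L *:%R (createv u) (cv_is_linear u).

Lemma av_is_linear u : linear (annihv u).
Proof.
move=> a y z; rewrite /annihv scaler_sumr -big_split; apply: eq_bigr => i _ /=.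
by rewrite linearP /= scalerDr !scalerA mulrC.
Qed.
HB.instance Definition _ u := GRing.isLinear.Build R L L *:%R (annihv u) (av_is_linear u).

Definition unitv i : J -> R := fun j => (j == i)%:R.

Lemma cv_unit i y : createv (unitv i) y = create i y.
Proof.
rewrite /createv (bigD1 i) //= big1 => [|j /negPf E]; last by rewrite /unitv E scale0r.
by rewrite /unitv eqxx scale1r addr0.
Qed.

Lemma av_unit i y : annihv (unitv i) y = annih i y.
Proof.
rewrite /annihv (bigD1 i) //= big1 => [|j /negPf E]; last by rewrite /unitv E scale0r.
by rewrite /unitv eqxx scale1r addr0.
Qed.

Lemma eq_cv (u v : J -> R) y : u =1 v -> createv u y = createv v y.
Proof. by move=> E; apply: eq_bigr => i _; rewrite E. Qed.

Lemma eq_av (u v : J -> R) y : u =1 v -> annihv u y = annihv v y.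
Proof. by move=> E; apply: eq_bigr => i _; rewrite E. Qed.

Lemma av_cr u i y : annihv u (create i y) = u i *: y - create i (annihv u y).
Proof.
have crZ a z : create i (a *: z) = a *: create i z by rewrite linearZ.
rewrite /annihv [LHS](bigD1 i) //= an_cr_id scalerBr -addrA; congr (_ + _).
rewrite linear_sum [in RHS](bigD1 i) //= opprD crZ; congr (_ + _).
rewrite -sumrN; apply: eq_bigr => j neq.
by rewrite an_cr // crZ scalerN.
Qed.

Lemma av_cv u v y : annihv u (createv v y) = (\sum_i u i * v i) *: y - createv v (annihv u y).
Proof.
rewrite /createv linear_sum scaler_suml -sumrB; apply: eq_bigr => i _.
by rewrite linearZ /= av_cr scalerBr scalerA mulrC.
Qed.

Lemma cr_cv i u y : create i (createv u y) = - createv u (create i y).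
Proof.
rewrite /createv linear_sum -sumrN; apply: eq_bigr => j _; rewrite linearZ /= -scalerN.
by have [->|neq] := eqVneq i j; rewrite ?cr_cr ?oppr0 // crC.
Qed.

Lemma cvC u v y : createv u (createv v y) = - createv v (createv u y).
Proof.
have -> : createv v (createv u y) = \sum_i u i *: createv v (create i y).
  by rewrite {2}/createv linear_sum; apply: eq_bigr => i _; rewrite linearZ.
rewrite {1}/createv -sumrN; apply: eq_bigr => i _.
by rewrite cr_cv scalerN.
Qed.

Lemma two_inj y : y + y = 0 -> y = 0.
Proof.
move/ffunP => E; apply/ffunP => S; have := E S; rewrite !ffunE -mulr2n -mulr_natl => /eqP.
by rewrite mulf_eq0 (negPf two_nz) => /eqP.
Qed.

(** Anticommutation yields only twice the square, hence the assumption on 2. *)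
Lemma cv_sqr u y : createv u (createv u y) = 0.
Proof. by apply: two_inj; rewrite {1}cvC addNr. Qed.

Lemma dot_cv u x y : dot (createv u x) y = dot x (annihv u y).
Proof.
rewrite /createv /annihv.
have -> : forall G : J -> L, dot (\sum_i G i) y = \sum_i dot (G i) y.
  by move=> G; apply: (big_morph (fun z => dot z y)) => [a b|]; rewrite ?dotDl ?dot0l.
have -> : forall G : J -> L, dot x (\sum_i G i) = \sum_i dot x (G i).
  by move=> G; apply: (big_morph (dot x)) => [a b|]; rewrite ?dotDr ?dot0r.
by apply: eq_bigr => i _; rewrite dotZl dotZr dot_cr.
Qed.

Notation vac := (@fone R J).

Lemma an_vac i : annih i vac = 0.
Proof.
apply/ffunP => S; rewrite !ffunE; case: ifP => // iS.
by rewrite -cards_eq0 cardsU1 iS mulr0.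
Qed.

Lemma av_vac u : annihv u vac = 0.
Proof. by rewrite /annihv big1 // => i _; rewrite an_vac scaler0. Qed.

Definition word (K : Type) (u : K -> J -> R) (s : seq K) : L :=
  foldr (fun k y => createv (u k) y) vac s.

Definition mon0 s : L := foldr create vac s.

Lemma word_unit s : word unitv s = mon0 s.
Proof. by elim: s => //= i s ->; rewrite cv_unit. Qed.

Lemma word_map (K K' : Type) (h : K -> K') u (s : seq K) : word u (map h s) = word (u \o h) s.
Proof. by elim: s => //= k s ->. Qed.

Lemma eq_word (K : Type) u v (s : seq K) : (forall k, u k =1 v k) -> word u s = word v s.
Proof. by move=> E; elim: s => //= k s ->; apply: eq_cv. Qed.

Lemma word_mid (K : Type) (u : K -> J -> R) (s t : seq K) (k : K) :
  word u (s ++ k :: t) = (-1) ^+ size s *: word u (k :: s ++ t).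
Proof.
elim: s => [|i s IH] /=; first by rewrite scale1r.
by rewrite IH linearZ /= cvC exprS mulN1r scaleNr scalerN.
Qed.

Lemma word_rep (K : eqType) (u : K -> J -> R) (s : seq K) (k : K) :
  k \in s -> createv (u k) (word u s) = 0.
Proof.
elim: s => //= i s IH; rewrite inE => /predU1P[->|/IH E]; first exact: cv_sqr.
by rewrite cvC E linear0 oppr0.
Qed.

Lemma word_nuniq (K : eqType) (u : K -> J -> R) (s : seq K) : ~~ uniq s -> word u s = 0.
Proof.
elim: s => //= i s IH; rewrite negb_and negbK => /orP[/word_rep->//|/IH->].
by rewrite linear0.
Qed.

(** The exponent is chosen before u: one sign serves basis vectors and arbitrary vectors alike,
    which is what [rho_mon0] relies on. *)
Lemma word_perm (K : eqType) (s t : seq K) : perm_eq s t ->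
  exists b : nat, forall u : K -> J -> R, word u s = (-1) ^+ b *: word u t.
Proof.
elim: s t => [|i s IH] t.
  by rewrite perm_sym => /perm_nilP->; exists 0%N => u; rewrite scale1r.
move=> E; have it : i \in t by rewrite -(perm_mem E) mem_head.
case/splitPr: it E => t1 t2; rewrite perm_sym perm_catC /= perm_cons perm_catC perm_sym.
move=> /IH[b Hb]; exists (b + size t1)%N => u.
rewrite word_mid /= Hb linearZ /= scalerA; congr (_ *: _).
by rewrite -exprD -addnA addnn exprD -[X in _ * X]signr_odd odd_double mulr1.
Qed.

Definition delta S : L := [ffun S' : {set J} => (S' == S)%:R].

Lemma cr_delta i S : i \notin S -> create i (delta S) = sgn i S *: delta (i |: S).
Proof.
move=> iS; apply/ffunP => S'; rewrite !ffunE.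
have [->|neq] := eqVneq S' (i |: S).
  by rewrite setU11 setU1K // eqxx sgn_setU1 // ltnn mul1r.
rewrite scaler0; case: ifP => // iS'; rewrite (_ : (_ == _) = false) ?mulr0 //.
by apply: contraNF neq => /eqP <-; rewrite setD1K.
Qed.

Lemma cr_delta_in i S : i \in S -> create i (delta S) = 0.
Proof.
move=> iS; apply/ffunP => S'; rewrite !ffunE; case: ifP => // iS'.
rewrite (_ : (_ == _) = false) ?mulr0 //.
by apply: contraTF iS => /eqP <-; rewrite setD11.
Qed.

Lemma mon0_delta s : uniq s -> exists b : nat, mon0 s = (-1) ^+ b *: delta [set x in s].
Proof.
elim: s => [_|i s IH /= /andP[iS /IH[b ->]]].
  exists 0%N; rewrite scale1r; have -> // : [set x in [::]] = set0 :> {set J}.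
  by apply/setP => x; rewrite !inE.
rewrite linearZ /= cr_delta ?inE // /sgn scalerA -exprD set_cons.
by eexists.
Qed.

Lemma delta_mon0 S : exists b : nat, delta S = (-1) ^+ b *: mon0 (enum S).
Proof.
have [b E] := mon0_delta (enum_uniq S); exists b.
by rewrite E scalerA -expr2 sqrr_sign scale1r set_enum.
Qed.

Lemma fock_delta y : y = \sum_S y S *: delta S.
Proof.
apply/ffunP => S; rewrite sum_ffunE (bigD1 S) //= big1 => [|S' neq].
  by rewrite !ffunE eqxx addr0 [_ *: _]mulr1.
by rewrite !ffunE eq_sym (negPf neq) scaler0.
Qed.

Lemma fock_ind (P : L -> Prop) :
  P 0 -> (forall a y z, P y -> P z -> P (a *: y + z)) -> (forall s, P (mon0 s)) ->
  forall y, P y.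
Proof.
move=> P0 PD Pm y; rewrite (fock_delta y).
apply: (big_ind P) => // [y1 y2 H1 H2|S _]; first by rewrite -[y1]scale1r; apply: PD.
have [b ->] := delta_mon0 S; rewrite scalerA -[X in P X]addr0.
exact: PD.
Qed.

(* rho A sends e_(j_1) /\ .. /\ e_(j_n) to A e_(j_1) /\ .. /\ A e_(j_n); the factor
   mon0 (enum S) S is the sign relating the enumeration of S to the order rk. *)
Definition rho (A : J -> J -> R) y : L :=
  \sum_S (y S * mon0 (enum S) S) *: word A (enum S).

Lemma rho_is_linear A : linear (rho A).
Proof.
move=> a y z; rewrite /rho scaler_sumr -big_split; apply: eq_bigr => S _ /=.
by rewrite !ffunE scalerA -scalerDl mulrDl mulrA.
Qed.
HB.instance Definition _ A := GRing.isLinear.Build R L L *:%R (rho A) (rho_is_linear A).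

Lemma mon0_nuniq s : ~~ uniq s -> mon0 s = 0.
Proof. by rewrite -word_unit => /word_nuniq. Qed.

Lemma rho_mon0 A s : rho A (mon0 s) = word A s.
Proof.
have [us|nus] := boolP (uniq s); last by rewrite mon0_nuniq // word_nuniq // linear0.
have [|b Hb] := @word_perm _ s (enum [set x in s]).
  by apply: uniq_perm => // [|x]; rewrite ?enum_uniq // mem_enum inE.
rewrite -word_unit !Hb word_unit linearZ /=; congr (_ *: _).
move: [set x in s] => S {s us b Hb}.
have [b E] := mon0_delta (enum_uniq S); rewrite set_enum in E.
rewrite /rho (bigD1 S) //= big1 ?addr0 => [|S' neq].
  by rewrite E !ffunE eqxx [(-1) ^+ b *: _]mulr1 -expr2 sqrr_sign scale1r.
by rewrite [X in X * _](_ : _ = 0) ?mul0r ?scale0r // E !ffunE (negPf neq) scaler0.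
Qed.

Definition appl (A : J -> J -> R) (u : J -> R) : J -> R := fun k => \sum_i u i * A i k.
Definition trf (A : J -> J -> R) : J -> J -> R := fun i k => A k i.

Lemma rho_cv A u y : rho A (createv u y) = createv (appl A u) (rho A y).
Proof.
move: y; apply: fock_ind => [|a y z Hy Hz|s].
- by rewrite !linear0.
- by rewrite !linearP /= Hy Hz.
rewrite /createv linear_sum.
under eq_bigr => i _ do rewrite linearZ /= -[create i _]/(mon0 (i :: s)) rho_mon0 /= /createv scaler_sumr.
rewrite exchange_big /=; apply: eq_bigr => k _.
rewrite rho_mon0 /appl scaler_suml; apply: eq_bigr => i _.
by rewrite scalerA.
Qed.

Lemma rho_cr A i y : rho A (create i y) = createv (A i) (rho A y).
Proof.
rewrite -cv_unit rho_cv; apply: eq_cv => k.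
rewrite /appl (bigD1 i) //= big1 => [|j /negPf E]; last by rewrite /unitv E mul0r.
by rewrite /unitv eqxx mul1r addr0.
Qed.

Lemma rho_vac A : rho A vac = vac.
Proof. by rewrite -[X in rho A X]/(mon0 [::]) rho_mon0. Qed.

Lemma av_rho A u y : annihv u (rho A y) = rho A (annihv (fun i => \sum_k u k * A i k) y).
Proof.
set v := fun i => _; move: y; apply: fock_ind => [|a y z Hy Hz|s].
- by rewrite !linear0.
- by rewrite !linearP /= Hy Hz.
elim: s => [|i s IH]; first by rewrite rho_vac !av_vac linear0.
rewrite [mon0 _]/= rho_cr av_cv IH av_cr linearB linearZ /= rho_cr.
by congr (_ *: _ - _); apply: eq_bigr.
Qed.

Lemma cr_set0 i y : create i y set0 = 0.
Proof. by rewrite ffunE inE. Qed.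

(** By induction on the monomial x: a creation on the left becomes a contraction on the right, and
    [av_rho] moves it through the transposed action. *)
Lemma dot_rho A x y : dot (rho A x) y = dot x (rho (trf A) y).
Proof.
have dot_vac z : dot vac z = z set0.
  rewrite /dot (bigD1 set0) //= ffunE eqxx mul1r big1 ?addr0 // => S /negPf E.
  by rewrite ffunE E mul0r.
move: x y; apply: fock_ind => [|a y z Hy Hz|s] y'.
- by rewrite linear0 !dot0l.
- by rewrite linearP /= !dotDl !dotZl Hy Hz.
elim: s y' => [|i s IH] y.
  rewrite rho_vac !dot_vac; move: y; apply: fock_ind => [|a y z Hy Hz|s].
  - by rewrite linear0.
  - by rewrite linearP /= !ffunE Hy Hz.
  case: s => [|i s]; first by rewrite rho_vac.
  rewrite rho_mon0 /= cr_set0 /createv sum_ffunE big1 // => k _.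
  by rewrite ffunE cr_set0 scaler0.
rewrite [mon0 _]/= rho_cr dot_cv IH dot_cr -av_unit av_rho; congr (dot _ (rho _ _)).
apply: eq_av => k; rewrite (bigD1 i) //= big1 => [|j /negPf E]; last by rewrite /unitv E mul0r.
by rewrite /unitv eqxx mul1r addr0.
Qed.

Lemma av_word n (X : 'I_n.+1 -> J -> R) u :
  annihv u (word X (enum 'I_n.+1)) = \sum_(j < n.+1) ((-1) ^+ j * (\sum_i u i * X j i)) *:
     word (X \o lift j) (enum 'I_n).
Proof.
elim: n X => [|n IH] X.
  rewrite enum_ordSl /= (_ : enum 'I_0 = [::]) /=; last by apply: size0nil; rewrite size_enum_ord.
  by rewrite av_cv av_vac linear0 subr0 big_ord_recl big_ord0 addr0 expr0 mul1r.
rewrite enum_ordSl /= av_cv word_map IH [RHS]big_ord_recl expr0 mul1r; congr (_ + _).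
have cvS (w : J -> R) m (G : 'I_m -> L) : createv w (\sum_j G j) = \sum_j createv w (G j).
  by rewrite linear_sum.
rewrite cvS -sumrN; apply: eq_bigr => j _.
rewrite linearZ /= enum_ordSl /= -scaleNr /bump leq0n add1n exprS -!mulNr mulN1r; congr (_ *: _).
rewrite word_map; have -> : lift (lift ord0 j) ord0 = ord0 by apply: val_inj.
congr (createv _ _); apply: eq_word => k i /=; congr (X _ i).
by apply: val_inj; rewrite /= /bump /=; lia.
Qed.

(** Contracting the word by the first basis vector is the Laplace expansion along the first row.
    This ties words to the minors defining [wedge]. *)
Lemma wick n (f : 'I_n -> J) (X : 'I_n -> J -> R) :
  dot (mon0 (map f (enum 'I_n))) (word X (enum 'I_n)) = \det (\matrix_(i, j) X j (f i)).
Proof.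
elim: n f X => [|n IH] f X.
  rewrite (_ : enum 'I_0 = [::]) /=; last by apply: size0nil; rewrite size_enum_ord.
  rewrite det_mx00 /dot (bigD1 set0) //= !ffunE eqxx mul1r big1 ?addr0 // => S /negPf E.
  by rewrite ffunE E mul0r.
rewrite {1}enum_ordSl /= dot_cr -av_unit av_word.
rewrite (expand_det_row _ ord0).
have -> : forall (G : 'I_n.+1 -> L) z, dot z (\sum_i G i) = \sum_i dot z (G i).
  by move=> G z; apply: (big_morph (dot z)) => [a b|]; rewrite ?dotDr ?dot0r.
apply: eq_bigr => j _; rewrite dotZr -map_comp IH mxE /cofactor add0n.
rewrite [X in _ * X * _](_ : _ = X j (f ord0)); last first.
  rewrite (bigD1 (f ord0)) //= big1 => [|k /negPf E]; last by rewrite /unitv E mul0r.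
  by rewrite /unitv eqxx mul1r addr0.
rewrite mulrCA mulrA; congr (_ * \det _).
by apply/matrixP => a b; rewrite !mxE.
Qed.

End Fock.

(** * Exterior powers of H in the exterior algebra, and the operator E *)

Section Symplectic.
Variable g : nat.
Local Notation N := (g + g)%N.

(* The order a_1 < b_1 < a_2 < b_2 < .. : with it, no sign appears when
   a_i /\ b_i is wedged with a basis vector. *)
Definition srank (j : 'I_N) : nat :=
  match split j with inl i => (2 * i)%N | inr i => (2 * i).+1 end.

Lemma srank_l (i : 'I_g) : srank (lshift g i) = (2 * i)%N.
Proof. by rewrite /srank (unsplitK (inl i)). Qed.

Lemma srank_r (i : 'I_g) : srank (rshift g i) = (2 * i).+1.
Proof. by rewrite /srank (unsplitK (inr i)). Qed.

Lemma srank_inj : injective srank.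
Proof.
move=> j1 j2; rewrite -(splitK j1) -(splitK j2).
case: (split j1) => i1; case: (split j2) => i2 /=; rewrite ?srank_l ?srank_r => H;
  try lia; congr (_ _); apply: val_inj => /=; lia.
Qed.

Lemma Sp_tr (A : Sp g) : val A *m sympl_mx g *m (val A)^T = sympl_mx g.
Proof.
have := Sp_mulmxV A; rewrite /Sp_inv_mx mulmxN => /(congr1 (fun M => M *m sympl_mx g)).
rewrite mul1mx mulNmx -!mulmxA sympl_mx_sqr !mulmxN mulmx1 opprK.
by [].

Qed.

Lemma Sp_trP (A : Sp g) : (val A)^T^T *m sympl_mx g *m (val A)^T == sympl_mx g.
Proof. by rewrite trmxK Sp_tr. Qed.

(** Closure under transposition makes the standard form contravariant: the orthogonal of a stable
    subspace is stable. *)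
Definition Sp_trmx (A : Sp g) : Sp g := Sub (val A)^T (Sp_trP A).

Section Coefficients.
Variables (R : idomainType).
Hypothesis two_nz : 2%:R != 0 :> R.
Local Notation L := {ffun {set 'I_N} -> R^o}.
Implicit Types (x y z : L) (i : 'I_g).
Notation create := (@create R _ srank).
Notation mon0 := (@mon0 R _ srank).
Notation word := (@word R _ srank).
Notation createv := (@createv R _ srank).
Notation rho := (@rho R _ srank).
Notation vac := (@fone R 'I_N).

(** Transposed because [rho] expects the image of e_j, a column of A, as the function at j. *)
Definition imx (A : 'M[int]_N) : 'I_N -> 'I_N -> R := fun j k => (A k j)%:~R.

(** The basis of [ext] follows the order of 'I_N, not [srank]; using [mon0] rather than [delta]
    accounts for the sign between the two. *)
Definition phi k (x : ext k N) : L :=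
  \sum_(s : incr k N) (x s)%:~R *: mon0 (codom (val s)).

Lemma phi_is_zmod_morphism k : zmod_morphism (@phi k).
Proof.
move=> x y; rewrite /phi -sumrB; apply: eq_bigr => s _.
by rewrite !ffunE intrB scalerBl.
Qed.
HB.instance Definition _ k := GRing.isZmodMorphism.Build (ext k N) L (@phi k)
  (@phi_is_zmod_morphism k).

Definition degree_in d y := forall S, y S != 0 -> #|S| = d.

Lemma hdeg0 d : degree_in d 0.
Proof. by move=> S; rewrite ffunE eqxx. Qed.

Lemma hdegD d y z : degree_in d y -> degree_in d z -> degree_in d (y + z).
Proof.
move=> Hy Hz S; rewrite ffunE; have [->|/Hy //] := eqVneq (y S) 0.
by rewrite add0r => /Hz.
Qed.

Lemma hdegZ d (a : R) y : degree_in d y -> degree_in d (a *: y).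
Proof.
by move=> Hy S; rewrite ffunE => H; apply: Hy; apply: contraNneq H => ->; rewrite scaler0.
Qed.

Lemma hdeg_sum d (K : finType) (P : pred K) (G : K -> L) :
  (forall k, P k -> degree_in d (G k)) -> degree_in d (\sum_(k | P k) G k).
Proof. by move=> H; apply: big_ind => //; [apply: hdeg0 | move=> ? ?; apply: hdegD]. Qed.

Lemma hdeg_cr d j y : degree_in d y -> degree_in d.+1 (create j y).
Proof.
move=> Hy S; rewrite ffunE; case: ifP; rewrite ?eqxx // => jS H.
rewrite (cardsD1 j) jS (Hy (S :\ j)) //.
by apply: contraNneq H => ->; rewrite mulr0.
Qed.

Lemma hdeg_word (K : Type) (u : K -> 'I_N -> R) (s : seq K) : degree_in (size s) (word u s).
Proof.
elim: s => [|k s IH] /=.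
  move=> S; rewrite ffunE; have [->|_] := eqVneq S set0; rewrite ?cards0 ?eqxx //.
by rewrite /createv; apply: hdeg_sum => j _; apply: hdegZ; apply: hdeg_cr.
Qed.

Lemma hdeg_mon0 s : degree_in (size s) (mon0 s).
Proof. by rewrite -word_unit; apply: hdeg_word. Qed.

Lemma hdeg_phi k (x : ext k N) : degree_in k (phi x).
Proof.
apply: hdeg_sum => s _; apply: hdegZ.
by have := @hdeg_mon0 (codom (val s)); rewrite size_codom card_ord.
Qed.

Lemma codom_uniq k (s : incr k N) : uniq (codom (val s)).
Proof. by rewrite map_inj_uniq ?enum_uniq //; apply: incr_inj. Qed.

Lemma incr_of_set k (S : {set 'I_N}) : #|S| = k ->
  exists s : incr k N, [set x in codom (val s)] = S.
Proof.
move=> Sk; pose f := [ffun i : 'I_k => enum_val (cast_ord (esym Sk) i)].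
have f_inj : injective f.
  by move=> i j; rewrite !ffunE => /enum_val_inj /cast_ord_inj.
have [[s v] /= E] := incr_perm_ex f_inj; exists s.
apply/eqP; rewrite eqEcard; apply/andP; split; last first.
  rewrite Sk -[X in (X <= _)%N]card_ord -(size_codom (val s)).
  by rewrite cardsE (card_uniqP (codom_uniq s)).
apply/subsetP => x; rewrite inE => /codomP[i ->].
have /ffunP/(_ (v^-1 i)%g) := E; rewrite !ffunE permKV => ->.
exact: enum_valP.
Qed.

Lemma hdeg_eq0 k z : degree_in k z -> (forall s : incr k N, dot (mon0 (codom (val s))) z = 0) -> z = 0.
Proof.
move=> Hz H; apply/ffunP => S; rewrite ffunE; apply/eqP/negPn/negP => zS.
have [s def_S] := incr_of_set (Hz S zS).
have [b E] := @mon0_delta R _ srank _ (codom_uniq s).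
have := H s; rewrite E def_S dotZl => /eqP; rewrite mulf_eq0 signr_eq0 /=.
rewrite /dot (bigD1 S) //= ffunE eqxx mul1r big1 ?addr0 ?(negPf zS) // => S' /negPf E'.
by rewrite ffunE E' mul0r.
Qed.

Lemma dot_mon0 k (s t : incr k N) :
  dot (mon0 (codom (val t))) (mon0 (codom (val s))) = (t == s)%:R.
Proof.
rewrite -(word_unit R srank (codom (val s))) !codomE word_map.
rewrite wick //; last exact: srank_inj.
have /ffunP/(_ t) := wedge_colsub1 s; rewrite !ffunE => /(congr1 (fun n => n%:~R : R)).
rewrite -det_map_mx rmorph_nat => <-; congr (\det _).
by apply/matrixP => i j; rewrite !mxE /= /unitv rmorph_nat.
Qed.

(** Both sides have degree k and pair equally with all monomials: for the word these pairings are
    minors, by [wick]. *)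
Lemma phi_wedge k (X : 'M[int]_(N, k)) :
  phi (wedge X) = word (fun j l => (X l j)%:~R) (enum 'I_k).
Proof.
apply/eqP; rewrite -subr_eq0; apply/eqP; apply: (@hdeg_eq0 k).
  apply: hdegD; first exact: hdeg_phi.
  rewrite -scaleN1r; apply: hdegZ.
  by have := @hdeg_word _ (fun j l => (X l j)%:~R) (enum 'I_k); rewrite size_enum_ord.
move=> t; rewrite dotDr dotNr; apply/eqP; rewrite subr_eq0; apply/eqP.
rewrite {2}codomE wick //; last exact: srank_inj.
rewrite /phi (_ : dot _ _ = \sum_(s : incr k N) (wedge X s)%:~R * (t == s)%:R); last first.
  rewrite (big_morph (dot (mon0 (codom (val t)))) (id1 := 0) (op1 := +%R)) => [|a b|]; rewrite ?dotDr ?dot0r //.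
  by apply: eq_bigr => s _; rewrite dotZr dot_mon0.
rewrite (bigD1 t) //= eqxx mulr1 big1 ?addr0 => [|s /negPf E]; last by rewrite eq_sym E mulr0.
rewrite ffunE -det_map_mx; congr (\det _).
by apply/matrixP => i j; rewrite !mxE.
Qed.

Lemma phi_act k (A : 'M[int]_N) (x : ext k N) : phi (ext_act A x) = rho (imx A) (phi x).
Proof.
rewrite /ext_act raddf_sum /phi linear_sum; apply: eq_bigr => s _.
rewrite raddfMz linearZ /= -/(phi _) phi_wedge rho_mon0 //; last exact: srank_inj.
rewrite codomE [word (imx A) _]word_map scaler_int; congr (_ *~ _).
by apply: eq_word => j i /=; rewrite /imx mxE.
Qed.

Definition E y : L := \sum_i create (lshift g i) (create (rshift g i) y).

Lemma E_is_linear : linear E.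
Proof.
by move=> a y z; rewrite /E scaler_sumr -big_split; apply: eq_bigr => i _; rewrite !linearP.
Qed.
HB.instance Definition _ := GRing.isLinear.Build R L L *:%R E E_is_linear.

(* The doubled sum depends on A only through A J A^T, whence the equivariance of E;
   this is where 2 <> 0 is needed. *)
Lemma cv_pair_sum (A : 'M[int]_N) z :
  let Q := \sum_i createv (imx A (lshift g i)) (createv (imx A (rshift g i)) z) in
  Q + Q = \sum_k \sum_l ((A *m sympl_mx g *m A^T) k l)%:~R *: create k (create l z).
Proof.
move=> Q; pose M k l := \sum_i (A k (lshift g i))%:~R * (A l (rshift g i))%:~R : R.
have QE : Q = \sum_k \sum_l M k l *: create k (create l z).
  rewrite /Q /createv; under eq_bigr => i _.
    rewrite (eq_bigr (fun k => \sum_l ((A k (lshift g i))%:~R * (A l (rshift g i))%:~R : R) *: create k (create l z))).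
    2: { by move=> k _; rewrite linear_sum scaler_sumr; apply: eq_bigr => l _;
         rewrite linearZ /= scalerA. }
    over.
  rewrite exchange_big /=; apply: eq_bigr => k _; rewrite exchange_big /=.
  by apply: eq_bigr => l _; rewrite scaler_suml.
rewrite {2}QE exchange_big QE -big_split; apply: eq_bigr => k _.
rewrite -big_split; apply: eq_bigr => l _ /=.
have -> : create l (create k z) = - create k (create l z).
  by have [->|neq] := eqVneq k l; [rewrite cr_cr oppr0 | rewrite crC 1?eq_sym //; apply: srank_inj].
rewrite scalerN -scaleNr -scalerDl; congr (_ *: _).
have -> : A *m sympl_mx g *m A^T = lsubmx A *m (rsubmx A)^T - rsubmx A *m (lsubmx A)^T.
  rewrite -{1 2}(hsubmxK A) /sympl_mx mul_row_block !mulmx0 add0r addr0 mulmx1 mulmxN mulmx1.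
  by rewrite tr_row_mx mul_row_col mulNmx addrC.
rewrite !mxE intrD intrN !rmorph_sum /M -sumrN; congr (_ + _).
  by apply: eq_bigr => i _; rewrite rmorphM /= !mxE.
by rewrite -sumrN; apply: eq_bigr => i _; rewrite rmorphM /= !mxE mulrC.
Qed.

Lemma E_rho (A : Sp g) y : rho (imx (val A)) (E y) = E (rho (imx (val A)) y).
Proof.
set z := rho _ y.
have -> : rho (imx (val A)) (E y) =
    \sum_i createv (imx (val A) (lshift g i)) (createv (imx (val A) (rshift g i)) z).
  rewrite /E linear_sum; apply: eq_bigr => i _.
  by rewrite /= !rho_cr //; apply: srank_inj.
have -> : E z = \sum_i createv (imx 1%:M (lshift g i)) (createv (imx 1%:M (rshift g i)) z).
  apply: eq_bigr => i _.
  have unitE j t : createv (imx 1%:M j) t = create j t.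
    by rewrite -cv_unit; apply: eq_cv => l; rewrite /imx /unitv mxE rmorph_nat.
  by rewrite !unitE.
apply/eqP; rewrite -subr_eq0; apply/eqP; apply: (two_inj two_nz).
rewrite addrACA -opprD; apply/eqP; rewrite subr_eq0; apply/eqP.
by rewrite !cv_pair_sum Sp_tr trmx1 mulmx1 mul1mx.
Qed.

End Coefficients.
End Symplectic.

(** * Torus components *)

Section Components.
Variable g : nat.
Local Notation N := (g + g)%N.
Implicit Types (A B K J : {set 'I_g}) (S : {set 'I_N}) (i : 'I_g).

Definition ab A B : {set 'I_N} :=
  [set j | match split j with inl i => i \in A | inr i => i \in B end].

Lemma mem_ab_l A B i : (lshift g i \in ab A B) = (i \in A).
Proof. by rewrite inE (unsplitK (inl i)). Qed.
Lemma mem_ab_r A B i : (rshift g i \in ab A B) = (i \in B).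
Proof. by rewrite inE (unsplitK (inr i)). Qed.

Lemma ab_ind S S' : (forall i, (lshift g i \in S) = (lshift g i \in S')) ->
  (forall i, (rshift g i \in S) = (rshift g i \in S')) -> S = S'.
Proof.
by move=> Hl Hr; apply/setP => j; rewrite -(splitK j); case: (split j) => i /=.
Qed.

Lemma ab_inj A B A' B' : ab A B = ab A' B' -> A = A' /\ B = B'.
Proof.
move=> E; split; apply/setP => i; first by rewrite -(mem_ab_l A B) E mem_ab_l.
by rewrite -(mem_ab_r A B) E mem_ab_r.
Qed.

Lemma abP S : exists A B, S = ab A B.
Proof.
exists [set i | lshift g i \in S], [set i | rshift g i \in S].
by apply: ab_ind => i; rewrite ?mem_ab_l ?mem_ab_r inE.
Qed.

Lemma card_ab A B : #|ab A B| = (#|A| + #|B|)%N.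
Proof.
rewrite -!sum1_card big_mkcond big_split_ord [X in _ = (X + _)%N]big_mkcond.
rewrite [X in _ = (_ + X)%N]big_mkcond.
by congr (_ + _)%N; apply: eq_bigr => i _; rewrite ?mem_ab_l ?mem_ab_r.
Qed.

Lemma ab_setD1 A B i : (ab A B :\ lshift g i) :\ rshift g i = ab (A :\ i) (B :\ i).
Proof.
apply: ab_ind => j; rewrite !in_setD1 ?mem_ab_l ?mem_ab_r in_setD1.
  by rewrite eq_lrshift (inj_eq (@lshift_inj _ _)).
by rewrite eq_rlshift (inj_eq (@rshift_inj _ _)).
Qed.

Lemma ab_setU_split A B : exists A' B' K, [/\ [disjoint A' & B'], K \subset ~: (A' :|: B'),
  A = A' :|: K & B = B' :|: K].
Proof.
exists (A :\: B), (B :\: A), (A :&: B); split.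
- rewrite -setI_eq0; apply/eqP/setP => i; rewrite !inE.
  by case: (i \in A); case: (i \in B).
- by apply/subsetP => i; rewrite !inE; case: (i \in A); case: (i \in B).
- by apply/setP => i; rewrite !inE; case: (i \in A); case: (i \in B).
- by apply/setP => i; rewrite !inE; case: (i \in A); case: (i \in B).
Qed.

Lemma ab_setU_inj A B K A' B' K' :
  [disjoint A & B] -> K \subset ~: (A :|: B) ->
  [disjoint A' & B'] -> K' \subset ~: (A' :|: B') ->
  ab (A :|: K) (B :|: K) = ab (A' :|: K') (B' :|: K') -> [/\ A = A', B = B' & K = K'].
Proof.
rewrite -!setI_eq0 => /eqP/setP dAB /subsetP sK /eqP/setP dAB' /subsetP sK'.
move=> /ab_inj[/setP EA /setP EB].
by split; apply/setP => i; have := EA i; have := EB i; have := dAB i; have := dAB' i;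
  have := sK i; have := sK' i; rewrite !inE; case: (i \in A); case: (i \in B);
  case: (i \in K); case: (i \in A'); case: (i \in B'); case: (i \in K') => //=;
  intuition.
Qed.

Lemma card_compl A B : [disjoint A & B] -> (#|~: (A :|: B)| + #|A| + #|B| = g)%N.
Proof.
move=> dAB; have := cardsC (A :|: B); rewrite card_ord cardsU disjoint_setI0 // cards0; lia.
Qed.

Section Coefficients.
Variables (R : idomainType).
Hypothesis two_nz : 2%:R != 0 :> R.
Local Notation L := {ffun {set 'I_N} -> R^o}.
Local Notation T := {ffun {set 'I_g} -> R^o}.
Implicit Types (x y z w : L) (f h : T).
Notation create := (@create R _ (@srank g)).
Notation mon0 := (@mon0 R _ (@srank g)).
Notation E := (@E g R).

Lemma cr_cr_ab i y A B : create (lshift g i) (create (rshift g i) y) (ab A B) =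
  if (i \in A) && (i \in B) then y (ab (A :\ i) (B :\ i)) else 0.
Proof.
rewrite ffunE mem_ab_l; case: ifP => //= iA; rewrite ffunE in_setD1 eq_rlshift mem_ab_r /=.
case: ifP => iB; rewrite ?mulr0 // ab_setD1 mulrA.
rewrite (_ : sgn R _ (rshift g i) _ = sgn R (@srank g) (lshift g i) (ab A B)).
  by rewrite sgn_sqr mul1r.
congr (_ ^+ _); apply: eq_card => j; rewrite !inE srank_l srank_r ltnS leq_eqVlt.
have [->|neq] := eqVneq j (lshift g i); first by rewrite srank_l ltnn andbF.
rewrite -[(2 * i)%N]srank_l (inj_eq (@srank_inj g)) (negPf neq) /=.
by [].
Qed.

Definition pairE i y : L := create (lshift g i) (create (rshift g i) y).

Lemma pairE_is_linear i : linear (pairE i).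
Proof. by move=> a y z; rewrite /pairE !linearP. Qed.
HB.instance Definition _ i := GRing.isLinear.Build R L L *:%R (pairE i) (pairE_is_linear i).

Definition comp A B y : T :=
  [ffun K : {set 'I_g} => if K \subset ~: (A :|: B) then y (ab (A :|: K) (B :|: K)) else 0].

Lemma comp_is_linear A B : linear (comp A B).
Proof.
by move=> a y z; apply/ffunP => K; rewrite !ffunE; case: ifP; rewrite ?scaler0 ?addr0.
Qed.
HB.instance Definition _ A B := GRing.isLinear.Build R L T *:%R (comp A B) (comp_is_linear A B).

Lemma comp_pairE A B i y : [disjoint A & B] ->
  comp A B (pairE i y) = if i \in ~: (A :|: B) then mulv i (comp A B y) else 0.
Proof.
rewrite -setI_eq0 => /eqP/setP/(_ i); rewrite !inE => dAB.
apply/ffunP => K; rewrite ffunE cr_cr_ab !inE.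
case: ifPn => [KU|KU]; last first.
  case: ifPn => iU; rewrite !ffunE //; case: ifP => // iK; case: ifP => // sub.
  by case/negP: KU; rewrite -(setD1K iK) subUset sub andbT sub1set !inE.
case: (boolP (i \in K)) => iK; last first.
  rewrite !orbF dAB; case: ifP; rewrite !ffunE // (negPf iK) //.
have := subsetP KU _ iK; rewrite !inE => iU; rewrite iU !orbT !ffunE iK.
rewrite (subset_trans (subD1set _ _) KU); move: iU; rewrite negb_or => /andP[iA iB].
by congr (y (ab _ _)); apply/setP => j; rewrite !inE; have [->|//] := eqVneq j i;
  rewrite ?(negPf iA) ?(negPf iB).
Qed.

Lemma comp_E A B y : [disjoint A & B] ->
  comp A B (E y) = raise (~: (A :|: B)) (comp A B y).
Proof.
move=> dAB; rewrite /E linear_sum /raise [RHS]big_mkcond; apply: eq_bigr => i _.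
exact: comp_pairE.
Qed.

Lemma comp_iterE A B n y : [disjoint A & B] ->
  comp A B (iter n E y) = iter n (raise (~: (A :|: B))) (comp A B y).
Proof. by move=> dAB; elim: n => // n IH; rewrite !iterS comp_E // IH. Qed.

Lemma comp_inj y z : (forall A B, [disjoint A & B] -> comp A B y = comp A B z) -> y = z.
Proof.
move=> H; apply/ffunP => S; have [A [B ->]] := abP S.
have [A' [B' [K [dAB KU -> ->]]]] := ab_setU_split A B.
by have /ffunP/(_ K) := H _ _ dAB; rewrite !ffunE KU.
Qed.

Definition emb A B f : L :=
  \sum_(K : {set 'I_g} | K \subset ~: (A :|: B)) f K *: delta R (ab (A :|: K) (B :|: K)).

Lemma emb_is_linear A B : linear (emb A B).
Proof.
move=> a f h; rewrite /emb scaler_sumr -big_split; apply: eq_bigr => K _ /=.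
by rewrite !ffunE scalerDl scalerA.
Qed.
HB.instance Definition _ A B := GRing.isLinear.Build R T L *:%R (emb A B) (emb_is_linear A B).

Lemma comp_emb A B f : [disjoint A & B] -> (forall K, f K != 0 -> K \subset ~: (A :|: B)) ->
  comp A B (emb A B f) = f.
Proof.
move=> dAB Hf; apply/ffunP => K; rewrite ffunE; case: ifPn => KU; last first.
  by apply/esym/eqP; apply: contraNT KU; apply: Hf.
rewrite /emb sum_ffunE (bigD1 K) //= !ffunE eqxx big1 ?addr0 => [|K' /andP[KU' neq]].
  by rewrite [_ *: _]mulr1.
rewrite !ffunE; case: eqP => [/ab_setU_inj E|]; last by rewrite scaler0.
by have [_ _ E'] := E dAB KU dAB KU'; rewrite E' eqxx in neq.
Qed.

Lemma comp_emb_neq A B A' B' f : [disjoint A & B] -> [disjoint A' & B'] ->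
  (A, B) != (A', B') -> comp A' B' (emb A B f) = 0.
Proof.
move=> dAB dAB' neq; apply/ffunP => K; rewrite !ffunE; case: ifPn => KU //.
rewrite /emb sum_ffunE big1 // => K' KU'; rewrite !ffunE.
case: eqP => [/ab_setU_inj E|]; last by rewrite scaler0.
by have [EA EB _] := E dAB' KU dAB KU'; rewrite EA EB eqxx in neq.
Qed.

Lemma comp_sum_emb (w : {set 'I_g} -> {set 'I_g} -> T) A B :
  (forall A B, [disjoint A & B] -> forall K, w A B K != 0 -> K \subset ~: (A :|: B)) ->
  [disjoint A & B] ->
  comp A B (\sum_(u : {set 'I_g} * {set 'I_g} | [disjoint u.1 & u.2]) emb u.1 u.2 (w u.1 u.2))
    = w A B.
Proof.
move=> Hw dAB; rewrite linear_sum (bigD1 (A, B)) //= comp_emb //; last exact: Hw.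
rewrite big1 ?addr0 // => -[A' B'] /= /andP[dAB' neq].
exact: comp_emb_neq.
Qed.

Lemma emb_comp y :
  y = \sum_(u : {set 'I_g} * {set 'I_g} | [disjoint u.1 & u.2]) emb u.1 u.2 (comp u.1 u.2 y).
Proof.
apply: comp_inj => A B dAB; rewrite (comp_sum_emb (w := fun A B => comp A B y)) // => A' B' dAB' K.
by rewrite ffunE; case: ifP => //; rewrite eqxx.
Qed.

Lemma dot_emb A B y f : (forall K, f K != 0 -> K \subset ~: (A :|: B)) ->
  dot y (emb A B f) = dot (comp A B y) f.
Proof.
move=> Hf; rewrite /emb.
rewrite (big_morph (dot y) (id1 := 0) (op1 := +%R)) => [|a b|]; rewrite ?dotDr ?dot0r //.
rewrite [RHS](bigID (fun K : {set 'I_g} => K \subset ~: (A :|: B))) /= [X in _ + X]big1 ?addr0.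
  apply: eq_bigr => K KU; rewrite dotZr ffunE KU mulrC; congr (_ * _).
  rewrite /dot (bigD1 (ab (A :|: K) (B :|: K))) //= ffunE eqxx mulr1 big1 ?addr0 //.
  by move=> S /negPf E; rewrite ffunE E mulr0.
by move=> K KU; rewrite ffunE (negPf KU) mul0r.
Qed.

Lemma pairE_emb A B i f : [disjoint A & B] -> i \in ~: (A :|: B) ->
  (forall K, f K != 0 -> K \subset ~: (A :|: B)) -> pairE i (emb A B f) = emb A B (mulv i f).
Proof.
move=> dAB iU Hf; apply: comp_inj => A' B' dAB'; rewrite comp_pairE //.
have Hi K : mulv i f K != 0 -> K \subset ~: (A :|: B).
  rewrite ffunE; case: ifP; rewrite ?eqxx // => iK /Hf sub.
  by rewrite -(setD1K iK) subUset sub1set iU.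
have [[<- <-]|neq] := eqVneq (A, B) (A', B'); first by rewrite !comp_emb // iU.
by rewrite !comp_emb_neq // linear0; case: ifP.
Qed.

Lemma emb_fone A B : [disjoint A & B] -> emb A B (fone R _) = delta R (ab A B).
Proof.
move=> dAB; rewrite /emb (bigD1 set0) ?sub0set //= !setU0 ffunE eqxx scale1r.
by rewrite big1 ?addr0 // => K /andP[_ /negPf E']; rewrite ffunE E' scale0r.
Qed.

(** One m fits all components: in degree k = #|A| + #|B| + 2 #|K| the weight #|~: (A :|: B)| - 2
    #|K| is always g - k. *)
Definition primL (m : int) y := forall A B, [disjoint A & B] -> prim (~: (A :|: B)) m (comp A B y).

Lemma primL0 m : primL m 0.
Proof. by move=> A B _; rewrite linear0; apply: prim0. Qed.

Lemma prim_supp U m f : prim U m f -> forall K, f K != 0 -> K \subset U.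
Proof. by move=> Hf K /(Hf.1)[]. Qed.

Lemma primL_emb m A B f : [disjoint A & B] -> prim (~: (A :|: B)) m f -> primL m (emb A B f).
Proof.
move=> dAB Hf A' B' dAB'; have [[<- <-]|neq] := eqVneq (A, B) (A', B').
  by rewrite comp_emb //; apply: prim_supp Hf.
by rewrite comp_emb_neq //; apply: prim0.
Qed.

(** Testing y against E of a single basis vector of the component (A, B) reads off one value of F on
    that component, to which [prim_of_ker] applies. *)
Lemma primL_of_ker k y : (forall t, (0 < t)%N -> t%:R != 0 :> R) ->
  degree_in k y -> (forall z, dot y (E z) = 0) -> primL (g%:Z - k%:Z) y.
Proof.
move=> char0 Hy HE A B dAB; apply: prim_of_ker => // [K|J JU].
  rewrite ffunE; case: ifPn; rewrite ?eqxx // => KU /Hy; rewrite card_ab => Hk; split=> //.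
  have := card_compl dAB.
  have dK : [disjoint A & K] /\ [disjoint B & K].
    rewrite -!setI_eq0 -!subset0; split; apply/subsetP => i; rewrite !inE => /andP[iA /(subsetP KU)];
      by rewrite !inE iA ?orbT.
  move: Hk; rewrite !cardsU !disjoint_setI0 ?cards0 ?dK.1 ?dK.2 //; lia.
pose dJ := delta R J; have HdJ K : dJ K != 0 -> K \subset ~: (A :|: B).
  by rewrite ffunE; have [->|_] := eqVneq K J; rewrite ?eqxx.
have Er : E (emb A B dJ) = emb A B (raise (~: (A :|: B)) dJ).
  apply: comp_inj => A' B' dAB'; rewrite comp_E //.
  have Hr K : raise (~: (A :|: B)) dJ K != 0 -> K \subset ~: (A :|: B).
    have Hd : homog (~: (A :|: B)) #|J| dJ.
      by move=> K' HK'; split; [exact: HdJ|move: HK'; rewrite ffunE; have [->|_] := eqVneq K' J; rewrite ?eqxx].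
    by move=> /(homog_raise Hd)[].
  have [[<- <-]|neq] := eqVneq (A, B) (A', B'); first by rewrite !comp_emb.
  by rewrite !comp_emb_neq // linear0.
have := HE (emb A B dJ); rewrite Er dot_emb => [|K HK]; last first.
  move: HK; rewrite /raise sum_ffunE => HK; apply: contraNT HK => KU.
  rewrite big1 // => i iU; rewrite !ffunE; case: ifP => // iK; case: eqP => // EK.
  by case/negP: KU; rewrite -(setD1K iK) EK subUset sub1set JU iU.
rewrite /raise (big_morph (dot (comp A B y)) (id1 := 0) (op1 := +%R)) => [|a b|]; rewrite ?dotDr ?dot0r //.
move=> H0; rewrite -[RHS]H0 [RHS](bigID [in J]) /= [X in X + _]big1 ?add0r; last first.
  move=> i /andP[_ iJ]; rewrite dot_mulv /dot big1 // => K _; rewrite !ffunE.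
  by case: ifP => [_|iK]; rewrite ?mul0r //; case: eqP => [E'|]; rewrite ?mulr0 // E' iJ in iK *.
rewrite [RHS](eq_bigl [in ~: (A :|: B) :\: J]) => [|i]; last by rewrite [RHS]inE andbC.
apply: eq_bigr => i; rewrite inE => /andP[iJ _]; rewrite dot_mulv /dot (bigD1 J) //= big1 ?addr0.
  by rewrite [dJ J]ffunE eqxx mulr1 [in RHS]ffunE (negPf iJ).
by move=> K /negPf E'; rewrite [dJ K]ffunE E' mulr0.
Qed.

Lemma primL_span (M : L -> Prop) m y :
  M 0 -> (forall (a : R) y z, M y -> M z -> M (a *: y + z)) ->
  0 <= m -> primL m y ->
  (forall A B PL, [disjoint A & B] -> uniq (pairs PL) -> {subset pairs PL <= ~: (A :|: B)} ->
     #|~: (A :|: B)|%:Z = m + 2 * (size PL)%:Z -> M (emb A B (ptab R PL))) ->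
  M y.
Proof.
move=> M0 MD m_ge0 Hy HM; rewrite (emb_comp y).
apply: (big_ind M) => // [y1 y2 H1 H2|[A B] /= dAB]; first by rewrite -[y1]scale1r; apply: MD.
apply: (@prim_span R _ (fun f => M (emb A B f)) (~: (A :|: B)) m) => //.
- by rewrite linear0.
- by move=> a f h Hf Hh; rewrite linearP; apply: MD.
- exact: Hy.
- by move=> PL *; apply: HM.
Qed.

End Coefficients.

Section FiniteCharacteristic.
Variables (p : nat) (F : fieldType).
Hypotheses (p_prime : prime p) (p_char : p%:R = 0 :> F)
  (char_p : forall t, (0 < t < p)%N -> t%:R != 0 :> F).
Local Notation L := {ffun {set 'I_N} -> F^o}.
Implicit Types (y z w : L) (c q : nat).
Notation E := (@E g F).

Definition resL_ker c q y :=
  if q is 0 then forall z, primL (block p c 0) z -> dot y z = 0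
  else iter c E y = 0.

Lemma E_primL c q w : (0 < c < p)%N -> primL (block p (p - c) q.+1) w ->
  primL (block p c q) (iter (p - c) E w).
Proof.
by move=> cp Hw A B dAB; rewrite comp_iterE //; apply: raise_block => //; apply: Hw.
Qed.

Lemma E_iter_char y : iter p E y = 0.
Proof.
apply: comp_inj => A B dAB; rewrite comp_iterE // linear0 iter_raise_char //.
exact: prime_gt0.
Qed.

Lemma E_dot_primL c w z : (0 < c < p)%N -> primL (block p (p - c) 1) w -> primL (block p c 0) z ->
  dot (iter (p - c) E w) z = 0.
Proof.
move=> cp Hw Hz; rewrite dotC (emb_comp (iter _ _ _)).
rewrite (big_morph (dot z) (id1 := 0) (op1 := +%R)) => [|a b|]; rewrite ?dotDr ?dot0r //.
rewrite big1 // => -[A B] /= dAB; have H := E_primL cp Hw dAB.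
rewrite dot_emb; last exact: prim_supp H.
rewrite comp_iterE // dotC.
have /= K := res_ker_im (q := 0) p_prime p_char cp (Hw _ _ dAB).
by apply: K; apply: Hz.
Qed.

(** E preserves the torus components and acts on each as [raise]; preimages are chosen component by
    component and reassembled by [emb]. *)
Theorem resL_exact c q y : (0 < c < p)%N -> primL (block p c q) y -> resL_ker c q y ->
  exists2 w, primL (block p (p - c) q.+1) w & y = iter (p - c) E w.
Proof.
move=> cp Hy Ky.
have ex (u : {set 'I_g} * {set 'I_g}) : exists f : {ffun {set 'I_g} -> F^o},
    [disjoint u.1 & u.2] -> prim (~: (u.1 :|: u.2)) (block p (p - c) q.+1) f /\
    comp u.1 u.2 y = iter (p - c) (raise (~: (u.1 :|: u.2))) f.
  case: u => A B /=; have [dAB|_] := boolP [disjoint A & B]; last by exists 0.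
  have [|w Hw Ew] := raise_exact p_prime p_char char_p cp (Hy _ _ dAB); last by exists w.
  case: q Hy Ky => [|q] /= Hy Ky; last by rewrite -comp_iterE // Ky linear0.
  move=> z Hz; rewrite -dot_emb; last exact: prim_supp Hz.
  by apply: Ky; apply: primL_emb.
have [w Hw] := choice ex.
have Hw' A B : [disjoint A & B] -> forall K, w (A, B) K != 0 -> K \subset ~: (A :|: B).
  by move=> /(Hw (A, B))[Hp _]; apply: prim_supp Hp.
exists (\sum_(u : {set 'I_g} * {set 'I_g} | [disjoint u.1 & u.2]) emb u.1 u.2 (w (u.1, u.2))).
  move=> A B dAB; rewrite (comp_sum_emb (w := fun A B => w (A, B))) //.
  by have [] := Hw (A, B) dAB.
apply: comp_inj => A B dAB; rewrite comp_iterE // (comp_sum_emb (w := fun A B => w (A, B))) //.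
by have [] := Hw (A, B) dAB.
Qed.

End FiniteCharacteristic.
End Components.

(** * Generation by the highest weight vector *)

Section ElementarySymplectic.
Variable g : nat.
Implicit Types (i j s t : 'I_g).

Lemma delta_mx_mul (r c r' c' : 'I_g) :
  delta_mx r c *m delta_mx r' c' = if c == r' then delta_mx r c' else 0 :> 'M[int]_g.
Proof.
case: eqP => [->|/eqP neq]; first by rewrite mul_delta_mx.
by rewrite mul_delta_mx_0.
Qed.

(** The transvections: [up_mx i] adds a_i to b_i, and [lo_mx i] adds b_i to a_i. *)
Definition up_mx i : 'M[int]_(g + g) := block_mx 1%:M (delta_mx i i) 0 1%:M.
Definition lo_mx i : 'M[int]_(g + g) := block_mx 1%:M 0 (delta_mx i i) 1%:M.

Lemma Sp_upP i : (up_mx i)^T *m sympl_mx g *m up_mx i == sympl_mx g.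
Proof.
rewrite /up_mx /sympl_mx tr_block_mx !mulmx_block !trmx1 trmx0 trmx_delta.
by rewrite !(mul0mx, mulmx0, mul1mx, mulmx1, add0r, addr0, mulmxN, mulNmx) ?subrr ?addNr.
Qed.

Lemma Sp_loP i : (lo_mx i)^T *m sympl_mx g *m lo_mx i == sympl_mx g.
Proof.
rewrite /lo_mx /sympl_mx tr_block_mx !mulmx_block !trmx1 trmx0 trmx_delta.
by rewrite !(mul0mx, mulmx0, mul1mx, mulmx1, add0r, addr0, mulmxN, mulNmx) ?subrr ?addNr.
Qed.

Definition Sp_up i : Sp g := Sub (up_mx i) (Sp_upP i).
Definition Sp_lo i : Sp g := Sub (lo_mx i) (Sp_loP i).

(** An elementary matrix of GL_g inside Sp: a_s goes to a_s + a_t and b_t to b_t - b_s. For s = t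
    the block formula is not symplectic, whence the default 1. *)
Definition levi_mx s t : 'M[int]_(g + g) :=
  if s == t then 1%:M else block_mx (1%:M + delta_mx t s) 0 0 (1%:M - delta_mx s t).

Lemma Sp_leviP s t : (levi_mx s t)^T *m sympl_mx g *m levi_mx s t == sympl_mx g.
Proof.
rewrite /levi_mx; have [_|st] := eqVneq s t; first by rewrite trmx1 mul1mx mulmx1.
rewrite /sympl_mx tr_block_mx !mulmx_block !trmx0.
rewrite !(mul0mx, mulmx0, mul1mx, mulmx1, add0r, addr0, mulmxN, mulNmx).
have -> : (1%:M + delta_mx t s)^T = 1%:M + delta_mx s t :> 'M[int]_g.
  by rewrite linearD /= trmx1 trmx_delta.
have -> : (1%:M - delta_mx s t)^T = 1%:M - delta_mx t s :> 'M[int]_g.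
  by rewrite linearB /= trmx1 trmx_delta.
have E1 : (1%:M + delta_mx s t) *m (1%:M - delta_mx s t) = 1%:M :> 'M[int]_g.
  rewrite mulmxDl mul1mx mulmxBr mulmx1 delta_mx_mul eq_sym (negPf st) subr0.
  by rewrite subrK.
have E2 : (1%:M - delta_mx t s) *m (1%:M + delta_mx t s) = 1%:M :> 'M[int]_g.
  rewrite mulmxDr mulmx1 mulmxBl mul1mx delta_mx_mul (negPf st) subr0.
  by rewrite subrK.
by rewrite E1 E2.
Qed.

Definition Sp_levi s t : Sp g := Sub (levi_mx s t) (Sp_leviP s t).

Section Coefficients.
Variables (R : idomainType).
Hypothesis two_nz : 2%:R != 0 :> R.
Local Notation N := (g + g)%N.
Local Notation L := {ffun {set 'I_N} -> R^o}.
Implicit Types (x y z w : L).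
Notation create := (@create R _ (@srank g)).
Notation createv := (@createv R _ (@srank g)).
Notation mon0 := (@mon0 R _ (@srank g)).
Notation rho := (@rho R _ (@srank g)).
Notation a i := (lshift g i).
Notation b i := (rshift g i).
Notation act A := (rho (imx R (val A))).
Notation E := (@E g R).
Notation pairE := (@pairE g R).

Lemma cv_split (u : 'I_N -> R) z :
  createv u z = \sum_i u (a i) *: create (a i) z + \sum_i u (b i) *: create (b i) z.
Proof. by rewrite /createv big_split_ord. Qed.

Lemma sum_unit j (h : 'I_g -> L) : \sum_i ((1%:M : 'M[int]_g) i j)%:~R *: h i = h j.
Proof.
rewrite (bigD1 j) //= mxE eqxx scale1r big1 ?addr0 // => i /negPf neq.
by rewrite mxE neq scale0r.
Qed.

Lemma sum_delta r c j (h : 'I_g -> L) :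
  \sum_i ((delta_mx r c : 'M[int]_g) i j)%:~R *: h i = if j == c then h r else 0.
Proof.
rewrite (bigD1 r) //= mxE eqxx /= big1 ?addr0 => [|i /negPf neq]; last by rewrite mxE neq scale0r.
by case: eqP; rewrite ?scale1r ?scale0r.
Qed.

Lemma sum_zero j (h : 'I_g -> L) : \sum_i ((0 : 'M[int]_g) i j)%:~R *: h i = 0.
Proof. by rewrite big1 // => i _; rewrite mxE scale0r. Qed.

Lemma cv_block_l (A B C D : 'M[int]_g) j z : createv (imx R (block_mx A B C D) (a j)) z =
  \sum_i (A i j)%:~R *: create (a i) z + \sum_i (C i j)%:~R *: create (b i) z.
Proof.
by rewrite cv_split; congr (_ + _); apply: eq_bigr => i _; rewrite /imx ?block_mxEul ?block_mxEdl.
Qed.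

Lemma cv_block_r (A B C D : 'M[int]_g) j z : createv (imx R (block_mx A B C D) (b j)) z =
  \sum_i (B i j)%:~R *: create (a i) z + \sum_i (D i j)%:~R *: create (b i) z.
Proof.
by rewrite cv_split; congr (_ + _); apply: eq_bigr => i _; rewrite /imx ?block_mxEur ?block_mxEdr.
Qed.

Lemma act_cr (A : Sp g) (j : 'I_N) y : act A (create j y) = createv (imx R (val A) j) (act A y).
Proof. by rewrite rho_cr //; apply: srank_inj. Qed.

Lemma up_l i j y : act (Sp_up i) (create (a j) y) = create (a j) (act (Sp_up i) y).
Proof. by rewrite act_cr /= cv_block_l sum_unit sum_zero addr0. Qed.

Lemma up_r i j y : act (Sp_up i) (create (b j) y) =
  create (b j) (act (Sp_up i) y) + (if j == i then create (a i) (act (Sp_up i) y) else 0).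
Proof. by rewrite act_cr /= cv_block_r sum_unit sum_delta addrC. Qed.

Lemma lo_r i j y : act (Sp_lo i) (create (b j) y) = create (b j) (act (Sp_lo i) y).
Proof. by rewrite act_cr /= cv_block_r sum_unit sum_zero add0r. Qed.

Lemma lo_l i j y : act (Sp_lo i) (create (a j) y) =
  create (a j) (act (Sp_lo i) y) + (if j == i then create (b i) (act (Sp_lo i) y) else 0).
Proof. by rewrite act_cr /= cv_block_l sum_unit sum_delta. Qed.

Lemma levi_l s t j y : s != t -> act (Sp_levi s t) (create (a j) y) =
  create (a j) (act (Sp_levi s t) y) + (if j == s then create (a t) (act (Sp_levi s t) y) else 0).
Proof.
move=> st; rewrite act_cr; set z := act _ y; rewrite /= /levi_mx (negPf st) cv_block_l sum_zero addr0.
under eq_bigr => i _ do rewrite mxE intrD scalerDl.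
by rewrite big_split /= sum_unit sum_delta.
Qed.

Lemma levi_r s t j y : s != t -> act (Sp_levi s t) (create (b j) y) =
  create (b j) (act (Sp_levi s t) y) - (if j == t then create (b s) (act (Sp_levi s t) y) else 0).
Proof.
move=> st; rewrite act_cr; set z := act _ y; rewrite /= /levi_mx (negPf st) cv_block_r sum_zero add0r.
under eq_bigr => i _ do rewrite mxE intrD scalerDl [in X in _ + X]mxE intrN scaleNr.
by rewrite big_split /= sumrN sum_unit sum_delta.
Qed.

Definition monab (la lb : seq 'I_g) : L :=
  mon0 ([seq a i | i <- la] ++ [seq b i | i <- lb]).

Lemma monab_cons i la lb : monab (i :: la) lb = create (a i) (monab la lb).
Proof. by []. Qed.

Lemma fix_mon0 (A : Sp g) (s : seq 'I_N) :
  (forall (j : 'I_N) y, j \in s -> act A (create j y) = create j (act A y)) -> act A (mon0 s) = mon0 s.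
Proof.
elim: s => [|j s IH] H; first by rewrite /= rho_vac //; apply: srank_inj.
by rewrite /= H ?mem_head // IH // => k y ks; apply: H; rewrite inE ks orbT.
Qed.

Lemma lo_monab i la lb : i \notin la -> act (Sp_lo i) (monab la lb) = monab la lb.
Proof.
move=> ila; apply: fix_mon0 => j y; rewrite mem_cat => /orP[] /mapP[k kl ->].
  by rewrite lo_l; case: eqP => [E|]; rewrite ?addr0 // -E kl in ila *.
exact: lo_r.
Qed.

Lemma levi_monab s t la lb : s != t -> s \notin la -> t \notin lb ->
  act (Sp_levi s t) (monab la lb) = monab la lb.
Proof.
move=> st sla tlb; apply: fix_mon0 => j y; rewrite mem_cat => /orP[] /mapP[k kl ->].
  by rewrite levi_l //; case: eqP => [E|]; rewrite ?addr0 // -E kl in sla *.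
by rewrite levi_r //; case: eqP => [E|]; rewrite ?subr0 // -E kl in tlb *.
Qed.

Definition stable (M : L -> Prop) :=
  [/\ M 0, forall (c : R) y z, M y -> M z -> M (c *: y + z) & forall (A : Sp g) y, M y -> M (act A y)].

Section Stable.
Variables (M : L -> Prop) (HM : stable M).

Lemma stableZ (c : R) y : M y -> M (c *: y).
Proof. by case: HM => M0 MD _ My; rewrite -[_ *: _]addr0; apply: MD. Qed.

Lemma stableD y z : M y -> M z -> M (y + z).
Proof. by case: HM => _ MD _ My Mz; rewrite -[y]scale1r; apply: MD. Qed.

Lemma stableB y z : M y -> M z -> M (y - z).
Proof. by move=> My Mz; rewrite -scaleN1r; apply: stableD => //; apply: stableZ. Qed.

Lemma stable_act (A : Sp g) y : M y -> M (act A y).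
Proof. by case: HM => _ _; apply. Qed.

Lemma stable_perm (s t : seq 'I_N) : perm_eq s t -> M (mon0 s) -> M (mon0 t).
Proof.
rewrite perm_sym => /(@word_perm R _ _ (@srank_inj g))[n H].
by rewrite -!word_unit H => ?; apply: stableZ.
Qed.

Variable is0 : seq 'I_g.
Hypotheses (is0_uniq : uniq is0) (M_is0 : M (monab is0 [::])).

(** Exchange: for s in la but not in is0, and t in is0 but not in la, [Sp_levi t s] minus the
    identity turns a_t into a_s. The induction counts the entries outside is0. *)
Lemma stable_a la : uniq la -> size la = size is0 -> M (monab la [::]).
Proof.
have [n] := ubnP (size [seq i <- la | i \notin is0]).
elim: n la => // n IH la; rewrite ltnS => Hn ula sla.
have [/allP sub|/allPn[s sla' sn]] := boolP (all [in is0] la).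
  have [|_ E] := uniq_min_size ula sub; first by rewrite sla.
  apply: stable_perm M_is0; rewrite /= !cats0; apply: perm_map.
  by apply: uniq_perm => // x; rewrite E.
have [t ti tn] : exists2 t, t \in is0 & t \notin la.
  apply/hasP; rewrite -[has _ _]negbK -all_predC; apply/negP => /allP sub.
  have sub' : {subset is0 <= la} by move=> x /sub /=; rewrite negbK.
  have [|_ E] := uniq_min_size is0_uniq sub'; first by rewrite sla.
  by rewrite E sla' in sn.
have Ela := perm_to_rem sla'.
have tl' : t \notin rem s la by apply: contraNN tn => /mem_rem.
have ts : t != s by apply: contraNneq tn => ->.
have Mt : M (monab (t :: rem s la) [::]).
  apply: IH; last 1 first.
  - by rewrite /= size_rem // prednK // -has_predT; apply/hasP; exists s.
  - move: Hn; rewrite /= ti /=; apply: leq_trans.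
    by have := perm_filter (fun i => i \notin is0) Ela; rewrite /= sn => /perm_size ->.
  - by rewrite /= tl' rem_uniq.
have : M (monab (s :: rem s la) [::]).
  have -> : monab (s :: rem s la) [::] =
      act (Sp_levi t s) (monab (t :: rem s la) [::]) - monab (t :: rem s la) [::].
    rewrite !monab_cons levi_l // eqxx levi_monab //.
    by rewrite addrAC subrr add0r.
  by apply: stableB => //; apply: stable_act.
by apply: stable_perm; rewrite !cats0 perm_map // perm_sym.
Qed.

(** [Sp_lo j] minus the identity replaces the factor a_j by b_j and touches no other factor. *)
Lemma stable_ab la lb : uniq (la ++ lb) -> (size la + size lb)%N = size is0 -> M (monab la lb).
Proof.
elim: lb la => [|j lb IH] la; first by rewrite cats0 addn0; apply: stable_a.
move=> ul sl; have ul' : uniq ((j :: la) ++ lb).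
  rewrite -(perm_uniq (s1 := la ++ j :: lb)) //.
  by rewrite -[j :: lb]cat1s -[j :: la]cat1s -catA perm_catCA.
have jla : j \notin la by move: ul'; rewrite /= mem_cat negb_or => /andP[/andP[]].
have Mj : M (monab (j :: la) lb) by apply: IH => //=; move: sl => /=; lia.
have : M (create (b j) (monab la lb)).
  have -> : create (b j) (monab la lb) = act (Sp_lo j) (monab (j :: la) lb) - monab (j :: la) lb.
    rewrite monab_cons lo_l eqxx lo_monab //.
    by rewrite addrAC subrr add0r.
  by apply: stableB => //; apply: stable_act.
rewrite -[create _ _]/(mon0 (b j :: [seq a i | i <- la] ++ [seq b i | i <- lb])).
apply: stable_perm.
by rewrite -[_ :: _ ++ _]cat1s perm_catCA.
Qed.

Definition pairword (PL : seq ('I_g * 'I_g)) z : L :=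
  foldr (fun st z => pairE st.1 z - pairE st.2 z) z PL.

Lemma pairE_cr i (j : 'I_N) z : pairE i (create j z) = create j (pairE i z).
Proof.
rewrite /pairE; have Hr := @srank_inj g.
have ab_neq : a i != b i by rewrite eq_lrshift.
have [->|n1] := eqVneq j (b i).
  by rewrite cr_cr linear0 crC 1?eq_sym // cr_cr linear0 oppr0.
have [->|n2] := eqVneq j (a i).
  by rewrite cr_cr crC // cr_cr linear0 oppr0.
have crN k y : create k (- y) = - create k y by rewrite linearN.
by rewrite (crC Hr (i := b i)) 1?eq_sym // crN crC 1?eq_sym // opprK.
Qed.

Lemma pairword_cr PL (j : 'I_N) z : pairword PL (create j z) = create j (pairword PL z).
Proof. by elim: PL => //= st PL ->; rewrite !pairE_cr linearB. Qed.

Lemma pairword_is_linear PL : linear (pairword PL).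
Proof.
elim: PL => [|st PL IH] c y z //=; rewrite IH.
have pE k u v : pairE k (c *: u + v) = c *: pairE k u + pairE k v by rewrite linearP.
by rewrite !pE scalerBr opprD addrACA.
Qed.
HB.instance Definition _ PL := GRing.isLinear.Build R L L *:%R (pairword PL) (pairword_is_linear PL).

Lemma levi_pairword s t PL z : s != t -> s \notin pairs PL -> t \notin pairs PL ->
  act (Sp_levi s t) z = z -> act (Sp_levi s t) (pairword PL z) = pairword PL z.
Proof.
move=> st; elim: PL => //= -[i j] PL IH /=; rewrite !inE !negb_or.
move=> /and3P[si sj sPL] /and3P[ti tj tPL] Hz.
have H k y : s != k -> t != k -> act (Sp_levi s t) y = y -> act (Sp_levi s t) (pairE k y) = pairE k y.
  move=> sk tk Hy; rewrite /pairE levi_l // (eq_sym k) (negPf sk) addr0.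
  by rewrite levi_r // (eq_sym k) (negPf tk) subr0 Hy.
by rewrite linearB /= !H // IH.
Qed.

(* With G = Sp_levi s t and y free of the indices s and t, (G - 1)(a_s /\ b_t /\ y)
   = a_t /\ b_t /\ y - a_s /\ b_s /\ y - a_t /\ b_s /\ y. *)
Lemma stable_pairs PL la lb : uniq (la ++ lb ++ pairs PL) ->
  (size la + size lb + 2 * size PL)%N = size is0 -> M (pairword PL (monab la lb)).
Proof.
elim: PL la lb => [|[s t] PL IH] la lb.
  by rewrite /= cats0 muln0 addn0; apply: stable_ab.
move=> ul sl; set z0 := monab la lb; set y := pairword PL z0.
have ul2 : uniq (s :: t :: (la ++ lb ++ pairs PL)).
  rewrite -(perm_uniq (s1 := la ++ lb ++ pairs ((s, t) :: PL))) //.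
  by rewrite catA [in X in perm_eq _ X]catA -[_ :: _ :: _]/([:: s; t] ++ _) perm_catCA.
have := ul2; rewrite !cons_uniq !in_cons !mem_cat !negb_or.
move=> /and3P[/and4P[st sla slb sPL] /and3P[tla tlb tPL] _].
have swap s' t' : perm_eq [:: s'; t'] [:: s; t] -> M (create (a s') (create (b t') y)).
  move=> st'; rewrite -!pairword_cr.
  have [|n Hn] := @word_perm R _ _ (@srank_inj g) _ 
     (a s' :: b t' :: [seq a i | i <- la] ++ [seq b i | i <- lb])
     ([seq a i | i <- s' :: la] ++ [seq b i | i <- t' :: lb]).
    by rewrite /= perm_cons -cat1s -[_ :: map _ lb]cat1s perm_catCA.
  have -> : create (a s') (create (b t') z0) = (-1) ^+ n *: monab (s' :: la) (t' :: lb).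
    by rewrite /monab -[mon0 ([seq _ | _ <- s' :: la] ++ _)]word_unit -Hn word_unit.
  have pwZ c w : pairword PL (c *: w) = c *: pairword PL w by rewrite linearZ.
  rewrite pwZ; apply: stableZ.
  apply: (IH (s' :: la) (t' :: lb)); last first.
    by rewrite -sl /= mulnS !addSn !addnS.
  rewrite -(perm_uniq (s1 := s :: t :: (la ++ lb ++ pairs PL))) //.
  rewrite -[_ :: _ :: _]/([:: s; t] ++ _) perm_sym.
  apply: perm_trans (perm_cat st' (perm_refl _)).
  by rewrite /= perm_cons -[_ :: lb ++ _]/([:: t'] ++ _) perm_catCA.
have Mst : M (create (a s) (create (b t) y)) by apply: swap.
have Mts : M (create (a t) (create (b s) y)) by apply: swap; rewrite (perm_catC [:: t] [:: s]).
have Gy : act (Sp_levi s t) y = y.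
  by apply: levi_pairword => //; apply: levi_monab.
have G2 : act (Sp_levi s t) (create (a s) (create (b t) y)) =
   create (a s) (create (b t) y) - pairE s y + pairE t y - create (a t) (create (b s) y).
  by rewrite levi_l // eqxx levi_r // eqxx Gy !linearB /= addrA.
have -> : pairword ((s, t) :: PL) z0 =
  create (a s) (create (b t) y) - act (Sp_levi s t) (create (a s) (create (b t) y)) - create (a t) (create (b s) y).
  rewrite G2 /= -/y; move: (create _ _) (pairE s y) (pairE t y) (create (a t) _) => u v w x.
  by rewrite !opprD !opprK !addrA subrr add0r addrK.
by apply: stableB => //; apply: stableB => //; apply: stable_act.
Qed.

End Stable.
End Coefficients.
End ElementarySymplectic.

Section Generation.
Variables (g : nat) (R : idomainType).
Hypothesis two_nz : 2%:R != 0 :> R.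
Local Notation N := (g + g)%N.
Local Notation L := {ffun {set 'I_N} -> R^o}.
Implicit Types (x y z w : L) (i j : 'I_g) (A B : {set 'I_g}).
Notation create := (@create R _ (@srank g)).
Notation mon0 := (@mon0 R _ (@srank g)).
Notation rho := (@rho R _ (@srank g)).
Notation a i := (lshift g i).
Notation b i := (rshift g i).
Notation act A := (rho (imx R (val A))).
Notation monab := (@monab g R).

Lemma set_ab (la lb : seq 'I_g) :
  [set x in [seq a i | i <- la] ++ [seq b i | i <- lb]] = ab [set i in la] [set i in lb].
Proof.
have lr i (l : seq 'I_g) : a i \notin [seq b i | i <- l].
  by apply/negP => /mapP[j _ /eqP]; rewrite eq_lrshift.
have rl i (l : seq 'I_g) : b i \notin [seq a i | i <- l].
  by apply/negP => /mapP[j _ /eqP]; rewrite eq_rlshift.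
apply: ab_ind => i; rewrite inE mem_cat ?mem_ab_l ?mem_ab_r inE.
  by rewrite (negPf (lr _ _)) orbF mem_map //; apply: lshift_inj.
by rewrite (negPf (rl _ _)) mem_map //; apply: rshift_inj.
Qed.

Lemma uniq_ab (la lb : seq 'I_g) :
  uniq la -> uniq lb -> uniq ([seq a i | i <- la] ++ [seq b i | i <- lb]).
Proof.
move=> ua ub; rewrite cat_uniq !map_inj_uniq ?ua ?ub ?andbT; try exact: rshift_inj; try exact: lshift_inj.
by apply/hasPn => _ /mapP[i _ ->]; apply/negP => /mapP[j _ /eqP]; rewrite eq_rlshift.
Qed.

Lemma monab_delta (la lb : seq 'I_g) : uniq la -> uniq lb ->
  exists n : nat, monab la lb = (-1) ^+ n *: delta R (ab [set i in la] [set i in lb]).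
Proof.
move=> ua ub; have [n E] := mon0_delta R (@srank g) (uniq_ab ua ub).
by exists n; rewrite /monab E set_ab.
Qed.

Lemma emb_ptab A B PL : [disjoint A & B] -> uniq (pairs PL) -> {subset pairs PL <= ~: (A :|: B)} ->
  emb A B (ptab R PL) = pairword PL (delta R (ab A B)).
Proof.
move=> dAB; elim: PL => [|[s t] PL IH] /=; first by rewrite emb_fone.
rewrite inE => /andP[/norP[_ sPL] /andP[tPL uPL]] sub.
have sub' : {subset pairs PL <= ~: (A :|: B)}.
  by move=> x xPL; apply: sub; rewrite !inE xPL !orbT.
have supp := prim_supp (prim_ptab R uPL sub').
rewrite linearB /= -!pairE_emb ?IH //; apply: sub; rewrite !inE eqxx ?orbT //.
Qed.

Section Stable.
Variables (M : L -> Prop) (HM : stable M).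
Variable is0 : seq 'I_g.
Hypotheses (is0_uniq : uniq is0) (M_is0 : M (monab is0 [::])).

Lemma stable_emb A B PL : [disjoint A & B] -> uniq (pairs PL) ->
  {subset pairs PL <= ~: (A :|: B)} ->
  #|~: (A :|: B)|%:Z = g%:Z - (size is0)%:Z + 2 * (size PL)%:Z -> M (emb A B (ptab R PL)).
Proof.
move=> dAB uPL sub sz; rewrite emb_ptab //.
have [n] := monab_delta (enum_uniq A) (enum_uniq B); rewrite !set_enum => E.
have -> : delta R (ab A B) = (-1) ^+ n *: monab (enum A) (enum B).
  by rewrite E scalerA -expr2 sqrr_sign scale1r.
have pwZ c w : pairword PL (c *: w) = c *: pairword PL w by rewrite linearZ.
rewrite pwZ; apply: stableZ => //; apply: (stable_pairs two_nz HM is0_uniq M_is0).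
  rewrite !cat_uniq !enum_uniq uPL !andbT /=; apply/andP; split.
    apply/hasPn => x; rewrite mem_cat !mem_enum => /orP[xB|/sub].
      by apply/negP => xA; move/disjoint_setI0/setP/(_ x): dAB; rewrite !inE xA xB.
    by rewrite !inE negb_or => /andP[].
  by apply/hasPn => x /sub; rewrite !inE mem_enum negb_or => /andP[].
have := card_compl dAB; rewrite -!cardE. move: sz; move: #|~: (A :|: B)| #|A| #|B| (size PL) (size is0) => n1 n2 n3 n4 n5. lia.
Qed.

(** The spanning vectors are obtained from one monomial by differences of group elements, with no
    division; hence the same statement over Z and over F_p. *)
Lemma stable_primL y : primL (g%:Z - (size is0)%:Z) y -> M y.
Proof.
case: (HM) => M0 MD _ Hy; apply: (primL_span M0 MD _ Hy) => [|A B PL]; last exact: stable_emb.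
have := uniq_leq_size is0_uniq (s2 := enum 'I_g); rewrite size_enum_ord => H.
have := H (fun (j : 'I_g) _ => etrans (mem_enum _ _) isT); move: (size is0) => n. lia.
Qed.

End Stable.

Definition filt i y : L := [ffun S : {set 'I_N} => if (a i \in S) && (b i \notin S) then y S else 0].

Lemma filt_is_linear i : linear (filt i).
Proof.
by move=> c y z; apply/ffunP => S; rewrite !ffunE; case: ifP; rewrite ?scaler0 ?addr0.
Qed.
HB.instance Definition _ i := GRing.isLinear.Build R L L *:%R (filt i) (filt_is_linear i).

Lemma filt_delta i S : filt i (delta R S) = if (a i \in S) && (b i \notin S) then delta R S else 0.
Proof.
apply/ffunP => S'; rewrite !ffunE; have [->|/negPf neq] := eqVneq S' S.
  by case: ifP; rewrite ffunE ?eqxx.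
by case: ifP; case: ifP; rewrite ffunE ?neq.
Qed.

(** [Sp_lo i] minus the identity turns a_i into b_i and kills terms without a_i or with both;
    [Sp_up i] minus the identity turns that b_i back into a_i. *)
Lemma filt_act i y :
  act (Sp_up i) (act (Sp_lo i) y - y) - (act (Sp_lo i) y - y) = filt i y.
Proof.
have Hr := @srank_inj g; pose P z := act (Sp_up i) (act (Sp_lo i) z - z) - (act (Sp_lo i) z - z).
rewrite -[LHS]/(P y).
have PD c u v : P (c *: u + v) = c *: P u + P v.
  have E1 : act (Sp_lo i) (c *: u + v) - (c *: u + v) =
      c *: (act (Sp_lo i) u - u) + (act (Sp_lo i) v - v).
    by rewrite linearP scalerBr opprD addrACA.
  rewrite /P E1; set X := _ - u; set Y := _ - v.
  have -> : act (Sp_up i) (c *: X + Y) = c *: act (Sp_up i) X + act (Sp_up i) Y by rewrite linearP.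
  clearbody X Y; by rewrite scalerBr opprD addrACA.
have P0 : P 0 = 0 by have := PD (-1) 0 0; rewrite !scaleN1r oppr0 addr0 addNr.
have PZ c u : P (c *: u) = c *: P u by rewrite -[c *: u]addr0 PD P0 addr0.
move: y; apply: (fock_ind (rk := @srank g)) => [|c u v Hu Hv|s].
- by rewrite P0 linear0.
- by rewrite PD Hu Hv linearP.
have [us|nus] := boolP (uniq s); last by rewrite mon0_nuniq // P0 linear0.
have lo_fix (t : seq 'I_N) : a i \notin t -> act (Sp_lo i) (mon0 t) = mon0 t.
  move=> ait; apply: fix_mon0 => // j y; rewrite -(splitK j); case: (split j) => j' /= jt.
    by rewrite lo_l //; case: eqP => [E|]; rewrite ?addr0 // -E jt in ait *.
  by rewrite lo_r.
have up_fix (t : seq 'I_N) : b i \notin t -> act (Sp_up i) (mon0 t) = mon0 t.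
  move=> bit; apply: fix_mon0 => // j y; rewrite -(splitK j); case: (split j) => j' /= jt.
    by rewrite up_l.
  by rewrite up_r //; case: eqP => [E|]; rewrite ?addr0 // -E jt in bit *.
have [n En] := mon0_delta R (@srank g) us.
have [as_|ans] := boolP (a i \in s); last first.
  by rewrite /P lo_fix // subrr linear0 subrr En linearZ /= filt_delta inE (negPf ans) scaler0.
have [|m Hm] := @word_perm R _ _ Hr _ s (a i :: rem (a i) s); first exact: perm_to_rem.
have := Hm (@unitv R _); rewrite !word_unit => {}Hm; rewrite Hm PZ linearZ; congr (_ *: _).
have aiu : a i \notin rem (a i) s by rewrite mem_rem_uniq // inE eqxx.
have Plo : act (Sp_lo i) (mon0 (a i :: rem (a i) s)) - mon0 (a i :: rem (a i) s)
    = create (b i) (mon0 (rem (a i) s)).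
  by rewrite /= lo_l // eqxx lo_fix // addrAC subrr add0r.
have ur := rem_uniq (a i) us.
have [k Ek] := mon0_delta R (@srank g) ur.
have ba : b i != a i by rewrite eq_rlshift.
have [|m' Em'] := @mon0_delta R _ (@srank g) (a i :: rem (a i) s); first by rewrite /= aiu ur.
rewrite /P Plo; have [bis|bns] := boolP (b i \in rem (a i) s).
  have -> : create (b i) (mon0 (rem (a i) s)) = 0 by rewrite Ek linearZ /= cr_delta_in ?scaler0 // inE.
  by rewrite linear0 subrr Em' linearZ /= filt_delta !inE bis orbT andbF scaler0.
rewrite up_r // eqxx up_fix // addrAC subrr add0r -[create _ _]/(mon0 (a i :: rem (a i) s)).
by rewrite Em' linearZ /= filt_delta !inE eqxx (negPf ba) (negPf bns).
Qed.

Lemma filt_fold y (l : seq 'I_g) (S : {set 'I_N}) :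
  foldr filt y l S = if all (fun i => (a i \in S) && (b i \notin S)) l then y S else 0.
Proof.
by elim: l => //= i l IH; rewrite ffunE IH; case: (_ && _).
Qed.

End Generation.

Section Irreducible.
Variables (g : nat) (F : fieldType).
Hypothesis two_nz : 2%:R != 0 :> F.
Local Notation L := {ffun {set 'I_(g + g)} -> F^o}.

Lemma dot_monab (la : seq 'I_g) : uniq la -> dot (monab F la [::]) (monab F la [::]) = 1.
Proof.
move=> ul; have [n ->] := monab_delta F ul (isT : uniq [::]).
rewrite dotZl dotZr mulrA -expr2 sqrr_sign mul1r /dot (bigD1 (ab [set i in la] [set i in [::]])) //=.
by rewrite ffunE eqxx mulr1 big1 ?addr0 // => S /negPf E; rewrite ffunE E mul0r.
Qed.

(** Filtering by all i in la keeps the terms of y that contain every such a_i; in degree [size la]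
    there is only one. *)
Lemma stable_hw (M : L -> Prop) (la : seq 'I_g) (y : L) : stable M -> uniq la -> M y ->
  degree_in (size la) y -> dot (monab F la [::]) y != 0 -> M (monab F la [::]).
Proof.
move=> HM ul My Hy; have [n ->] := monab_delta F ul (isT : uniq [::]).
set S0 := ab _ _; rewrite dotZl mulf_eq0 signr_eq0 /=.
have -> : dot (delta F S0) y = y S0.
  rewrite /dot (bigD1 S0) //= ffunE eqxx mul1r big1 ?addr0 // => S /negPf E.
  by rewrite ffunE E mul0r.
move=> yS0; have Mf : M (foldr (@filt g F) y la).
  elim: {ul Hy S0 yS0} la => //= i la IH; rewrite -filt_act //.
  have Mlo : M (rho (@srank g) (imx F (val (Sp_lo i))) (foldr (@filt g F) y la) - foldr (@filt g F) y la).
    by apply: stableB => //; apply: stable_act.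
  by apply: stableB => //; apply: stable_act.
apply: stableZ => //; have -> : delta F S0 = (y S0)^-1 *: foldr (@filt g F) y la; last exact: stableZ.
apply/ffunP => S; rewrite !ffunE filt_fold; case: ifPn => [/allP H|H]; last first.
  case: eqP => [E|]; last by rewrite scaler0.
  case/allP: H => i il; rewrite E mem_ab_l mem_ab_r !inE il //.
have [->|neq] := eqVneq S S0; first by rewrite [_ *: _]mulVf.
have [->|/Hy cS] := eqVneq (y S) 0; first by rewrite scaler0.
case/negP: neq; rewrite eq_sym eqEcard cS card_ab; apply/andP; split.
  apply/subsetP => j; rewrite inE -(splitK j); case: (split j) => i /=.
    by rewrite (unsplitK (inl i)) inE => /H/andP[].
  by rewrite (unsplitK (inr i)) inE.
by rewrite [X in (_ + X)%N](_ : _ = 0%N) ?addn0 ?cardsE ?(card_uniqP ul) //; apply: eq_card0 => j; rewrite !inE.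
Qed.

End Irreducible.

(** * The lattice and its reduction *)

Section WeylLattice.
Variables (g k : nat) (kg : (k <= g)%N).
Local Notation N := (g + g)%N.

Definition hwseq : seq 'I_g := [seq widen_ord kg i | i <- enum 'I_k].

Lemma size_hwseq : size hwseq = k.
Proof. by rewrite size_map size_enum_ord. Qed.

Lemma hwseq_uniq : uniq hwseq.
Proof. by rewrite map_inj_uniq ?enum_uniq // => i j /(congr1 val) /= /val_inj. Qed.

Lemma in_VB x y : in_V x -> in_V y -> @in_V g k (x - y).
Proof. exact: in_V_sub. Qed.

Lemma in_V_comb x y (c : int) : in_V x -> in_V y -> @in_V g k (x *~ c + y).
Proof.
move=> /asboolP Hx /asboolP Hy; apply/asboolP.
rewrite -/(V_pred (x *~ c + y)) -[V_pred _]/(_ \in @V_pred g k).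
apply: rpredD; last exact: Hy.
by case: c => n; [rewrite rpredMn | rewrite NegzE mulrNz rpredN rpredMn].
Qed.

Section Coefficients.
Variable R : idomainType.
Hypothesis two_nz : 2%:R != 0 :> R.
Local Notation L := {ffun {set 'I_N} -> R^o}.

Lemma phi_hw : phi R (hw_vec g k) = monab R hwseq [::].
Proof.
rewrite phi_wedge // /monab cats0 /hwseq -map_comp -word_unit [RHS]word_map.
apply: eq_word => i j; rewrite /unitv mxE /= rmorph_nat; congr (_%:R).
Qed.

(** The hypothesis on scalars covers Z and F_p: multiplication by a scalar is then repeated
    addition, under which the orbit lattice is closed. *)
Lemma stable_phiV : (forall c : R, exists n : int, c = n%:~R) ->
  stable (fun z : L => exists2 x, @in_V g k x & phi R x = z).
Proof.
move=> HR; split.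
- by exists 0; [rewrite -(subrr (hw_vec g k)); apply: in_VB; apply: in_V_hw | rewrite raddf0].
- move=> c _ _ [x Hx <-] [y Hy <-]; have [n ->] := HR c.
  by exists (x *~ n + y); [exact: in_V_comb | rewrite raddfD raddfMz /= scaler_int].
move=> A _ [x Hx <-]; exists (ext_act (val A) x); first exact: in_V_act.
by rewrite phi_act.
Qed.

Lemma primL_phiV z : (forall c : R, exists n : int, c = n%:~R) ->
  primL (g%:Z - k%:Z) z -> exists2 x, @in_V g k x & phi R x = z.
Proof.
move=> HR Hz; apply: (stable_primL two_nz (stable_phiV HR) hwseq_uniq); last by rewrite size_hwseq.
by exists (hw_vec g k); [apply: in_V_hw | rewrite phi_hw].
Qed.

(** The highest weight vector involves no b_i. Along the orbit, A passes to the other side as its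
    transpose, which is symplectic and commutes with E. *)
Lemma in_V_dotE x z : @in_V g k x -> dot (phi R x) (@E g R z) = 0.
Proof.
move=> Hx; elim: Hx z => [|x' y _ IHx _ IHy|A x' _ IH] z.
- have [n] := monab_delta R hwseq_uniq (isT : uniq [::]).
  rewrite phi_hw => ->; rewrite dotZl /dot; set S0 := ab _ _.
  rewrite (bigD1 S0) //= ffunE eqxx mul1r [X in _ + X]big1 ?addr0 => [|S /negPf E']; last first.
    by rewrite ffunE E' mul0r.
  rewrite /E sum_ffunE big1 ?mulr0 // => i _.
  by rewrite cr_cr_ab !inE andbF.
- by rewrite raddfB dotDl dotNl IHx IHy subrr.
rewrite phi_act // dot_rho //; last exact: srank_inj.
have -> : trf (imx R (val A)) = imx R (val (Sp_trmx A)).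
  by apply/funext => i; apply/funext => j; rewrite /trf /imx /= mxE.
by rewrite E_rho.
Qed.

Lemma dot_phi (t : incr k N) x : dot (mon0 R (@srank g) (codom (val t))) (phi R x) = (x t)%:~R.
Proof.
rewrite /phi (big_morph (dot _) (id1 := 0) (op1 := +%R)) => [|c d|]; rewrite ?dotDr ?dot0r //.
rewrite (bigD1 t) //= dotZr dot_mon0 // eqxx mulr1 big1 ?addr0 // => s /negPf neq.
by rewrite dotZr dot_mon0 // eq_sym neq mulr0.
Qed.

End Coefficients.

(* Membership in the orbit lattice is a linear condition; hence V(varpi_k) is a
   direct summand of Lambda^k H. *)
Lemma in_V_primL (x : ext k N) : in_V x <-> primL (g%:Z - k%:Z) (phi int x).
Proof.
split=> [Hx|/(primL_phiV (isT : 2%:R != 0 :> int))[]].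
- apply: primL_of_ker => [//|[|t] // _||z].
  + by rewrite pnatr_eq0.
  + exact: hdeg_phi.
  + exact: in_V_dotE.
- by move=> c; exists c; rewrite intz.
move=> y Hy Ephi; suff -> : x = y by [].
apply/ffunP => t; have := dot_phi (isT : 2%:R != 0 :> int) t x.
by rewrite -Ephi dot_phi // !intz => ->.
Qed.

Lemma prim_intr (R : comNzRingType) (I : finType) (U : {set I}) m (f : {ffun {set I} -> int^o}) :
  prim U m f -> prim U m ([ffun S : {set I} => (f S)%:~R] : {ffun {set I} -> R^o}).
Proof.
move=> [f1 f2]; split=> [S|J /f2 E'].
  by rewrite ffunE => H; apply: f1; apply: contraNneq H => ->.
rewrite /ssum; under eq_bigr => S _ do rewrite ffunE.
by rewrite -rmorph_sum /= -/(ssum f J) E'.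
Qed.

Lemma mon0_intr (R : idomainType) s S : mon0 R (@srank g) s S = (mon0 int (@srank g) s S)%:~R.
Proof.
elim: s S => [|j s IH] S /=; rewrite !ffunE; first by rewrite rmorph_nat.
case: ifP => // _; rewrite IH intrM /sgn rmorphXn /= rmorphN1 //.
Qed.

Lemma phi_intr (R : idomainType) (x : ext k N) S : phi R x S = (phi int x S)%:~R.
Proof.
rewrite /phi !sum_ffunE rmorph_sum; apply: eq_bigr => s _.
rewrite !ffunE mon0_intr intz; exact: (esym (intrM _ _ _)).
Qed.

Lemma primL_intr (R : idomainType) m (x : ext k N) : primL m (phi int x) -> primL m (phi R x).
Proof.
move=> H A B dAB.
have -> : comp A B (phi R x) = [ffun S => (comp A B (phi int x) S)%:~R].
  apply/ffunP => K; rewrite [LHS]ffunE [RHS]ffunE [in RHS]ffunE.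
  by case: ifP => _; [rewrite (phi_intr R) | rewrite mulr0z].
exact/prim_intr/H.
Qed.

End WeylLattice.

(** * V_p(varpi_k) as the space of primitive vectors over F_p *)

Section ModularWeyl.
Variables (p : nat) (p_prime : prime p) (p_ge3 : (3 <= p)%N) (g : nat).
Local Notation N := (g + g)%N.
Local Notation F := 'F_p.
Local Notation L := {ffun {set 'I_N} -> F^o}.
Local Notation act A := (rho (@srank g) (imx F (val A))).
Implicit Types (k : nat) (A : Sp g).

Lemma Fp_nat_eq0 (t : nat) : (t%:R == 0 :> F) = (p %| t)%N.
Proof. by rewrite -(dvdn_pcharf (pchar_Fp p_prime)). Qed.

Lemma Fp_p : p%:R = 0 :> F.
Proof. by apply/eqP; rewrite Fp_nat_eq0. Qed.

Lemma Fp_small t : (0 < t < p)%N -> t%:R != 0 :> F.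
Proof. by move=> /andP[t0 tp]; rewrite Fp_nat_eq0 gtnNdvd. Qed.

Lemma Fp_two : 2%:R != 0 :> F.
Proof. exact: Fp_small. Qed.

Lemma Fp_intr_eq0 (n : int) : n%:~R = 0 :> F -> exists m, n = m *+ p.
Proof.
move=> n0; have : (p %| `|n|)%N.
  rewrite -Fp_nat_eq0; case: n n0 => n /= n0; first by rewrite pmulrn n0.
  by apply/eqP; rewrite -oppr0 -n0 NegzE mulrNz opprK.
move=> /dvdnP[m E]; exists (if n < 0 then - m%:Z else m%:Z).
by case: n E {n0} => n /= E; rewrite ?NegzE -mulr_natr natz; lia.
Qed.

Lemma Fp_intr (c : F) : exists n : int, c = n%:~R.
Proof. by exists (c : nat)%:Z; rewrite -pmulrn natr_Zp. Qed.

Definition theta k (q : VmodpV_rep p_prime g k) : L :=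
  phi F (val (repr (q : {ideal_quot (@pV p g k)}))).

Lemma theta_pi k (x : V g k) : theta (V_pi p_prime x) = phi F (val x).
Proof.
rewrite /theta; set x' := repr _; have : V_pi p_prime (x' - x) = 0.
  by rewrite raddfB; apply/eqP; rewrite subr_eq0; apply/eqP/reprK.
move=> /V_pi_eq0[y] /(congr1 (fun z => phi F (val z))).
rewrite [val _]raddfB [val (y *+ p)]raddfMn /= raddfB raddfMn /= -scaler_nat Fp_p scale0r => /eqP.
by rewrite subr_eq0 => /eqP.
Qed.

Lemma theta_linear k : linear (@theta k).
Proof.
move=> c q r; have [[x <-] [y <-]] := (V_piP q, V_piP r).
rewrite -[c *: V_pi _ x]raddfMn -raddfD !theta_pi.
have -> : val (x *+ c + y) = val x *+ c + val y by rewrite raddfD raddfMn.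
by rewrite raddfD raddfMn /= -scaler_nat natr_Zp.
Qed.

Lemma theta_act k A (q : VmodpV_rep p_prime g k) : theta (rep_act A q) = act A (theta q).
Proof.
have [x <-] := V_piP q; rewrite /= VmodpV_act_pi !theta_pi /= phi_act //; exact: Fp_two.
Qed.

Lemma prim_div (I : finType) (U : {set I}) m (f : {ffun {set I} -> int^o}) :
  prim U m (f *+ p) -> prim U m f.
Proof.
have p_nz : p%:Z != 0 by rewrite eqz_nat -lt0n prime_gt0.
rewrite -scaler_nat => -[f1 f2]; split=> [S fS|J /f2].
  by apply: f1; rewrite ffunE; apply: mulf_neq0; rewrite ?natz.
by rewrite ssumZ natz => /eqP; rewrite mulf_eq0 (negPf p_nz) => /eqP.
Qed.

Section Fundamental.
Variables (k : nat) (kg : (k <= g)%N).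

(** Saturation: if all coordinates of x in V are divisible by p, the quotient satisfies the same
    linear equations over Z, so it lies in V again. *)
Lemma theta_eq0 (q : VmodpV_rep p_prime g k) : theta q = 0 -> q = 0.
Proof.
have [x <-] := V_piP q; rewrite theta_pi => x0; apply/V_pi_eq0.
have Hy t : exists m : int, val x t = m *+ p.
  by apply: Fp_intr_eq0; rewrite -(dot_phi Fp_two) x0 dot0r.
have [y0 Hy0] := choice Hy; pose y : ext k N := [ffun t => y0 t].
have Ey : val x = y *+ p by apply/ffunP => t; rewrite Hy0 ffunMnE ffunE.
have Vy : y \in @V_pred g k.
  apply/asboolP/(in_V_primL kg) => A B dAB; apply: prim_div.
  rewrite -raddfMn -raddfMn -Ey.
  by have /asboolP/(in_V_primL kg) := valP x; apply.
exists (Sub y Vy); apply: val_inj.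
by rewrite Ey [RHS]raddfMn.
Qed.

(** Integral equations reduce modulo p, which gives one inclusion; the other is generation by the
    highest weight vector over F_p itself. *)
Lemma primL_theta z : primL (g%:Z - k%:Z) z <-> exists q : VmodpV_rep p_prime g k, theta q = z.
Proof.
split=> [/(primL_phiV kg Fp_two Fp_intr)[x Hx <-]|[q <-]].
  have Vx : x \in @V_pred g k by apply/asboolP.
  by exists (V_pi p_prime (Sub x Vx : V g k)); rewrite theta_pi.
have [x <-] := V_piP q; rewrite theta_pi; apply: primL_intr.
by apply/(in_V_primL kg)/asboolP/(valP x).
Qed.

Lemma theta_hw : theta (V_pi p_prime (V_hw g k)) = monab F (hwseq kg) [::].
Proof. by rewrite theta_pi phi_hw //; exact: Fp_two. Qed.

Lemma V_hw_generates : generates (V_pi p_prime (V_hw g k) : VmodpV_rep p_prime g k).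
Proof.
move=> M [M0 MD MA] Mv y; have [x <-] := V_piP y.
suff claim z : in_V z -> forall Hz : z \in @V_pred g k, M (V_pi p_prime (Sub z Hz : V g k)).
  have -> : x = Sub (val x) (valP x) by apply: val_inj.
  by apply: claim; apply/asboolP/(valP x).
elim=> [|x1 x2 H1 IH1 H2 IH2|A x1 H1 IH1] Hx.
- by have -> : (Sub (hw_vec g k) Hx : V g k) = V_hw g k by apply: val_inj.
- have P1 : x1 \in @V_pred g k by apply/asboolP.
  have P2 : x2 \in @V_pred g k by apply/asboolP.
  have -> : (Sub (x1 - x2) Hx : V g k) = (Sub x1 P1 : V g k) - Sub x2 P2 by apply: val_inj.
  by rewrite raddfB addrC -scaleN1r; apply: MD; [exact: IH2|exact: IH1].
have P1 : x1 \in @V_pred g k by apply/asboolP.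
have -> : (Sub (ext_act (val A) x1) Hx : V g k) = V_act A (Sub x1 P1 : V g k) by apply: val_inj.
by rewrite -VmodpV_act_pi; apply: (MA A).
Qed.

End Fundamental.

Definition vtheta (k : int) : Vp p_prime g k -> L :=
  match k return Vp p_prime g k -> L with Posz n => @theta n | Negz _ => fun _ => 0 end.

Lemma vtheta_linear (k : int) : linear (@vtheta k).
Proof. by case: k => k /=; [apply: theta_linear | move=> c q r; rewrite scaler0 addr0]. Qed.

HB.instance Definition _ (k : int) :=
  GRing.isLinear.Build F (Vp p_prime g k) L *:%R (@vtheta k) (@vtheta_linear k).

Lemma vtheta_act (k : int) A (q : Vp p_prime g k) : vtheta (rep_act A q) = act A (vtheta q).
Proof. by case: k q => k q /=; [apply: theta_act | rewrite linear0]. Qed.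

Lemma vtheta_eq0 (k : int) (q : Vp p_prime g k) : k <= g%:Z -> vtheta q = 0 -> q = 0.
Proof.
case: k q => k q kg /=; first exact: theta_eq0.
by move=> _; apply/rowP => -[].
Qed.

Lemma vtheta_inj (k : int) (q r : Vp p_prime g k) : k <= g%:Z -> vtheta q = vtheta r -> q = r.
Proof.
move=> kg E; have := vtheta_linear (-1) q r; rewrite E !scaleN1r addNr.
move/(vtheta_eq0 kg)/eqP; rewrite addrC subr_eq0.
by move=> /eqP ->.
Qed.

Lemma primL_vtheta (k : int) z : k <= g%:Z ->
  (primL (g%:Z - k) z <-> exists q : Vp p_prime g k, vtheta q = z).
Proof.
case: k => k kg; first exact: primL_theta.
split=> [Hz|[q <-]]; last exact: primL0.
(* For k < 0 the weight g - k exceeds g, hence the size of every index set, and only 0 is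
   primitive. *)
exists 0; apply: comp_inj => A B dAB; rewrite linear0; apply/ffunP => S.
rewrite ffunE; apply/esym/eqP/negPn/negP => /((Hz A B dAB).1)[_].
have := subset_leq_card (subsetT (~: (A :|: B))); rewrite cardsT card_ord NegzE.
by move: #|~: _| #|S| => n1 n2; lia.
Qed.

Lemma hom_of_op (k1 k2 : int) (D : {linear L -> L}) : k1 <= g%:Z -> k2 <= g%:Z ->
  (forall A y, act A (D y) = D (act A y)) ->
  (forall y, primL (g%:Z - k1) y -> primL (g%:Z - k2) (D y)) ->
  exists d : rep_hom (Vp p_prime g k1) (Vp p_prime g k2), forall q, vtheta (d q) = D (vtheta q).
Proof.
move=> k1g k2g DA DP.
have ex q : exists r : Vp p_prime g k2, vtheta r = D (vtheta (q : Vp p_prime g k1)).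
  by apply/primL_vtheta => //; apply: DP; apply/primL_vtheta => //; exists q.
have [f Hf] := choice ex.
have f_lin : linear f.
  by move=> c q r; apply: (vtheta_inj k2g); rewrite vtheta_linear !Hf vtheta_linear linearP.
pose mf := GRing.isLinear.Build _ _ _ _ f f_lin.
pose fL : {linear Vp p_prime g k1 -> Vp p_prime g k2} := HB.pack f mf.
have fA A q : fL (rep_act A q) = rep_act A (fL q).
  by apply: (vtheta_inj k2g); rewrite /= vtheta_act !Hf vtheta_act DA.
by exists (RepHom fA) => q; rewrite /= Hf.
Qed.

End ModularWeyl.

(** * The resolution *)

Section Resolution.
Variables (p : nat) (p_prime : prime p) (p_ge3 : (3 <= p)%N) (g : nat).
Local Notation N := (g + g)%N.
Local Notation F := 'F_p.
Local Notation L := {ffun {set 'I_N} -> F^o}.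
Local Notation act A := (rho (@srank g) (imx F (val A))).
Local Notation E := (@E g F).

Definition Epow n (y : L) : L := iter n E y.

Lemma Epow_is_linear n : linear (Epow n).
Proof. by elim: n => // n IH c y z; rewrite /Epow !iterS -/(Epow n _) IH linearP. Qed.
HB.instance Definition _ n := GRing.isLinear.Build F L L *:%R (Epow n) (Epow_is_linear n).

Lemma iter_E_act n (A : Sp g) y : act A (iter n E y) = iter n E (act A y).
Proof. by elim: n => // n IH; rewrite !iterS E_rho ?IH //; apply: Fp_two. Qed.

Definition step (c n : nat) : nat := if odd n then (p - c)%N else c.

(** The reflection from l to its partner replaces c by p - c and raises q by one; lowering an index
    by 2p raises q by two. *)
Lemma res_indexE (l : int) (c n : nat) : (0 < c < p)%N -> l = g%:Z + 1 - c%:Z ->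
  g%:Z - res_index p l (2 * (g%:Z - p%:Z + 1) - l) n = block p (step c n) n.
Proof.
move=> cp El; have [m] := ubnP n; elim: m n => // m IH [|[|n]] Hn.
- by rewrite /block /step /= El; lia.
- by rewrite /block /step /= El; lia.
have := IH n; rewrite /block /step /= negbK => /(_ ltac:(lia)).
by case: (odd n); move: (res_index _ _ _ _) => r; lia.
Qed.

Section Main.
Variables (k : nat) (kg : (k <= g)%N) (W : rep F (Sp g)).
Hypotheses (W_irr : irreducible W).
Variable (e : rep_hom (Vp p_prime g k) W).
Let v : Vp p_prime g k := V_pi p_prime (V_hw g k).
Hypothesis e_gen : generates (e v).

Lemma cover_surj w : exists x, e x = w.
Proof.
apply: (e_gen (N := fun w => exists x, e x = w)); last by exists v.
split=> [|c _ _ [x <-] [y <-]|A _ [x <-]]; first by exists 0; rewrite linear0.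
  by exists (c *: x + y); rewrite linearP.
by exists (rep_act A x); rewrite rep_funE.
Qed.

Lemma cover_hw : e v != 0.
Proof.
apply/eqP => ev0; have [[w w_nz] _] := W_irr; case/eqP: w_nz.
apply: (e_gen (N := fun w => w = 0)) => //; split=> // [c _ _ -> ->|A _ ->].
  by rewrite scaler0 addr0.
by rewrite linear0.
Qed.

Local Notation th := (@vtheta p p_prime g k).

(** A kernel vector not orthogonal to v would put v into the kernel, by [stable_hw]. So the
    orthogonal of the kernel contains v; being a subrepresentation by contravariance, it is
    everything. *)
Lemma ker_orthogonal x z : e x = 0 -> dot (th x) (th z) = 0.
Proof.
have orth_v y : e y = 0 -> dot (th y) (th v) = 0.
  move=> ey0; apply/eqP/negPn/negP => nz.
  pose M (u : L) := exists2 q, e q = 0 & th q = u.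
  have HM : stable M.
    split=> [|c _ _ [q eq <-] [r er <-]|A _ [q eq <-]].
    - by exists 0; rewrite linear0.
    - by exists (c *: q + r); [rewrite linearP /= eq er scaler0 addr0 | rewrite vtheta_linear].
    by exists (rep_act A q); [rewrite rep_funE eq linear0 | rewrite vtheta_act].
  have Mv : M (monab F (hwseq kg) [::]).
    apply: (stable_hw (Fp_two p_prime p_ge3) HM (hwseq_uniq kg) (y := th y)).
    - by exists y.
    - by rewrite size_hwseq; apply: hdeg_phi.
    by rewrite -(theta_hw p_prime p_ge3 kg) dotC.
  have [q eq thq] := Mv; case/eqP: cover_hw; rewrite -eq; congr (e _).
  have kgZ : k%:Z <= g%:Z by rewrite lez_nat.
  apply: (@vtheta_inj p p_prime p_ge3 g k _ _ kgZ).
  by rewrite thq; exact: (theta_hw p_prime p_ge3 kg).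
pose M (z : Vp p_prime g k) := forall x, e x = 0 -> dot (th x) (th z) = 0.
have subM : subrep M.
  split=> [y _|c y z' Hy Hz y' ey|A y Hy y' ey].
  - by rewrite linear0 dot0r.
  - move: (Hy _ ey) (Hz _ ey); rewrite vtheta_linear dotDr dotZr.
    by move: (th y) (th z') (th y') => u w u' -> ->; rewrite mulr0 addr0.
  rewrite (vtheta_act p_ge3) dotC dot_rho; [|exact: srank_inj|exact: Fp_two].
  have -> : trf (imx F (val A)) = imx F (val (Sp_trmx A)).
    by apply/funext => i; apply/funext => j; rewrite /trf /imx /= mxE.
  by rewrite -(vtheta_act p_ge3) dotC; apply: Hy; rewrite rep_funE ey linear0.
have G : forall z, M z := @V_hw_generates p p_prime g k M subM orth_v.
exact: G.
Qed.

(** If the radical had nonzero image, it would map onto W, and v would be a radical vector plus a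
    kernel vector. Both are orthogonal to v, yet v pairs with itself to 1. *)
Lemma radical_ker x : (forall z, dot (th x) (th z) = 0) -> e x = 0.
Proof.
pose M (y : Vp p_prime g k) := forall z, dot (th y) (th z) = 0.
have subM : subrep M.
  split=> [z|c y y' Hy Hy' z|A y Hy z].
  - by rewrite linear0 dot0l.
  - move: (Hy z) (Hy' z); rewrite vtheta_linear dotDl dotZl.
    by move: (th y) (th z) (th y') => u w u' -> ->; rewrite mulr0 addr0.
  rewrite (vtheta_act p_ge3) dot_rho; [|exact: srank_inj|exact: Fp_two].
  have -> : trf (imx F (val A)) = imx F (val (Sp_trmx A)).
    by apply/funext => i; apply/funext => j; rewrite /trf /imx /= mxE.
  by rewrite -(vtheta_act p_ge3); apply: Hy.
move=> Mx; pose M' (w : W) := exists2 y, M y & e y = w.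
have subM' : subrep M'.
  case: subM => M0 MD MA; split=> [|c _ _ [y My <-] [y' My' <-]|A _ [y My <-]].
  - by exists 0; rewrite ?linear0.
  - by exists (c *: y + y'); [exact: MD | rewrite linearP].
  by exists (rep_act A y); [exact: MA | rewrite rep_funE].
case: W_irr => _ /(_ M' subM')[H|H]; first by apply: H; exists x.
have [y My ey] := H (e v).
have E0 : e (-1 *: y + v) = 0 by rewrite linearP /= ey scaleN1r addNr.
have thv : th v = monab F (hwseq kg) [::] := theta_hw p_prime p_ge3 kg.
move: (ker_orthogonal v E0) (My v); rewrite vtheta_linear thv; move: (th y) => u.
move=> + E1; rewrite dotDl dotZl E1 mulr0 add0r dot_monab ?hwseq_uniq // => /eqP.
Qed.

End Main.

Lemma cover_exists (l : int) (W : rep F (Sp g)) : l <= g%:Z -> is_Vbar p_prime l W ->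
  exists e : rep_hom (Vp p_prime g l) W,
    [/\ forall w, exists x, e x = w,
       forall x z, e x = 0 -> dot (@vtheta p p_prime g l x) (@vtheta p p_prime g l z) = 0 &
       forall x, (forall z, dot (@vtheta p p_prime g l x) (@vtheta p p_prime g l z) = 0) -> e x = 0].
Proof.
case: l => k /= kg; last first.
  move=> W0; pose f (x : zero_rep F (Sp g)) : W := 0.
  have f_lin : linear f by move=> c x y; rewrite /f scaler0 addr0.
  pose fL : {linear zero_rep F (Sp g) -> W} := HB.pack f (GRing.isLinear.Build _ _ _ _ f f_lin).
  have fA (A : Sp g) x : fL (rep_act A x) = rep_act A (fL x) by rewrite /= /f linear0.
  exists (RepHom fA); split=> [w|x z _|x _] //; last by rewrite dot0l.
  by exists 0; rewrite [w]W0.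
rewrite lez_nat in kg; case=> W_irr [M [f [subM Mv fD fA f_gen]]].
(* The subrepresentation M contains the generator, so it is everything and the subquotient is a
   quotient. *)
have MT := @V_hw_generates p p_prime g k M subM Mv.
have f_lin : linear f by move=> c x y; apply: fD.
pose fL : {linear Vp p_prime g k -> W} := HB.pack f (GRing.isLinear.Build _ _ _ _ f f_lin).
have fLA (A : Sp g) x : fL (rep_act A x) = rep_act A (fL x) by apply: fA.
exists (RepHom fLA); split.
- exact: (cover_surj (e := RepHom fLA) f_gen).
- exact: (ker_orthogonal kg W_irr (e := RepHom fLA) f_gen).
exact: (radical_ker kg W_irr (e := RepHom fLA) f_gen).
Qed.

End Resolution.

Theorem mainTheorem6 (p : nat) (p_prime : prime p) (p_ge3 : (3 <= p)%N)
    (g : nat) (g_ge1 : (1 <= g)%N)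
    (l : int) (l_ge : g%:Z - p%:Z + 2 <= l) (l_le : l <= g%:Z)
    (Vbar : rep 'F_p (Sp g)) (Vbar_spec : is_Vbar p_prime l Vbar) :
  let l' := 2 * (g%:Z - p%:Z + 1) - l in
  has_resolution (fun n => Vp p_prime g (res_index p l l' n)) Vbar.
Proof.
(* The bounds on l say exactly that c = g + 1 - l lies strictly between 0 and p. *)
move=> l'; have [c cp El] : exists2 c, (0 < c < p)%N & l = g%:Z + 1 - c%:Z.
  by exists (absz (g%:Z + 1 - l)%R); lia.
pose r := res_index p l l'; pose cs := step p c.
have Er n : g%:Z - r n = block p (cs n) n by apply: res_indexE.
have csp n : (0 < cs n < p)%N by rewrite /cs /step; case: (odd n); lia.
have csS n : (p - cs n)%N = cs n.+1.
  by rewrite /cs /step /=; case: (odd n) => //=; rewrite subKn //; lia.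
have rg n : r n <= g%:Z by have := Er n; rewrite /block; have := csp n; lia.
have Fp0 := Fp_p p_prime; have Fps := Fp_small p_prime.
have ex n : exists d : rep_hom (Vp p_prime g (r n.+1)) (Vp p_prime g (r n)),
    forall q, @vtheta p p_prime g _ (d q) = iter (p - cs n) (@E g 'F_p) (@vtheta p p_prime g _ q).
  have [||d Hd] := @hom_of_op p p_prime p_ge3 g (r n.+1) (r n)
    (@Epow p g (p - cs n)) (rg n.+1) (rg n).
  - by move=> A y; apply: iter_E_act.
  - by move=> y; rewrite !Er -csS; apply: E_primL.
  by exists d.
pose d n := projT1 (cid (ex n)).
have Hd n q : @vtheta p p_prime g _ (d n q) = iter (p - cs n) (@E g 'F_p) (@vtheta p p_prime g _ q).
  exact: (projT2 (cid (ex n))).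
have img n x : resL_ker p (cs n) n (@vtheta p p_prime g (r n) x) -> exists y, d n y = x.
  move=> Kx; have Px : primL (block p (cs n) n) (@vtheta p p_prime g (r n) x).
    by rewrite -Er; apply/(primL_vtheta p_prime p_ge3 _ (rg n)); exists x.
  have [w Hw Ew] := resL_exact p_prime Fp0 Fps (csp n) Px Kx.
  move: Hw; rewrite csS -Er => /(primL_vtheta p_prime p_ge3 _ (rg n.+1))[y Ey].
  by exists y; apply: (vtheta_inj p_ge3 (rg n)); rewrite Hd Ey -Ew.
have exact_pos n x : d n x = 0 <-> exists y, d n.+1 y = x.
  split=> [dx0|[y <-]].
    apply: (img n.+1 x); rewrite /resL_ker -csS.
    by apply: etrans (esym (Hd n x)) _; rewrite dx0 linear0.
  apply: (vtheta_eq0 p_ge3 (rg n)); rewrite !Hd -iterD.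
  have -> : (p - cs n + (p - cs n.+1))%N = p by rewrite csS subnKC // ltnW //; case/andP: (csp n.+1).
  exact: E_iter_char.
have [e [e_surj e_orth e_rad]] := cover_exists p_ge3 l_le Vbar_spec.
exists d, e; split => // x; split=> [ex0|[y <-]].
  (* At n = 0 the kernel condition of [resL_exact] is membership in the radical, which contains the
     kernel of e. *)
  apply: (img 0%N) => z; rewrite -(Er 0%N) => /(primL_vtheta p_prime p_ge3 _ (rg 0%N))[q <-].
  exact: e_orth.
apply: e_rad => z.
have -> : @vtheta p p_prime g l (d 0%N y) = iter (p - cs 0%N) (@E g 'F_p) (@vtheta p p_prime g _ y) by apply: Hd.
apply: (E_dot_primL p_prime Fp0 Fps (csp 0%N)).
  by rewrite csS -Er; apply/(primL_vtheta p_prime p_ge3 _ (rg 1%N)); exists y.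
by rewrite -(Er 0%N); apply/(primL_vtheta p_prime p_ge3 _ (rg 0%N)); exists z.
Qed.
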